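(* Fix integers $d\ge 1$, $q\ge 2$ and a real number $\epsilon>0$. Let $r=r(n)$ be a sequence of integers with $1\le r\le n$, and let $\sigma=(\sigma_v)_{v\in\Lambda_n}$ be i.i.d. labels uniform on $\{1,\ldots,q\}$. Then the following hold. (1) If $d=1$: the labeling configuration is identifiable with probability tending to $1$ as $n\to\infty$ when $r\ge \frac{2(1+\epsilon)\log n}{\log q}$ (for all $n$), and is non-identifiable with probability tending to $1$ as $n\to\infty$ when $r\le \frac{2(1-\epsilon)\log n}{\log q}$ (for all $n$). (2) If $d\ge 2$: the labeling configuration is identifiable with probability tending to $1$ as $n\to\infty$ when $r^d\ge \frac{d(1+\epsilon)\log n}{\log q}$ (for all $n$), and is non-identifiable with probability tending to $1$ as $n\to\infty$ when $r^d\le \frac{d(1-\epsilon)\log n}{\log q}$ (for all $n$). (3) In each of the identifiable regimes in (1) and (2), the labeling can be recovered by a polynomial-time algorithm: there is an algorithm running in time polynomial in $n$ which, given the empirical profile $\{\sigma|_B: B\in\mathfrak B_{n,r}\}$, outputs $\sigma$ with probability tending to $1$ as $n\to\infty$.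
   Context: $\Lambda_n=\{v\in\mathbb Z^d: 0\le v_i\le n-1 \text{ for all } 1\le i\le d\}$. An $r$-box is a translate of $\Lambda_r$ (a box with $r^d$ vertices); $\mathfrak B_{n,r}$ is the collection of all $r$-boxes contained in $\Lambda_n$. For $B\in\mathfrak B_{n,r}$ let $\tau_B$ be the translation mapping $B$ to $\Lambda_r$, and let $\sigma|_B=(\sigma_{\tau_B^{-1}(v)})_{v\in\Lambda_r}$, a labeling of $\Lambda_r$. The empirical profile of $\sigma$ is the multiset $\{\sigma|_B: B\in\mathfrak B_{n,r}\}$ (labeling configurations on all $r$-boxes, with no information about their locations; the orientation of each box is observed). The labeling configuration $\sigma$ is non-identifiable if there is a labeling configuration $\sigma'\ne\sigma$ on $\Lambda_n$ with the same empirical profile as $\sigma$; otherwise it is identifiable. *)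

(* Defs.v *)
From HB Require Import structures.
From mathcomp Require Import all_boot all_order all_algebra.
From mathcomp Require Import finmap multiset.
From mathcomp Require Import all_classical all_reals all_analysis.
Set Implicit Arguments.
Unset Strict Implicit.
Unset Printing Implicit Defensive.
Import Order.TTheory GRing.Theory Num.Theory.
Import numFieldNormedType.Exports.

Local Open Scope mset_scope.
Local Open Scope classical_set_scope.
Local Open Scope nat_scope.

Definition Lambda (d n : nat) := d.-tuple 'I_n.

(* The q labels are numbered 0, ..., q - 1. *)
Definition config (d n q : nat) := {ffun Lambda d n -> 'I_q}.

(* The r-box c + Lambda_r is represented by its least corner c. *)
Definition boxes (d n r : nat) : {set Lambda d n} :=
  [set c : Lambda d n | [forall i, tnth c i + r <= n]]%SET.

(* The vertex c + v, i.e. the preimage of v under the translation that maps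
   c + Lambda_r to Lambda_r.  The default value of [insubd] is never reached
   when c \in boxes d n r, see [tnth_box_vertex]. *)
Definition box_vertex (d n r : nat) (c : Lambda d n) (v : Lambda d r) :
    Lambda d n :=
  [tuple insubd (tnth c i) (tnth c i + tnth v i) | i < d].

Lemma tnth_box_vertex d n r (c : Lambda d n) (v : Lambda d r) (i : 'I_d) :
  c \in boxes d n r ->
  tnth (box_vertex c v) i = tnth c i + tnth v i :> nat.
Proof.
rewrite inE => /forallP/(_ i) cr; rewrite tnth_mktuple val_insubd.
by rewrite ifT// (leq_trans _ cr)// -addnS leq_add2l ltn_ord.
Qed.

Definition restrict (d n q r : nat) (s : config d n q) (c : Lambda d n) :
    config d r q :=
  [ffun v => s (box_vertex c v)].

Definition profile (d n q r : nat) (s : config d n q) : {mset config d r q} :=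
  seq_mset [seq restrict r s c | c in boxes d n r].

Definition nonidentifiable (d n q r : nat) (s : config d n q) : Prop :=
  exists s' : config d n q, s' <> s /\ profile r s' = profile r s.

Definition identifiable (d n q r : nat) (s : config d n q) : Prop :=
  ~ nonidentifiable r s.

Section Probability.
Local Open Scope ring_scope.

Definition label_pmf (R : realType) (q : nat) (_ : 'I_q) : R := q%:R^-1.

(* Joint law of independent labels with common law [label_pmf]. *)
Definition config_pmf (R : realType) (d n q : nat) (s : config d n q) : R :=
  \prod_(v : Lambda d n) label_pmf R (s v).

Definition prob (R : realType) (d n q : nat) (E : set (config d n q)) : R :=
  \sum_(s : config d n q | s \in E) config_pmf R s.

Lemma prob_setT (R : realType) (d n q : nat) :
  (0 < q)%N -> prob R [set: config d n q] = 1.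
Proof.
move=> q0; rewrite /prob; under eq_bigl do rewrite in_setT.
rewrite /config_pmf.
rewrite -(bigA_distr_bigA (fun (_ : Lambda d n) (x : 'I_q) => label_pmf R x)).
rewrite big1// => v _; rewrite /label_pmf sumr_const card_ord -[LHS]mulr_natl.
by rewrite divff// pnatr_eq0 -lt0n.
Qed.

Definition whp (R : realType) (d q : nat) (E : forall n, set (config d n q)) :
    Prop :=
  (fun n => prob R (E n)) @ \oo --> (1 : R).

End Probability.

(* Machine model: Jones' WHILE language over binary trees (N. D. Jones,
   "Computability and Complexity", MIT Press, 1997), with one time unit per
   constructor of an evaluated expression and per executed command.  Trees can
   be stored with shared subtrees, so each time unit is a bounded number of
   pointer operations; the polynomial-time functions of this model whose
   outputs have polynomial size are those of Turing machines. *)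
Inductive tree : Type := Leaf | Node of tree & tree.

Inductive expr : Type :=
| Var of nat
| Nil
| Cons of expr & expr
| Hd of expr
| Tl of expr.

Inductive cmd : Type :=
| Skip
| Assign of nat & expr
| Seq of cmd & cmd
| If of expr & cmd & cmd
| While of expr & cmd.

Definition store := nat -> tree.

Definition update (m : store) (x : nat) (t : tree) : store :=
  fun y => if y == x then t else m y.

Definition left_child (t : tree) : tree := if t is Node a _ then a else Leaf.
Definition right_child (t : tree) : tree := if t is Node _ b then b else Leaf.
Definition is_node (t : tree) : bool := if t is Node _ _ then true else false.

Fixpoint eval (m : store) (e : expr) : tree :=
  match e with
  | Var x => m x
  | Nil => Leaf
  | Cons e1 e2 => Node (eval m e1) (eval m e2)
  | Hd e1 => left_child (eval m e1)
  | Tl e1 => right_child (eval m e1)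
  end.

Fixpoint cost (e : expr) : nat :=
  match e with
  | Var _ | Nil => 1
  | Cons e1 e2 => (cost e1 + cost e2).+1
  | Hd e1 | Tl e1 => (cost e1).+1
  end.

(* [exec c m t m']: started in store m, the command c halts after exactly t
   time units in store m'. *)
Inductive exec : cmd -> store -> nat -> store -> Prop :=
| ExecSkip m : exec Skip m 1 m
| ExecAssign x e m :
    exec (Assign x e) m (cost e).+1 (update m x (eval m e))
| ExecSeq c1 c2 m m1 m2 t1 t2 :
    exec c1 m t1 m1 -> exec c2 m1 t2 m2 ->
    exec (Seq c1 c2) m (t1 + t2).+1 m2
| ExecIfTrue e c1 c2 m m' t :
    is_node (eval m e) -> exec c1 m t m' ->
    exec (If e c1 c2) m (cost e + t).+1 m'
| ExecIfFalse e c1 c2 m m' t :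
    ~~ is_node (eval m e) -> exec c2 m t m' ->
    exec (If e c1 c2) m (cost e + t).+1 m'
| ExecWhileFalse e c m :
    ~~ is_node (eval m e) -> exec (While e c) m (cost e).+1 m
| ExecWhileTrue e c m m1 m2 t1 t2 :
    is_node (eval m e) -> exec c m t1 m1 -> exec (While e c) m1 t2 m2 ->
    exec (While e c) m (cost e + t1 + t2).+1 m2.

Lemma exec_det c m t1 m1 t2 m2 :
  exec c m t1 m1 -> exec c m t2 m2 -> t1 = t2 /\ m1 = m2.
Proof.
move=> E; elim: E t2 m2 => {c m t1 m1}.
- by move=> m t2 m2 E; inversion E.
- by move=> x e m t2 m2 E; inversion E.
- move=> c1 c2 m m1 m2 t1 t2 _ IH1 _ IH2 t3 m3 E.
  inversion E as [| |? ? ? ? ? ? ? E1 E2| | | |]; subst.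
  by have [? ?] := IH1 _ _ E1; subst; have [? ?] := IH2 _ _ E2; subst.
- move=> e c1 c2 m m' t h _ IH t2 m2 E.
  inversion E as [| | |? ? ? ? ? ? _ E1|? ? ? ? ? ? h' _| |]; subst.
    by have [? ?] := IH _ _ E1; subst.
  by rewrite h in h'.
- move=> e c1 c2 m m' t h _ IH t2 m2 E.
  inversion E as [| | |? ? ? ? ? ? h' _|? ? ? ? ? ? _ E1| |]; subst.
    by rewrite h' in h.
  by have [? ?] := IH _ _ E1; subst.
- move=> e c m h t2 m2 E.
  inversion E as [| | | | | |? ? ? ? ? ? ? h' _ _]; subst => //.
  by rewrite h' in h.
- move=> e c m m1 m2 t1 t2 h _ IH1 _ IH2 t3 m3 E.
  inversion E as [| | | | |? ? ? h'|? ? ? ? ? ? ? _ E1 E2]; subst.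
    by rewrite h in h'.
  by have [? ?] := IH1 _ _ E1; subst; have [? ?] := IH2 _ _ E2; subst.
Qed.

(* Variable 0 holds the input at the start and the output at the end; all
   other variables are initially [Leaf]. *)
Definition runs (c : cmd) (input : tree) (t : nat) (output : tree) : Prop :=
  exists m : store, exec c (update (fun=> Leaf) 0 input) t m /\ m 0 = output.

Definition enc_seq (s : seq tree) : tree := foldr Node Leaf s.

Definition enc_nat (k : nat) : tree := iter k (Node Leaf) Leaf.

(* A labeling of Lambda_n is encoded as a d-dimensional array: the list, over
   the first coordinate 0, ..., n - 1, of the (d-1)-dimensional slices. *)
Fixpoint enc_array (d n : nat) : (Lambda d n -> tree) -> tree :=
  match d return (Lambda d n -> tree) -> tree with
  | 0 => fun f => f [tuple]
  | d'.+1 => fun f =>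
      enc_seq [seq enc_array (fun w : Lambda d' n => f [tuple of x :: w])
              | x <- enum 'I_n]
  end.

Definition enc_config (d n q : nat) (s : config d n q) : tree :=
  enc_array (fun v => enc_nat (s v)).

Definition enc_list (d n q : nat) (l : seq (config d n q)) : tree :=
  enc_seq [seq enc_config s | s <- l].

(* A multiset is given to a program as a list of its elements, in an arbitrary
   order that carries no information on the locations of the boxes. *)
Definition lists_profile (d n q r : nat) (s : config d n q)
    (l : seq (config d r q)) : Prop :=
  seq_mset l = profile r s.

Definition poly_time (d q : nat) (r : nat -> nat) (c : cmd) : Prop :=
  exists C k : nat,
    forall (n : nat) (s : config d n q) (l : seq (config d (r n) q)),
      lists_profile s l ->
      exists t out, runs c (enc_list l) t out /\ t <= C * n.+1 ^ k.

Definition recovers (d n q r : nat) (c : cmd) (s : config d n q) : Prop :=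
  forall l : seq (config d r q),
    lists_profile s l -> exists t, runs c (enc_list l) t (enc_config s).

Definition poly_time_recoverable (R : realType) (d q : nat) (r : nat -> nat) :
    Prop :=
  exists c : cmd, poly_time d q r c /\
    whp R (fun n => [set s : config d n q | recovers (r n) c s]).

(* Main.v *)
Require Import Defs.
From HB Require Import structures.
From mathcomp Require Import all_boot all_order all_algebra.
From mathcomp Require Import finmap multiset.
From mathcomp Require Import all_classical all_reals all_analysis.
From mathcomp Require Import zify ring lra.
Import Order.TTheory GRing.Theory Num.Theory.
Import numFieldNormedType.Exports.
Local Open Scope classical_set_scope.
Local Open Scope ring_scope.

(** The labeling is rebuilt like a jigsaw puzzle. Two boxes that differ by a unit
    step overlap in a cell with one side r - 1 and the other sides r. If the
    content of such an overlap occurs nowhere else, then knowledge of one of the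
    two boxes determines the other. A labeling is called reconstructible if the
    box at the origin is recognizable and if repeatedly filling boxes whose
    content is forced by the labels already known reaches all vertices. The
    program [assemble] does precisely this. Every label that it writes is correct
    for every labeling with the given profile, so reconstructible labelings are
    both identifiable and recovered by the program ([final_labels], [assembleE],
    [reconstructible_identifiable]). The program runs in polynomial time since it
    is composed of functions shown to be feasible in the WHILE language
    ([feasible_assemble], [poly_time_feasible]).

    Reconstructibility is a matter of counting. A repeated overlap forces the
    labels of a set X to be copies of other labels, which leaves at most
    q ^ (|V| - |X|) labelings if the copying is not circular ([count_forced]).
    There are about n ^ (2 d) pairs of overlaps, so all overlaps are unique when
    r ^ d exceeds 2 d log_q n with a margin. For d = 1 this is the threshold.

    For d >= 2 the threshold is at half of this, and repeated overlaps do
    occur. But a given overlap is repeated only with probability n ^ (- c), hence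
    repeated overlaps are sparse: in every window of side proportional to r some
    hyperplane in each direction crosses only unique overlaps, and these
    hyperplanes link all windows to the origin ([all_hyperplanes_known]). The
    remaining vertices are added layer by layer ([fill_window]). A new layer
    could be blocked only by r repeated overlaps in a row. Their displacements
    fall into classes of equal ones, and the labels forced by the classes
    outweigh the choices of the displacements ([count_run_cond]).

    For d >= 2 below the threshold there are far fewer profiles than labelings
    ([count_identifiable]), so most labelings share their profile. For d = 1 this
    comparison stops at r = log_q n. Up to 2 log_q n, a second moment argument
    finds positions a < b < a' < b' such that the blocks of length r at a and a'
    coincide, and those at b and b' as well ([count_no_match]); then exchanging
    the segments [a, b) and [a', b') changes the word but not its profile
    ([windows_swap], [nonidentifiable_swap]). *)

Set Implicit Arguments.
Unset Strict Implicit.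
Unset Printing Implicit Defensive.

(** * Polynomial bounds and feasible functions *)

Set Implicit Arguments.
Unset Strict Implicit.
Unset Printing Implicit Defensive.

Section PolynomialBounds.
Local Open Scope nat_scope.

(** A single power of n + 2, a base that is at least 2, absorbs constants, sums
    and products. *)
Definition poly (f : nat -> nat) := exists k, forall n, f n <= (n + 2) ^ k.

Lemma poly_le f g : (forall n, f n <= g n) -> poly g -> poly f.
Proof. by move=> fg [k gk]; exists k => n; apply: leq_trans (fg n) (gk n). Qed.

Lemma leq_base n k l : k <= l -> (n + 2) ^ k <= (n + 2) ^ l.
Proof. by move=> kl; rewrite leq_pexp2l// addn2. Qed.

Lemma base_gt0 n k : 0 < (n + 2) ^ k.
Proof. by rewrite expn_gt0 addn2. Qed.

Lemma leq_base2 m n k : m <= n -> (m + 2) ^ k <= (n + 2) ^ k.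
Proof. by move=> mn; case: k => // k; rewrite leq_exp2r// leq_add2r. Qed.

Lemma poly_const c : poly (fun=> c).
Proof.
exists c => n; apply: (@leq_trans (2 ^ c)); first exact/ltnW/ltn_expl.
by case: c => // c; rewrite leq_exp2r// leq_addl.
Qed.

Lemma poly_id : poly id.
Proof. by exists 1 => n; rewrite expn1 leq_addr. Qed.

Lemma poly_add f g : poly f -> poly g -> poly (fun n => f n + g n).
Proof.
move=> [k fk] [l gl]; exists (maxn k l).+1 => n.
rewrite expnS (leq_trans (leq_add (fk n) (gl n)))//.
apply: (@leq_trans (2 * (n + 2) ^ maxn k l)); last by rewrite leq_mul2r leq_addl orbT.
by rewrite mul2n -addnn leq_add// leq_base ?leq_maxl ?leq_maxr.
Qed.

Lemma poly_mul f g : poly f -> poly g -> poly (fun n => f n * g n).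
Proof. by move=> [k fk] [l gl]; exists (k + l) => n; rewrite expnD leq_mul. Qed.

Lemma poly_base k : poly (fun n => (n + 2) ^ k).
Proof. by exists k. Qed.

Lemma poly_exp f k : poly f -> poly (fun n => (f n + 2) ^ k).
Proof.
move=> [l fl]; have [l' fl'] : poly (fun n => f n + 2).
  exact: poly_add (ex_intro _ l fl) (poly_const 2).
exists (l' * k) => n; rewrite expnM.
by case: k => // k; rewrite leq_exp2r.
Qed.

End PolynomialBounds.

Section TreeSize.
Local Open Scope nat_scope.

Fixpoint tsize (t : tree) : nat :=
  if t is Node a b then (tsize a + tsize b).+1 else 1.

Lemma tsize_gt0 t : 0 < tsize t.
Proof. by case: t. Qed.

Definition enc_bool (b : bool) : tree := if b then Node Leaf Leaf else Leaf.

Fixpoint on_input (e : expr) : expr :=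
  match e with
  | Var _ => Var 0
  | Defs.Nil => Defs.Nil
  | Defs.Cons e1 e2 => Defs.Cons (on_input e1) (on_input e2)
  | Hd e1 => Hd (on_input e1)
  | Tl e1 => Tl (on_input e1)
  end.

Lemma eval_on_input m e : Defs.eval m (on_input e) = Defs.eval (fun=> m 0) e.
Proof. by elim: e => //= [e1 -> e2 ->|e ->|e ->]. Qed.

Lemma tsize_left_child t : tsize (left_child t) <= tsize t.
Proof. by case: t => //= a b; rewrite ltnW// ltnS leq_addr. Qed.

Lemma tsize_right_child t : tsize (right_child t) <= tsize t.
Proof. by case: t => //= a b; rewrite ltnW// ltnS leq_addl. Qed.

Lemma tsize_eval e x : tsize (Defs.eval (fun=> x) e) <= cost e * (tsize x).+1.
Proof.
elim: e => /= [_||e1 h1 e2 h2|e h|e h]; rewrite ?mul1n//.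
- by rewrite mulSn mulnDl; have := leq_add h1 h2; lia.
- by rewrite (leq_trans (tsize_left_child _))// (leq_trans h)// leq_mul2r leqnSn orbT.
- by rewrite (leq_trans (tsize_right_child _))// (leq_trans h)// leq_mul2r leqnSn orbT.
Qed.

End TreeSize.

Class Encoding (A : Type) := encode : A -> tree.
Arguments encode : simpl never.

#[global] Instance tree_encoding : Encoding tree := id.
#[global] Instance bool_encoding : Encoding bool := enc_bool.
#[global] Instance nat_encoding : Encoding nat := enc_nat.
#[global] Instance prod_encoding A B (eA : Encoding A) (eB : Encoding B) :
  Encoding (A * B) := fun x => Node (encode x.1) (encode x.2).
#[global] Instance seq_encoding A (eA : Encoding A) : Encoding (seq A) :=
  fun s => enc_seq (map encode s).

Notation esize x := (tsize (encode x)).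

Section Feasibility.
Local Open Scope nat_scope.

(** The program may be started in any store that holds the argument in variable
    0, and it preserves all variables above some N, so that a larger program can
    keep values there while it runs. The bound on the size of f a makes the
    composite of two feasible functions feasible. *)
Definition feasible A B (eA : Encoding A) (eB : Encoding B) (f : A -> B) :=
  exists c N k,
  (forall m a, m 0 = encode a -> exists t m', [/\ exec c m t m',
     m' 0 = encode (f a), (forall v, N < v -> m' v = m v) &
     t <= (esize a + 2) ^ k]) /\
  (forall a, esize (f a) <= (esize a + 2) ^ k).

End Feasibility.

Arguments feasible {A B eA eB} f.

Section FeasibleI.
Local Open Scope nat_scope.

Lemma feasibleI A B (eA : Encoding A) (eB : Encoding B) (f : A -> B) c N p p' : poly p -> poly p' ->
  (forall m a, m 0 = encode a -> exists t m', [/\ exec c m t m',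
     m' 0 = encode (f a), (forall v, N < v -> m' v = m v) & t <= p (esize a)]) ->
  (forall a, esize (f a) <= p' (esize a)) -> feasible f.
Proof.
move=> [k pk] [k' pk'] fc fs; exists c, N, (maxn k k'); split=> [m a ma|a].
  have [t [m' [e f0 fv tp]]] := fc m a ma; exists t, m'; split=> //.
  by rewrite (leq_trans tp)// (leq_trans (pk _))// leq_base// leq_maxl.
by rewrite (leq_trans (fs a))// (leq_trans (pk' _))// leq_base// leq_maxr.
Qed.

End FeasibleI.

Section BasicRules.
Local Open Scope nat_scope.
Context {A B C D : Type} {eA : Encoding A} {eB : Encoding B} {eC : Encoding C}.
Implicit Types (m : store).

Lemma feasible_ext (f g : A -> B) : f =1 g -> feasible f -> feasible g.
Proof.
move=> fg [c [N [k [fc fs]]]]; exists c, N, k; split=> [m a ma|a].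
  by have [t [m' [e f0 fv tp]]] := fc m a ma; exists t, m'; rewrite -fg.
by rewrite -fg.
Qed.

(** Evaluation in a constant store lets every variable stand for the argument. *)
Lemma feasible_expr e (f : A -> B) :
  (forall a, Defs.eval (fun=> encode a) e = encode (f a)) -> feasible f.
Proof.
move=> fe.
apply: (@feasibleI _ _ _ _ _ (Assign 0 (on_input e)) 0 (fun=> (cost (on_input e)).+1)
  (fun n => cost e * n.+1)).
- exact: poly_const.
- apply: poly_mul (poly_const _) _; apply: poly_le (poly_add poly_id (poly_const 1)).
  by move=> n; rewrite addn1.
- move=> m a ma; eexists; eexists; split; first exact: ExecAssign.
  + by rewrite /update eqxx eval_on_input ma.
  + by move=> v v0; rewrite /update gtn_eqF.
  + by [].
- by move=> a; rewrite -fe tsize_eval.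
Qed.

Lemma feasible_comp (f : B -> C) (g : A -> B) :
  feasible f -> feasible g -> feasible (fun x => f (g x)).
Proof.
move=> [cf [N [k [fc fs]]]] [cg [M [l [gc gs]]]].
apply: (@feasibleI _ _ _ _ _ (Seq cg cf) (maxn N M)
  (fun n => n.+2 + ((n + 2) ^ l + ((n + 2) ^ l + 2) ^ k)) (fun n => ((n + 2) ^ l + 2) ^ k)).
- apply: poly_add; first by apply: poly_le (poly_base 1) => n; rewrite addn2.
  by apply: poly_add (poly_base _) (poly_exp _ (poly_base _)).
- exact: poly_exp (poly_base _).
- move=> m a ma; have [t1 [m1 [e1 h1 v1 le1]]] := gc m a ma.
  have [t2 [m2 [e2 h2 v2 le2]]] := fc m1 _ h1.
  exists (t1 + t2).+1, m2; split.
  + exact: ExecSeq e1 e2.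
  + by rewrite h2.
  + by move=> v; rewrite gtn_max => /andP[? ?]; rewrite v2// v1.
  + have : (esize (g a) + 2) ^ k <= ((esize a + 2) ^ l + 2) ^ k.
      exact: leq_base2.
    by lia.
- by move=> x; rewrite (leq_trans (fs _))// leq_base2.
Qed.

Lemma feasible_pair (f : A -> B) (g : A -> C) :
  feasible f -> feasible g -> feasible (fun x => (f x, g x)).
Proof.
move=> [cf [N [k [fc fs]]]] [cg [M [l [gc gs]]]].
pose y := (maxn N M).+1; pose z := y.+1.
have yN : N < y by rewrite ltnS leq_maxl.
have yM : M < y by rewrite ltnS leq_maxr.
have pkl : poly (fun n => (n + 2) ^ k + (n + 2) ^ l + 20).
  by apply: poly_add (poly_add _ _) (poly_const _); apply: poly_base.
apply: (@feasibleI _ _ _ _ _ (Seq (Assign y (Var 0)) (Seq cf (Seq (Assign z (Var 0))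
  (Seq (Assign 0 (Var y)) (Seq cg (Assign 0 (Defs.Cons (Var z) (Var 0)))))))) z
  _ _ pkl pkl).
- move=> m a ma; pose m0 := update m y (m 0).
  have m00 : m0 0 = encode a by rewrite /m0 /update ltn_eqF.
  have [t1 [m1 [e1 h1 v1 le1]]] := fc m0 a m00.
  pose m2 := update m1 z (m1 0); pose m3 := update m2 0 (m2 y).
  have m3E : m3 0 = encode a.
    by rewrite /m3 /m2 /m0 /update eqxx ltn_eqF// v1// /m0 /update eqxx.
  have [t2 [m4 [e4 h4 v4 le4]]] := gc m3 a m3E.
  have m4z : m4 z = encode (f a).
    by rewrite v4 ?(ltn_trans yM)// /m3 /m2 /update eqxx h1.
  eexists; exists (update m4 0 (Node (m4 z) (m4 0))); split.
  + apply: ExecSeq; first exact: ExecAssign.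
    apply: ExecSeq; first exact: e1.
    apply: ExecSeq; first exact: ExecAssign.
    apply: ExecSeq; first exact: ExecAssign.
    apply: ExecSeq; first exact: e4.
    exact: ExecAssign.
  + by rewrite /update eqxx m4z h4.
  + move=> v zv; have yv : y < v := ltnW zv.
    have v0 : 0 < v by apply: leq_ltn_trans yv.
    rewrite /update (gtn_eqF v0) v4 ?(ltn_trans yM)// /m3 /m2 /update.
    rewrite (gtn_eqF v0) (gtn_eqF zv) v1 ?(ltn_trans yN)//.
    by rewrite /m0 /update (gtn_eqF yv).
  + by move: le1 le4 => /=; lia.
- by move=> x; rewrite [encode _]/=/prod_encoding/=; have := fs x; have := gs x; lia.
Qed.

Lemma feasible_if_node (test : C -> bool) (h : A -> C) (f g : A -> B) :
  (forall y, is_node (encode y) = test y) ->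
  feasible h -> feasible f -> feasible g ->
  feasible (fun x => if test (h x) then f x else g x).
Proof.
move=> testE [ch [N0 [k0 [hc hs]]]] [cf [N [k [fc fs]]]] [cg [M [l [gc gs]]]].
pose y := (maxn N0 (maxn N M)).+1; pose z := y.+1.
have yN : N < y by rewrite ltnS !leq_max leqnn orbT.
have yM : M < y by rewrite ltnS !leq_max leqnn !orbT.
have yN0 : N0 < y by rewrite ltnS !leq_max leqnn.
have pkl : poly (fun n => (n + 2) ^ k0 + (n + 2) ^ k + (n + 2) ^ l + 20).
  by do ![apply: poly_add]; rewrite -/poly; try exact: poly_base; exact: poly_const.
apply: (@feasibleI _ _ _ _ _ (Seq (Assign y (Var 0)) (Seq ch (Seq (Assign z (Var 0))
  (Seq (Assign 0 (Var y)) (If (Var z) cf cg))))) z _ _ pkl pkl).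
- move=> m a ma; pose m0 := update m y (m 0).
  have m00 : m0 0 = encode a by rewrite /m0 /update ltn_eqF.
  have [t1 [m1 [e1 h1 v1 le1]]] := hc m0 a m00.
  pose m2 := update m1 z (m1 0); pose m3 := update m2 0 (m2 y).
  have m3E : m3 0 = encode a.
    by rewrite /m3 /m2 /m0 /update eqxx ltn_eqF// v1// /m0 /update eqxx.
  have m3z : is_node (m3 z) = test (h a) by rewrite /m3 /m2 /update eqxx h1 testE.
  have m3v v : z < v -> m3 v = m v.
    move=> zv; have yv : y < v := ltnW zv.
    have v0 : 0 < v by apply: leq_ltn_trans yv.
    rewrite /m3 /m2 /update (gtn_eqF v0) (gtn_eqF zv) v1 ?(ltn_trans yN0)//.
    by rewrite /m0 /update (gtn_eqF yv).
  case: ifP => hx.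
    have [t2 [m4 [e4 h4 v4 le4]]]  := fc m3 a m3E.
    eexists; exists m4; split.
    + apply: ExecSeq; first exact: ExecAssign.
      apply: ExecSeq; first exact: e1.
      apply: ExecSeq; first exact: ExecAssign.
      apply: ExecSeq; first exact: ExecAssign.
      by apply: ExecIfTrue e4; rewrite /= -/m0 -/m2 -/m3 m3z.
    + by rewrite h4.
    + by move=> v zv; rewrite v4 ?m3v// (ltn_trans yN)// (ltn_trans _ zv).
    + by move: le1 le4 => /=; lia.
  have [t2 [m4 [e4 h4 v4 le4]]]  := gc m3 a m3E.
  eexists; exists m4; split.
  + apply: ExecSeq; first exact: ExecAssign.
    apply: ExecSeq; first exact: e1.
    apply: ExecSeq; first exact: ExecAssign.
    apply: ExecSeq; first exact: ExecAssign.
    by apply: ExecIfFalse e4; rewrite /= -/m0 -/m2 -/m3 m3z hx.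
  + by rewrite h4.
  + by move=> v zv; rewrite v4 ?m3v// (ltn_trans yM)// (ltn_trans _ zv).
  + by move: le1 le4 => /=; lia.
- by move=> x /=; case: ifP => _; have := fs x; have := gs x; lia.
Qed.

End BasicRules.

Section WhileRule.
Local Open Scope nat_scope.
Context {X S : Type} {eX : Encoding X} {eS : Encoding S}.

(** The guard is stored in the loop state, as its left child. Without a bound on
    the intermediate sizes, iterating a step that squares the size of its
    argument would leave polynomial time. *)
Lemma feasible_while (test : S -> bool) (g : X -> S) (f : S -> S) (h : X -> S) p :
  (forall s, is_node (left_child (encode s)) = test s) ->
  poly p -> feasible g -> feasible f ->
  (forall x, exists2 i, i <= p (esize x) & [/\ h x = iter i f (g x),
     ~~ test (iter i f (g x)),
     (forall j, j < i -> test (iter j f (g x))) &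
     (forall j, j <= i -> esize (iter j f (g x)) <= p (esize x))]) ->
  feasible h.
Proof.
move=> testE [kp pk] [cg [M [l [gc _]]]] [cf [N [k [fc fs]]]] hx.
apply: (@feasibleI _ _ _ _ _ (Seq cg (While (Hd (Var 0)) cf)) (maxn M N)
  (fun n => n.+2 + (n + 2) ^ l + (1 + (n + 2) ^ kp) * (4 + ((n + 2) ^ kp + 2) ^ k))
  (fun n => (n + 2) ^ kp)).
- apply: poly_add.
    apply: poly_add (poly_base _).
    by apply: poly_le (poly_base 1) => n; rewrite addn2.
  apply: poly_mul; first exact: poly_add (poly_const _) (poly_base _).
  exact: poly_add (poly_const _) (poly_exp _ (poly_base _)).
- exact: poly_base.
- move=> m x mx; have [i ip [-> stop go bd]] := hx x.
  set B := (esize x + 2) ^ kp.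
  have iB : i <= B by rewrite (leq_trans ip).
  have {}bd j : j <= i -> esize (iter j f (g x)) <= B.
    by move=> ji; rewrite (leq_trans (bd j ji)).
  have [t0 [m0 [e0 g0 v0 le0]]] := gc m x mx.
  suff [t [m' [e h1 h2 h3]]] : exists t m', [/\ exec (While (Hd (Var 0)) cf) m0 t m',
    m' 0 = @encode _ eS (iter i f (g x)), (forall v, N < v -> m' v = m0 v) &
    t <= (1 + i) * (4 + (B + 2) ^ k)].
    exists (t0 + t).+1, m'; split=> //.
    + exact: ExecSeq e0 e.
    + by move=> v; rewrite gtn_max => /andP[Mv Nv]; rewrite h2// v0.
    + have : (1 + i) * (4 + (B + 2) ^ k) <= (1 + B) * (4 + (B + 2) ^ k).
        by rewrite leq_mul2r leq_add2l iB orbT.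
      by move: h3 le0; lia.
  move: B (g x) g0 bd stop go {hx ip iB pk e0 v0 le0 mx} => B s ms bd stop go.
  elim: i s m0 ms bd stop go => [|i IH] s {}m ms bd stop go.
    exists (cost (Hd (Var 0))).+1, m; split=> //.
    by apply: ExecWhileFalse; rewrite /= ms testE.
  have [t1 [m1 [e1 h1 v1 le1]]] := fc m s ms.
  have [||| t2 [m2 [e2 h2 v2 le2]]] := IH (f s) m1 h1.
  - by move=> j ji; rewrite -iterSr bd.
  - by rewrite -iterSr.
  - by move=> j ji; rewrite -iterSr go.
  exists (2 + t1 + t2).+1, m2; split.
  + by apply: ExecWhileTrue e1 e2; rewrite /= ms testE; apply: (go 0).
  + by rewrite h2 -iterSr.
  + by move=> v Nv; rewrite v2// v1.
  + have : (esize s + 2) ^ k <= (B + 2) ^ k by apply: leq_base2 (bd 0 _).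
    by move: le1 le2; move: ((B + 2) ^ k) ((esize s + 2) ^ k) => Y Z; nia.
- by move=> x; have [i ip [-> _ _ bd]] := hx x; rewrite (leq_trans (bd i _)).
Qed.

End WhileRule.

(** * Equality of trees, typed rules and folds *)

Section TreeEquality.
Local Open Scope nat_scope.

Fixpoint tree_eqb (a b : tree) : bool :=
  match a, b with
  | Leaf, Leaf => true
  | Node a1 a2, Node b1 b2 => tree_eqb a1 b1 && tree_eqb a2 b2
  | _, _ => false
  end.

Lemma tree_eqP a b : reflect (a = b) (tree_eqb a b).
Proof.
apply: (iffP idP) => [|<-]; last by elim: a => //= a1 -> a2 ->.
by elim: a b => [|a1 IH1 a2 IH2] [|b1 b2]//= /andP[/IH1 -> /IH2 ->].
Qed.

Let hd_var := Hd (Var 0).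
Let a_var := Hd (Hd hd_var).
Let b_var := Tl (Hd hd_var).
Let w_var := Tl hd_var.
Let one := Defs.Cons Defs.Nil Defs.Nil.

(** The comparison works on a list of pairs of trees that remain to be compared,
    kept next to the answer found so far. A round treats the first pair: it is
    replaced by the two pairs of children, dropped, or answered negatively. *)
Let step_true := Defs.Cons (Defs.Cons (Defs.Cons (Hd a_var) (Hd b_var))
  (Defs.Cons (Defs.Cons (Tl a_var) (Tl b_var)) w_var)) (Tl (Var 0)).
Let step_drop := Defs.Cons w_var (Tl (Var 0)).
Let step_fail := Defs.Cons Defs.Nil Defs.Nil.

Let ev e x := Defs.eval (fun=> x) e.

Let eq_step x :=
  if is_node (ev a_var x) then
    if is_node (ev b_var x) then ev step_true x else ev step_fail x
  else if is_node (ev b_var x) then ev step_fail x else ev step_drop x.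

Let feasible_eq_step : feasible eq_step.
Proof.
by apply: (@feasible_if_node _ _ _ _ _ _ is_node) => //;
  [|apply: (@feasible_if_node _ _ _ _ _ _ is_node) => //..];
  exact: feasible_expr.
Qed.

Let state (W : seq (tree * tree)) (b : bool) :=
  Node (enc_seq [seq Node x.1 x.2 | x <- W]) (enc_bool b).

Let all_equal (W : seq (tree * tree)) := all (fun x => tree_eqb x.1 x.2) W.

Let terminates W := exists2 i, i <= sumn [seq tsize x.1 | x <- W] &
  [/\ iter i eq_step (state W true) = state [::] (all_equal W),
     ~~ is_node (left_child (iter i eq_step (state W true))),
     (forall j, j < i -> is_node (left_child (iter j eq_step (state W true)))) &
     (forall j, j <= i -> tsize (iter j eq_step (state W true)) <=
        tsize (state W true))].

(** Each round takes at least one node off the first components of the list, so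
    their total size bounds the number of rounds. *)
Let eq_loop W : terminates W.
Proof.
have [k] := ubnP (sumn [seq tsize x.1 | x <- W]).
elim: k W => // k IH [|[a b] W] lek.
  by exists 0 => //; split=> // -[].
have lift W' : eq_step (state ((a, b) :: W) true) = state W' true ->
    tsize (state W' true) <= tsize (state ((a, b) :: W) true) ->
    all_equal ((a, b) :: W) = all_equal W' ->
    sumn [seq tsize x.1 | x <- W'] < sumn [seq tsize x.1 | x <- (a, b) :: W] ->
    terminates ((a, b) :: W).
  move=> st sz al sm; have [|i ile [i1 i2 i3 i4]] := IH W'.
    by rewrite (leq_trans sm).
  exists i.+1; first by rewrite (leq_ltn_trans ile).
  rewrite !iterSr st al; split=> // -[|j]//; rewrite ltnS iterSr st => ji.
    exact: i3.
  by rewrite (leq_trans (i4 _ ji)).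
have fail : eq_step (state ((a, b) :: W) true) = Node Leaf Leaf ->
    all_equal ((a, b) :: W) = false -> terminates ((a, b) :: W).
  move=> st al; exists 1; first by rewrite /= addn_gt0 tsize_gt0.
  rewrite [iter 1 _ _]/= st al; split=> // -[|[|j]]//= _.
  by rewrite st /=; lia.
case: a b lek lift fail => [|a1 a2] [|b1 b2] lek lift fail; try by apply: fail.
- by apply: (lift W) => //=; lia.
- apply: (lift ((a1, b1) :: (a2, b2) :: W)) => //=; first by lia.
    by rewrite /all_equal /= andbA.
  by lia.
Qed.

Lemma feasible_tree_eqb : feasible (fun x : tree * tree => tree_eqb x.1 x.2).
Proof.
have right_step : feasible (fun x : tree => right_child x).
  exact: (feasible_expr (e := Tl (Var 0))).
pose loop x := Node Leaf (enc_bool (tree_eqb (left_child x) (right_child x))).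
have loopP : feasible loop.
  pose init := Defs.Cons (Defs.Cons (Defs.Cons (Hd (Var 0)) (Tl (Var 0))) Defs.Nil) one.
  have init_state x : ev init x = state [:: (left_child x, right_child x)] true by [].
  apply: (@feasible_while _ _ _ _ (fun x => is_node (left_child x)) (ev init) eq_step loop
    (fun n => n + n + 10)) => //.
  - by apply: poly_add (poly_add _ _) (poly_const _); apply: poly_id.
  - exact: (feasible_expr (e := init)).
  move=> x; rewrite init_state.
  have [i ile [i1 i2 i3 i4]] := eq_loop [:: (left_child x, right_child x)].
  have sl := tsize_left_child x; have sr := tsize_right_child x.
  exists i; first by move: ile; rewrite /encode/tree_encoding/=; lia.
  split=> //; first by rewrite i1 /all_equal /= andbT.
  move=> j ji; rewrite /encode/tree_encoding (leq_trans (i4 j ji))//=.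
  by rewrite /encode/tree_encoding; lia.
have [c [N [k [fc fs]]]] := feasible_comp right_step loopP.
exists c, N, k; split=> [m a ma|a]; first exact: (fc m (encode a) ma).
exact: (fs (encode a)).
Qed.

End TreeEquality.

Section TypedRules.
Local Open Scope nat_scope.
Context {X : Type} {eX : Encoding X}.

Lemma feasible_size A B (eA : Encoding A) (eB : Encoding B) (f : A -> B) :
  feasible f -> exists k, forall a, esize (f a) <= (esize a + 2) ^ k.
Proof. by move=> [c [N [k [_ fs]]]]; exists k. Qed.

Lemma feasible_id : feasible (fun x : X => x).
Proof. exact: (feasible_expr (e := Var 0)). Qed.

Fixpoint quote (t : tree) : expr :=
  if t is Node a b then Defs.Cons (quote a) (quote b) else Defs.Nil.

Lemma eval_quote m t : Defs.eval m (quote t) = t.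
Proof. by elim: t => //= a -> b ->. Qed.

Lemma feasible_const A (eA : Encoding A) (a : A) : feasible (fun _ : X => a).
Proof. by apply: (feasible_expr (e := quote (encode a))) => x; rewrite eval_quote. Qed.

Lemma feasible_fst A B (eA : Encoding A) (eB : Encoding B) (f : X -> A * B) :
  feasible f -> feasible (fun x => (f x).1).
Proof. by apply: feasible_comp; apply: (feasible_expr (e := Hd (Var 0))). Qed.

Lemma feasible_snd A B (eA : Encoding A) (eB : Encoding B) (f : X -> A * B) :
  feasible f -> feasible (fun x => (f x).2).
Proof. by apply: feasible_comp; apply: (feasible_expr (e := Tl (Var 0))). Qed.

Lemma feasible_if A (eA : Encoding A) (h : X -> bool) (f g : X -> A) :
  feasible h -> feasible f -> feasible g ->
  feasible (fun x => if h x then f x else g x).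
Proof. by apply: (@feasible_if_node _ _ _ _ _ _ id) => -[]. Qed.

Lemma feasible_cons A (eA : Encoding A) (f : X -> A) (g : X -> seq A) :
  feasible f -> feasible g -> feasible (fun x => f x :: g x).
Proof.
move=> ff fg.
have consP : feasible (fun p : A * seq A => p.1 :: p.2).
  by apply: (feasible_expr (e := Var 0)) => -[].
exact: (feasible_comp consP (feasible_pair ff fg)).
Qed.

Lemma feasible_behead A (eA : Encoding A) (f : X -> seq A) :
  feasible f -> feasible (fun x => behead (f x)).
Proof. by apply: feasible_comp; apply: (feasible_expr (e := Tl (Var 0))) => -[]. Qed.

Lemma feasible_encode A (eA : Encoding A) (f : X -> A) :
  feasible f -> @feasible _ _ _ tree_encoding (fun x => encode (f x)).
Proof. by case=> c [N [k [fc fs]]]; exists c, N, k. Qed.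

Lemma feasible_decode A (eA : Encoding A) (f : X -> A) :
  @feasible _ _ _ tree_encoding (fun x => encode (f x)) -> feasible f.
Proof. by case=> c [N [k [fc fs]]]; exists c, N, k. Qed.

Lemma feasible_head A (eA : Encoding A) a0 (f : X -> seq A) :
  feasible f -> feasible (fun x => head a0 (f x)).
Proof.
move=> ff; apply: feasible_decode.
pose hd t : tree := if is_node t then left_child t else @encode _ eA a0.
apply: (@feasible_ext _ _ _ _ (fun x => hd (@encode (seq A) _ (f x)))).
  by move=> x; case: (f x).
have h1 := feasible_encode ff.
apply: (@feasible_if_node _ _ _ _ _ _ is_node) => //.
- by apply: feasible_comp h1; apply: (feasible_expr (e := Hd (Var 0))).
- exact: feasible_const.
Qed.

Lemma feasible_eq (A : eqType) (eA : Encoding A) (f g : X -> A) :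
  injective (encode : A -> tree) -> feasible f -> feasible g ->
  feasible (fun x => f x == g x).
Proof.
move=> inj ff fg.
apply: (@feasible_ext _ _ _ _ (fun x => tree_eqb (@encode _ eA (f x)) (@encode _ eA (g x)))).
  by move=> x; apply/tree_eqP/eqP => [/inj|->].
exact: (feasible_comp feasible_tree_eqb
  (feasible_pair (feasible_encode ff) (feasible_encode fg))).
Qed.

End TypedRules.

Lemma esize_cons A (eA : Encoding A) (a : A) s :
  (esize (a :: s) = (esize a + esize s).+1)%N.
Proof. by []. Qed.

Lemma esize_pair A B (eA : Encoding A) (eB : Encoding B) (a : A) (b : B) :
  (esize (a, b) = (esize a + esize b).+1)%N.
Proof. by []. Qed.

Lemma esize_head A (eA : Encoding A) a0 (s : seq A) :
  (esize (head a0 s) <= esize s + esize a0)%N.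
Proof. by case: s => [|a s]; rewrite ?esize_cons [head _ _]/=; lia. Qed.

Lemma esize_drop A (eA : Encoding A) (s : seq A) i : (esize (drop i s) <= esize s)%N.
Proof.
elim: s i => [|a s IH] [|i]//; apply: leq_trans (IH i) _.
by rewrite esize_cons; lia.
Qed.

Lemma size_esize A (eA : Encoding A) (s : seq A) : (size s < esize s)%N.
Proof. by elim: s => [|a s IH]//; rewrite esize_cons [size _]/=; lia. Qed.

Section Folds.
Local Open Scope nat_scope.
Context {X : Type} {eX : Encoding X}.

(** The loop state consists of the rest of the list, the parameter and the
    current value; the list is also the guard. *)
Lemma feasible_foldl B S (eB : Encoding B) (eS : Encoding S) (b0 : B)
    (l : X -> seq B) (s0 : X -> S) (g : X -> S -> B -> S) p :
  feasible l -> feasible s0 ->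
  feasible (fun y : X * S * B => g y.1.1 y.1.2 y.2) -> poly p ->
  (forall x j, j <= size (l x) ->
     esize (foldl (g x) (s0 x) (take j (l x))) <= p (esize x)) ->
  feasible (fun x => foldl (g x) (s0 x) (l x)).
Proof.
move=> fl fs fg [k pk] bd; have [kl szl] := feasible_size fl.
pose step (p : seq B * (X * S)) := (behead p.1, (p.2.1, g p.2.1 p.2.2 (head b0 p.1))).
have stepE i x s t : i <= size s ->
    iter i step (s, (x, t)) = (drop i s, (x, foldl (g x) t (take i s))).
  elim: i => [|i IH] ils; first by rewrite drop0 take0.
  rewrite iterS IH 1?ltnW// /step/= (take_nth b0)// foldl_rcons.
  by rewrite -nth0 nth_drop addn0 -drop1 drop_drop add1n.
have loop : feasible (fun x => ([::] : seq B, (x, foldl (g x) (s0 x) (l x)))); last first.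
  exact: (feasible_snd (feasible_snd loop)).
apply: (@feasible_while _ _ _ _ (fun p : seq B * (X * S) => ~~ nilp p.1)
  (fun x => (l x, (x, s0 x))) step _
  (fun n => 2 + (n + 2) ^ kl + n + (n + 2) ^ k)).
- by move=> [[|b s] y].
- by do ![apply: poly_add]; rewrite -/poly; try exact: poly_base;
    [exact: poly_const|exact: poly_id].
- by apply: feasible_pair => //; apply: feasible_pair => //; exact: feasible_id.
- have f1 : feasible (fun p : seq B * (X * S) => p.1) by apply/feasible_fst/feasible_id.
  have f2 : feasible (fun p : seq B * (X * S) => p.2) by apply/feasible_snd/feasible_id.
  have f21 := feasible_fst f2; have f22 := feasible_snd f2.
  apply: feasible_pair; first exact: feasible_behead.
  apply: feasible_pair => //.
  have := feasible_comp fg (feasible_pair (feasible_pair f21 f22) (feasible_head b0 f1)).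
  exact.
- move=> x; exists (size (l x)).
    by have := size_esize eB (l x); have := szl x; lia.
  rewrite stepE// take_size drop_size; split=> //.
    move=> j jl; rewrite stepE 1?ltnW//=.
    by rewrite /nilp size_drop subn_eq0 -ltnNge.
  move=> j jl; rewrite stepE//; have := esize_drop eB (l x) j; have := szl x.
  have := leq_trans (bd x j jl) (pk _).
  by rewrite !esize_pair; lia.
Qed.

(** If a step enlarges the value only by a summand bounded in terms of the
    parameter and the current item, then all intermediate values stay polynomial. *)
Lemma feasible_foldl_add B S (eB : Encoding B) (eS : Encoding S) (b0 : B)
    (l : X -> seq B) (s0 : X -> S) (g : X -> S -> B -> S) k :
  feasible l -> feasible s0 ->
  feasible (fun y : X * S * B => g y.1.1 y.1.2 y.2) ->
  (forall x s b, esize (g x s b) <= esize s + (esize (x, b) + 2) ^ k) ->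
  feasible (fun x => foldl (g x) (s0 x) (l x)).
Proof.
move=> fl fs fg bd; have [kl szl] := feasible_size fl.
have [ks szs] := feasible_size fs.
apply: (feasible_foldl b0 (p := fun n =>
  (n + 2) ^ ks + (n + 2) ^ kl * (1 + n + (n + 2) ^ kl + 2) ^ k)) => //.
  apply: poly_add (poly_base _) (poly_mul (poly_base _) (poly_exp _ _)).
  apply: poly_add (poly_base _); exact: poly_add (poly_const _) poly_id.
move=> x j jl; set u := (1 + _ + _ + _) ^ k.
have key s t : (forall i, i < size s -> (esize (x, nth b0 s i) + 2) ^ k <= u) ->
    esize (foldl (g x) t s) <= esize t + size s * u.
  elim: s t => [|b s IH] t su /=; first by rewrite mul0n addn0.
  rewrite (leq_trans (IH _ _))//; first by move=> i; apply: (su i.+1).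
  rewrite mulSn addnA leq_add2r (leq_trans (bd _ _ _))// leq_add2l.
  exact: (su 0).
apply: leq_trans (key _ _ _) _.
  move=> i; rewrite size_take_min leq_min => /andP[ij il].
  rewrite nth_take// leq_base2//.
  have : esize (nth b0 (l x) i) <= esize (l x).
    elim: (l x) i il {ij} => [|b s IH] [|i]// il; rewrite esize_cons [nth _ _ _]/=.
      by lia.
    by have := IH i il; lia.
  by have := szl x; rewrite esize_pair; lia.
rewrite leq_add// leq_mul2r size_take_min; apply/orP; right.
by have := size_esize eB (l x); have := szl x; rewrite geq_min; lia.
Qed.

End Folds.

(** * Feasible operations on lists and numbers *)

Ltac feasible_proj :=
  lazymatch goal with
  | |- feasible (fun x => x) => exact: feasible_id
  | |- feasible (@fst _ _) => exact: (feasible_fst feasible_id)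
  | |- feasible (@snd _ _) => exact: (feasible_snd feasible_id)
  | |- feasible (fun x => fst (@?f x)) => eapply (@feasible_fst _ _ _ _ _ _ f); feasible_proj
  | |- feasible (fun x => snd (@?f x)) => eapply (@feasible_snd _ _ _ _ _ _ f); feasible_proj
  end.

Section ListRules.
Local Open Scope nat_scope.

Lemma feasible_app X (eX : Encoding X) A B (eA : Encoding A) (eB : Encoding B) (f : A -> B) (g : X -> A) :
  feasible f -> feasible g -> feasible (fun x => f (g x)).
Proof. exact: feasible_comp. Qed.

Lemma feasible_app2 X (eX : Encoding X) A B C (eA : Encoding A) (eB : Encoding B) (eC : Encoding C)
    (f : A -> B -> C) (g : X -> A) (h : X -> B) :
  feasible (fun p : A * B => f p.1 p.2) -> feasible g -> feasible h ->
  feasible (fun x => f (g x) (h x)).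
Proof. by move=> ff fg fh; apply: (feasible_comp ff (feasible_pair fg fh)). Qed.

Lemma feasible_rev X (eX : Encoding X) A (eA : Encoding A) (a0 : A) (l : X -> seq A) :
  feasible l -> feasible (fun x => rev (l x)).
Proof.
move=> fl; apply: (@feasible_ext _ _ _ _ (fun x => foldl (fun s b => b :: s) [::] (l x))).
  move=> x; rewrite /rev; elim: (l x) [::] => //= b s IH t; exact: IH.
apply: (feasible_foldl_add a0 (k := 1) (g := fun _ s b => b :: s)) => //.
- exact: feasible_const.
- by apply: feasible_cons; feasible_proj.
- by move=> x s b; rewrite esize_cons esize_pair expn1; lia.
Qed.

Lemma feasible_cat X (eX : Encoding X) A (eA : Encoding A) (a0 : A) (l l' : X -> seq A) :
  feasible l -> feasible l' -> feasible (fun x => l x ++ l' x).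
Proof.
move=> fl fl'.
apply: (@feasible_ext _ _ _ _ (fun x => foldl (fun s b => b :: s) (l' x) (rev (l x)))).
  by move=> x; rewrite foldl_rev; elim: (l x) => //= a s ->.
apply: (feasible_foldl_add a0 (k := 1) (g := fun _ s b => b :: s)) => //.
- exact: feasible_rev.
- by apply: feasible_cons; feasible_proj.
- by move=> x s b; rewrite esize_cons esize_pair expn1; lia.
Qed.

Lemma feasible_map X (eX : Encoding X) A B (eA : Encoding A) (eB : Encoding B) (a0 : A) (b0 : B)
    (g : X -> A -> B) (l : X -> seq A) :
  feasible (fun y : X * A => g y.1 y.2) -> feasible l ->
  feasible (fun x => [seq g x a | a <- l x]).
Proof.
move=> fg fl.
apply: (@feasible_ext _ _ _ _ (fun x => rev (foldl (fun s a => g x a :: s) [::] (l x)))).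
  move=> x; have : forall s, rev (foldl (fun s a => g x a :: s) s (l x)) =
    rev s ++ [seq g x a | a <- l x]; last by move->.
  by elim: (l x) => [|a t IH] s /=; rewrite ?cats0// IH rev_cons cat_rcons.
apply: (feasible_rev b0).
have [k szg] := feasible_size fg.
apply: (feasible_foldl_add a0 (k := k.+1) (g := fun x s a => g x a :: s)) => //.
- exact: feasible_const.
- apply: feasible_cons; last by feasible_proj.
  by eapply (feasible_app2 fg); feasible_proj.
- move=> x s a; rewrite esize_cons expnS addnC.
  have h : esize (g x a) <= (esize (x, a) + 2) ^ k := szg (x, a).
  apply: (@leq_trans (esize s + 2 * (esize (x, a) + 2) ^ k)).
    by have := base_gt0 (esize (x, a)) k; lia.
  by rewrite leq_add2l leq_mul2r leq_addl orbT.
Qed.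

Lemma esize_cat A (eA : Encoding A) (s t : seq A) :
  esize (s ++ t) < esize s + esize t.
Proof. by elim: s => [|a s IH]//; rewrite cat_cons !esize_cons; lia. Qed.

Lemma feasible_flatten X (eX : Encoding X) A (eA : Encoding A) (a0 : A) (l : X -> seq (seq A)) :
  feasible l -> feasible (fun x => flatten (l x)).
Proof.
move=> fl.
apply: (@feasible_ext _ _ _ _ (fun x => foldl (fun s b => s ++ b) [::] (l x))).
  by move=> x; rewrite -[RHS]cat0s; elim: (l x) [::] => [|a s IH] t/=; rewrite ?cats0// IH catA.
apply: (feasible_foldl_add [::] (k := 1) (g := fun _ s b => s ++ b)) => //.
- exact: feasible_const.
- by apply: (feasible_cat a0); feasible_proj.
- by move=> x s b; have := esize_cat eA s b; rewrite esize_pair expn1; lia.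
Qed.

Lemma feasible_andb X (eX : Encoding X) (f g : X -> bool) :
  feasible f -> feasible g -> feasible (fun x => f x && g x).
Proof.
move=> ff fg; apply: (@feasible_ext _ _ _ _ (fun x => if f x then g x else false)).
  by move=> x; case: (f x).
by apply: feasible_if => //; exact: feasible_const.
Qed.

Lemma feasible_implyb X (eX : Encoding X) (f g : X -> bool) :
  feasible f -> feasible g -> feasible (fun x => f x ==> g x).
Proof.
move=> ff fg; apply: (@feasible_ext _ _ _ _ (fun x => if f x then g x else true)).
  by move=> x; case: (f x).
by apply: feasible_if => //; exact: feasible_const.
Qed.

Lemma feasible_negb X (eX : Encoding X) (f : X -> bool) : feasible f -> feasible (fun x => ~~ f x).
Proof.
move=> ff; apply: (@feasible_ext _ _ _ _ (fun x => if f x then false else true)).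
  by move=> x; case: (f x).
by apply: feasible_if => //; exact: feasible_const.
Qed.

Lemma feasible_all X (eX : Encoding X) A (eA : Encoding A) (a0 : A) (p : X -> A -> bool) (l : X -> seq A) :
  feasible (fun y : X * A => p y.1 y.2) -> feasible l ->
  feasible (fun x => all (p x) (l x)).
Proof.
move=> fp fl.
apply: (@feasible_ext _ _ _ _ (fun x => foldl (fun b a => b && p x a) true (l x))).
  move=> x; rewrite -[RHS]andTb; elim: (l x) true => [|a s IH] b /=; rewrite ?andbT//.
  by rewrite IH andbA.
apply: (feasible_foldl_add a0 (k := 1) (g := fun x b a => b && p x a)) => //.
- exact: feasible_const.
- apply: feasible_andb; first by feasible_proj.
  by eapply (feasible_app2 fp); feasible_proj.
- by move=> x [] a; case: (p x a); rewrite // expn1; lia.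
Qed.

Lemma feasible_filter X (eX : Encoding X) A (eA : Encoding A) (a0 : A) (p : X -> A -> bool) (l : X -> seq A) :
  feasible (fun y : X * A => p y.1 y.2) -> feasible l ->
  feasible (fun x => [seq a <- l x | p x a]).
Proof.
move=> fp fl.
apply: (@feasible_ext _ _ _ _ (fun x => flatten [seq if p x a then [:: a] else [::] | a <- l x])).
  by move=> x; elim: (l x) => //= a s ->; case: (p x a).
apply: (feasible_flatten a0).
apply: (feasible_map a0 [::] (g := fun x a => if p x a then [:: a] else [::])) => //.
apply: feasible_if => //; last exact: feasible_const.
by apply: feasible_cons; [feasible_proj|exact: feasible_const].
Qed.

(** A unary number and a list of leaves are the same tree; hence a number can
    serve as the list that drives a fold. *)
Lemma feasible_nseq X (eX : Encoding X) (f : X -> nat) :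
  feasible f -> feasible (fun x => nseq (f x) Leaf).
Proof.
move=> [c [N [k [fc fs]]]]; exists c, N, k.
have e n : encode (nseq n Leaf) = encode n by elim: n => // n IH; exact: (congr1 (Node Leaf) IH).
by split=> [m a /fc|a]; rewrite e.
Qed.

Lemma feasible_succ X (eX : Encoding X) (f : X -> nat) : feasible f -> feasible (fun x => (f x).+1).
Proof.
apply: feasible_comp; exact: (feasible_expr (e := Defs.Cons Defs.Nil (Var 0))).
Qed.

Lemma feasible_pred X (eX : Encoding X) (f : X -> nat) : feasible f -> feasible (fun x => (f x).-1).
Proof.
by apply: feasible_comp; apply: (feasible_expr (e := Tl (Var 0))) => -[].
Qed.

Lemma foldl_nseq S (g : S -> S) s n : foldl (fun s (_ : tree) => g s) s (nseq n Leaf) = iter n g s.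
Proof. by elim: n s => // n IH s; rewrite iterSr -IH. Qed.

Lemma feasible_addn X (eX : Encoding X) (f g : X -> nat) :
  feasible f -> feasible g -> feasible (fun x => f x + g x).
Proof.
move=> ff fg.
apply: (@feasible_ext _ _ _ _ (fun x => foldl (fun n (_ : tree) => n.+1) (g x) (nseq (f x) Leaf))).
  by move=> x; rewrite foldl_nseq iter_succn addnC.
apply: (feasible_foldl_add Leaf (k := 1) (g := fun _ s _ => s.+1)) => //.
- exact: feasible_nseq.
- by apply: feasible_succ; feasible_proj.
- move=> x s b; have -> : esize s.+1 = (esize s).+2 by [].
  by rewrite expn1; lia.
Qed.

Lemma feasible_length X (eX : Encoding X) A (eA : Encoding A) (a0 : A) (l : X -> seq A) :
  feasible l -> feasible (fun x => size (l x)).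
Proof.
move=> fl.
apply: (@feasible_ext _ _ _ _ (fun x => foldl (fun n _ => n.+1) 0 (l x))).
  by move=> x; rewrite -[RHS]add0n; elim: (l x) 0 => [|a s IH] n /=; rewrite ?addn0// IH addSnnS.
apply: (feasible_foldl_add a0 (k := 1) (g := fun _ s _ => s.+1)) => //.
- exact: feasible_const.
- by apply: feasible_succ; feasible_proj.
- move=> x s b; have -> : esize s.+1 = (esize s).+2 by [].
  by rewrite expn1; lia.
Qed.

Lemma feasible_nth X (eX : Encoding X) A (eA : Encoding A) (a0 : A) (l : X -> seq A) (f : X -> nat) :
  feasible l -> feasible f -> feasible (fun x => nth a0 (l x) (f x)).
Proof.
move=> fl ff.
apply: (@feasible_ext _ _ _ _ (fun x =>
  head a0 (foldl (fun s (_ : tree) => behead s) (l x) (nseq (f x) Leaf)))).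
  move=> x; rewrite foldl_nseq -nth0.
  have -> : forall n (s : seq A), iter n behead s = drop n s.
    by elim=> [|n IH] [|b s]; rewrite ?iterSr//= IH.
  by rewrite nth_drop addn0.
apply: feasible_head.
apply: (feasible_foldl_add Leaf (k := 1) (g := fun _ s _ => behead s)) => //.
- exact: feasible_nseq.
- by apply: feasible_behead; feasible_proj.
- by move=> x [|a s] b; rewrite ?esize_cons [behead _]/=; lia.
Qed.

Lemma esize_nat n : esize n = n.*2.+1.
Proof. by elim: n => // n IH; rewrite doubleS -IH. Qed.

Lemma feasible_iota X (eX : Encoding X) (f : X -> nat) : feasible f -> feasible (fun x => iota 0 (f x)).
Proof.
move=> ff; have [k szf] := feasible_size ff.
have iotaE n : foldl (fun s (_ : tree) => rcons s (size s)) [::] (nseq n Leaf) = iota 0 n.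
  rewrite foldl_nseq; elim: n => // n IH; rewrite iterS IH size_iota.
  by rewrite -addn1 iotaD cats1.
apply: (@feasible_ext _ _ _ _ (fun x =>
  foldl (fun s (_ : tree) => rcons s (size s)) [::] (nseq (f x) Leaf))).
  by move=> x.
apply: (feasible_foldl Leaf (g := fun _ s _ => rcons s (size s))
  (p := fun n => 1 + (n + 2) ^ k * ((n + 2) ^ k * 2 + 2))) => //.
- exact: feasible_nseq.
- exact: feasible_const.
- apply: (@feasible_ext _ _ _ _ (fun y : X * seq nat * tree => y.1.2 ++ [:: size y.1.2])).
    by move=> y; rewrite cats1.
  apply: (feasible_cat 0); first by feasible_proj.
  apply: feasible_cons; last exact: feasible_const.
  by apply: (feasible_length 0); feasible_proj.
- apply: poly_add (poly_const _) (poly_mul (poly_base _) (poly_add (poly_mul _ _) _)).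
  + exact: poly_base.
  + exact: poly_const.
  + exact: poly_const.
move=> x j; rewrite size_nseq => jf; rewrite take_nseq// iotaE.
have key m n : esize (iota m n) <= 1 + n * ((m + n) * 2 + 2).
  by elim: n m => // n IH m; rewrite -[iota m n.+1]/(m :: iota m.+1 n) esize_cons esize_nat; have := IH m.+1; nia.
have := key 0 j; rewrite add0n => /leq_trans; apply.
have {}jf : j <= (esize x + 2) ^ k.
  by rewrite (leq_trans jf)// (leq_trans _ (szf x))// esize_nat; lia.
by rewrite leq_add2l leq_mul// leq_add2r leq_mul2r jf orbT.
Qed.

End ListRules.

(** * The reconstruction algorithm *)

Section Assembly.
Local Open Scope nat_scope.

(** Nested lists with the shape of encoded labelings: the algorithm works on them
    directly, and encodings of labelings are encodings of such arrays. *)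
Fixpoint arr (d : nat) : Type := if d is d'.+1 then seq (arr d') else nat.

Fixpoint arr_encoding d : Encoding (arr d) :=
  if d is d'.+1 return Encoding (arr d) then seq_encoding (@arr_encoding d')
  else nat_encoding.

Fixpoint arr0 d : arr d := if d is d'.+1 return arr d then [::] else 0.

(** Partial labelings are association lists from vertices to labels. *)
Definition vec := seq nat.
Definition labels := seq (vec * nat).

Fixpoint entries d : arr d -> labels :=
  if d is d'.+1 return arr d -> labels then fun a : seq (arr d') =>
    flatten [seq [seq (k :: e.1, e.2) | e <- entries (nth (arr0 d') a k)]
            | k <- iota 0 (size a)]
  else fun a : nat => [:: ([::], a)].

Fixpoint grid d m : seq vec :=
  if d is d'.+1 then flatten [seq [seq k :: u | u <- grid d' m] | k <- iota 0 m]
  else [:: [::]].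

Definition addv (u v : vec) : vec :=
  [seq nth 0 u k + nth 0 v k | k <- iota 0 (size u)].

Definition units d : seq vec :=
  [seq [seq nat_of_bool (i == j) | j <- iota 0 d] | i <- iota 0 d].

Definition place (c : vec) (B : labels) : labels :=
  [seq (addv c e.1, e.2) | e <- B].

Definition compatible (K : labels) (c : vec) (B : labels) : bool :=
  all (fun e => all (fun e' => (e'.1 == e.1) ==> (e'.2 == e.2)) K) (place c B).

(** The box at c is filled when the listed contents compatible with the known
    labels are all equal. If the known labels are correct, the true content of
    the box is among these, so nothing incorrect is ever written. *)
Definition paste (l : seq labels) (K : labels) (c : vec) : labels :=
  let ms := [seq B <- l | compatible K c B] in
  if all (fun B => B == head [::] ms) ms then place c (head [::] ms) ++ K else K.

(** Contents A and B for which a box with content B could lie at the translate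
    by - e of a box with content A. *)
Definition follows (e : vec) (B A : labels) : bool :=
  all (fun x => all (fun y => (y.1 == addv e x.1) ==> (y.2 == x.2)) B) A.

(** A box with a positive coordinate has a lower neighbour in that direction, and
    the content of this neighbour is listed. A content that follows no listed
    content in any direction therefore belongs to the box at the origin. *)
Definition at_origin d (l : seq labels) (A : labels) : bool :=
  all (fun e => all (fun B => ~~ follows e B A) l) (units d).

Definition lookup (K : labels) (v : vec) : nat :=
  head 0 [seq e.2 | e <- [seq e <- K | e.1 == v]].

Fixpoint tabulate d (n : nat) (K : labels) (v : vec) : arr d :=
  if d is d'.+1 return arr d then [seq tabulate d' n K (rcons v k) | k <- iota 0 n]
  else lookup K v.

(** The d-th root of N, found by search. *)
Definition grid_side d N : nat :=
  head 0 [seq m <- iota 0 N.+1 | size (grid d m) == N].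

Definition origin_labels d (l : seq labels) : labels :=
  head [::] [seq A <- l | at_origin d l A].

(** Sweeps over all positions of boxes. A sweep completes a new box unless the
    known labels are already closed under filling, so that N sweeps suffice for
    N boxes. *)
Definition passes d m N : seq vec := flatten [seq grid d m | _ <- iota 0 N].

(** With m positions in each direction for boxes of side r, the side of the
    whole array is m + r - 1; the side r is read off the first content. *)
Definition assemble d (l : seq (arr d.+1)) : arr d.+1 :=
  let l' := [seq entries a | a <- l] in
  let m := grid_side d.+1 (size l) in
  let K := foldl (paste l') (origin_labels d.+1 l') (passes d.+1 m (size l)) in
  tabulate d.+1 (m + (size (head [::] l)).-1) K [::].

End Assembly.

#[global] Existing Instance arr_encoding.
#[global] Instance vec_encoding : Encoding vec := seq_encoding nat_encoding.
#[global] Instance labels_encoding : Encoding labels :=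
  seq_encoding (prod_encoding vec_encoding nat_encoding).

Section AssemblyFeasible.
Local Open Scope nat_scope.

Lemma encode_nat_inj : injective (encode : nat -> tree).
Proof. by elim=> [|n IH] [|m]// [/IH ->]. Qed.

Lemma encode_seq_inj (A : Type) (eA : Encoding A) :
  injective (encode : A -> tree) -> injective (encode : seq A -> tree).
Proof. by move=> inj; elim=> [|a s IH] [|b t]// [/inj -> /IH ->]. Qed.

Lemma encode_pair_inj (A B : Type) (eA : Encoding A) (eB : Encoding B) :
  injective (encode : A -> tree) -> injective (encode : B -> tree) ->
  injective (encode : A * B -> tree).
Proof. by move=> iA iB [a b] [a' b'] [/iA -> /iB ->]. Qed.

Lemma encode_vec_inj : injective (encode : vec -> tree).
Proof. exact: encode_seq_inj encode_nat_inj. Qed.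

Lemma encode_labels_inj : injective (encode : labels -> tree).
Proof. exact: encode_seq_inj (encode_pair_inj encode_vec_inj encode_nat_inj). Qed.

Variables (X : Type) (eX : Encoding X).

Lemma feasible_entries d : feasible (@entries d).
Proof.
elim: d => [|d IH] /=.
  apply: (feasible_cons (f := fun a : nat => ([::] : vec, a))); last exact: feasible_const.
  by apply: feasible_pair; [exact: feasible_const|exact: feasible_id].
apply: (feasible_flatten ([::] : vec, 0)).
eapply (@feasible_map _ _ _ _ _ _ 0 [::] (fun (a : seq (arr d)) k =>
  [seq (k :: e.1, e.2) | e <- entries (nth (arr0 d) a k)])); last first.
  by apply: feasible_iota; apply: (feasible_length (arr0 d)); exact: feasible_id.
eapply (@feasible_map _ _ _ _ _ _ ([::], 0) ([::], 0)
  (fun (y : seq (arr d) * nat) (e : vec * nat) => (y.2 :: e.1, e.2))).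
  apply: feasible_pair; last by feasible_proj.
  by apply: feasible_cons; feasible_proj.
eapply (feasible_app IH).
by eapply feasible_nth; feasible_proj.
Qed.

Lemma feasible_grid d (f : X -> nat) : feasible f -> feasible (fun x => grid d (f x)).
Proof.
move=> ff; elim: d => [|d IH] /=; first exact: feasible_const.
apply: (feasible_flatten ([::] : vec)).
eapply (@feasible_map _ _ _ _ _ _ 0 [::] (fun x k => [seq k :: u | u <- grid d (f x)]));
  last exact: feasible_iota.
eapply (@feasible_map _ _ _ _ _ _ [::] [::] (fun (y : X * nat) (u : vec) => (y.2 :: u : vec))).
  by apply: feasible_cons; feasible_proj.
by eapply (feasible_app IH); feasible_proj.
Qed.

Lemma feasible_addv (f g : X -> vec) :
  feasible f -> feasible g -> feasible (fun x => addv (f x) (g x)).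
Proof.
move=> ff fg; eapply (@feasible_map _ _ _ _ _ _ 0 0
  (fun x k => nth 0 (f x) k + nth 0 (g x) k)); last first.
  by apply: feasible_iota; exact: (feasible_length 0).
apply: feasible_addn; eapply feasible_nth; try by feasible_proj.
  by eapply (feasible_app ff); feasible_proj.
by eapply (feasible_app fg); feasible_proj.
Qed.

Lemma feasible_eqvec (f g : X -> vec) :
  feasible f -> feasible g -> feasible (fun x => f x == g x).
Proof. exact: feasible_eq encode_vec_inj. Qed.

Lemma feasible_eqn (f g : X -> nat) :
  feasible f -> feasible g -> feasible (fun x => f x == g x).
Proof. exact: feasible_eq encode_nat_inj. Qed.

End AssemblyFeasible.

Section AssembleFeasible.
Local Open Scope nat_scope.

Lemma feasible_place (X : Type) (eX : Encoding X) (c : X -> vec) (B : X -> labels) :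
  feasible c -> feasible B -> feasible (fun x => place (c x) (B x)).
Proof.
move=> fc fB; eapply (@feasible_map _ _ _ _ _ _ ([::], 0) ([::], 0)
  (fun x (e : vec * nat) => (addv (c x) e.1, e.2))); last exact: fB.
apply: feasible_pair; last by feasible_proj.
apply: feasible_addv; last by feasible_proj.
by eapply (feasible_app fc); feasible_proj.
Qed.

Lemma feasible_compatible (X : Type) (eX : Encoding X) (K : X -> labels) (c : X -> vec)
    (B : X -> labels) :
  feasible K -> feasible c -> feasible B ->
  feasible (fun x => compatible (K x) (c x) (B x)).
Proof.
move=> fK fc fB; eapply (@feasible_all _ _ _ _ ([::], 0)
  (fun x (e : vec * nat) => all (fun e' : vec * nat => (e'.1 == e.1) ==> (e'.2 == e.2)) (K x)));
  last exact: feasible_place.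
eapply (@feasible_all _ _ _ _ ([::], 0)
  (fun (y : X * (vec * nat)) (e' : vec * nat) => (e'.1 == y.2.1) ==> (e'.2 == y.2.2)));
  last by eapply (feasible_app fK); feasible_proj.
apply: feasible_implyb; first by apply: feasible_eqvec; feasible_proj.
by apply: feasible_eqn; feasible_proj.
Qed.

Lemma feasible_lookup (X : Type) (eX : Encoding X) (K : X -> labels) (v : X -> vec) :
  feasible K -> feasible v -> feasible (fun x => lookup (K x) (v x)).
Proof.
move=> fK fv; apply: feasible_head.
eapply (@feasible_map _ _ _ _ _ _ ([::], 0) 0 (fun x (e : vec * nat) => e.2)).
  by feasible_proj.
eapply (@feasible_filter _ _ _ _ ([::], 0) (fun x (e : vec * nat) => e.1 == v x)); last exact: fK.
apply: feasible_eqvec; first by feasible_proj.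
by eapply (feasible_app fv); feasible_proj.
Qed.

Lemma feasible_tabulate (X : Type) (eX : Encoding X) d (n : X -> nat) (K : X -> labels)
    (v : X -> vec) :
  feasible n -> feasible K -> feasible v ->
  feasible (fun x => tabulate d (n x) (K x) (v x)).
Proof.
elim: d X eX n K v => [|d IH] X eX n K v fn fK fv /=; first exact: feasible_lookup.
eapply (@feasible_map _ _ _ _ _ _ 0 (arr0 d)
  (fun x k => tabulate d (n x) (K x) (rcons (v x) k))); last exact: feasible_iota.
apply: IH; [by eapply (feasible_app fn); feasible_proj|
  by eapply (feasible_app fK); feasible_proj|].
apply: (@feasible_ext _ _ _ _ (fun y : X * nat => (v y.1 ++ [:: y.2]))).
  by move=> y; rewrite cats1.
apply: (feasible_cat 0); first by eapply (feasible_app fv); feasible_proj.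
by apply: feasible_cons; [feasible_proj|exact: feasible_const].
Qed.

Lemma feasible_grid_side (X : Type) (eX : Encoding X) d (N : X -> nat) :
  feasible N -> feasible (fun x => grid_side d (N x)).
Proof.
move=> fN; apply: feasible_head.
eapply (@feasible_filter _ _ _ _ 0 (fun x m => size (grid d m) == N x));
  last by apply: feasible_iota; exact: feasible_succ.
apply: feasible_eqn; last by eapply (feasible_app fN); feasible_proj.
by apply: (feasible_length ([::] : vec)); apply: feasible_grid; feasible_proj.
Qed.

Lemma feasible_passes (X : Type) (eX : Encoding X) d (m N : X -> nat) :
  feasible m -> feasible N -> feasible (fun x => passes d (m x) (N x)).
Proof.
move=> fm fN; apply: (feasible_flatten ([::] : vec)).
eapply (@feasible_map _ _ _ _ _ _ 0 [::] (fun x (_ : nat) => grid d (m x)));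
  last exact: feasible_iota.
by apply: feasible_grid; eapply (feasible_app fm); feasible_proj.
Qed.

Lemma feasible_at_origin (X : Type) (eX : Encoding X) d (l : X -> seq labels) (A : X -> labels) :
  feasible l -> feasible A -> feasible (fun x => at_origin d (l x) (A x)).
Proof.
move=> fl fA.
eapply (@feasible_all _ _ _ _ [::]
  (fun x e => all (fun B => ~~ follows e B (A x)) (l x))); last exact: feasible_const.
eapply (@feasible_all _ _ _ _ [::] (fun (y : X * vec) B => ~~ follows y.2 B (A y.1)));
  last by eapply (feasible_app fl); feasible_proj.
apply: feasible_negb.
eapply (@feasible_all _ _ _ _ ([::], 0) (fun (z : X * vec * labels) (x : vec * nat) =>
  all (fun y : vec * nat => (y.1 == addv z.1.2 x.1) ==> (y.2 == x.2)) z.2));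
  last by eapply (feasible_app fA); feasible_proj.
eapply (@feasible_all _ _ _ _ ([::], 0) (fun (u : X * vec * labels * (vec * nat)) (y : vec * nat) =>
  (y.1 == addv u.1.1.2 u.2.1) ==> (y.2 == u.2.2))); last by feasible_proj.
apply: feasible_implyb; last by apply: feasible_eqn; feasible_proj.
by apply: feasible_eqvec; [|apply: feasible_addv]; feasible_proj.
Qed.

Lemma feasible_origin_labels (X : Type) (eX : Encoding X) d (l : X -> seq labels) :
  feasible l -> feasible (fun x => origin_labels d (l x)).
Proof.
move=> fl; apply: feasible_head.
eapply (@feasible_filter _ _ _ _ [::] (fun x A => at_origin d (l x) A)) => //.
by apply: feasible_at_origin; [eapply (feasible_app fl)|]; feasible_proj.
Qed.

Lemma feasible_paste (X : Type) (eX : Encoding X) (l : X -> seq labels) (K : X -> labels)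
    (c : X -> vec) :
  feasible l -> feasible K -> feasible c ->
  feasible (fun x => paste (l x) (K x) (c x)).
Proof.
move=> fl fK fc.
have fms : feasible (fun x => [seq B <- l x | compatible (K x) (c x) B]).
  eapply (@feasible_filter _ _ _ _ [::] (fun x B => compatible (K x) (c x) B)) => //.
  by apply: feasible_compatible; [eapply (feasible_app fK)|eapply (feasible_app fc)|];
    feasible_proj.
apply: feasible_if => //; last first.
  apply: (feasible_cat ([::], 0)) => //.
  by apply: feasible_place => //; exact: feasible_head.
eapply (@feasible_all _ _ _ _ [::] (fun x B =>
  B == head [::] [seq B <- l x | compatible (K x) (c x) B])) => //.
apply: feasible_eq encode_labels_inj _ _; first by feasible_proj.
by apply: feasible_head; eapply (feasible_app fms); feasible_proj.
Qed.

Lemma esize_filter A (eA : Encoding A) (p : pred A) (s : seq A) :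
  esize [seq a <- s | p a] <= esize s.
Proof.
elim: s => // a s IH; rewrite esize_cons.
have -> : [seq b <- a :: s | p b] = if p a then a :: [seq b <- s | p b] else [seq b <- s | p b] by [].
by case: (p a); rewrite ?esize_cons; lia.
Qed.

(** A paste adds at most one translated content, whose size is polynomial in the
    size of the input, so the growth is additive. *)
Lemma feasible_paste_all : feasible (fun x : seq labels * (labels * seq vec) =>
  foldl (paste x.1) x.2.1 x.2.2).
Proof.
have place_ok : feasible (fun y : vec * labels => place y.1 y.2).
  by apply: feasible_place; feasible_proj.
have [k szp] := feasible_size place_ok.
eapply (@feasible_foldl_add _ _ _ _ _ _ [::] (fun x => x.2.2) (fun x => x.2.1)
  (fun x => paste x.1) k); [by feasible_proj|by feasible_proj| |].
  by apply: feasible_paste; feasible_proj.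
move=> [l [s cs]] K c; rewrite /paste [(l, _).1]/=; case: ifP => _; last by rewrite leq_addr.
set B : labels := head _ _; rewrite (leq_trans (ltnW (esize_cat _ _ _)))// addnC leq_add2l.
apply: leq_trans (szp (c, B)) _; apply: leq_base2; rewrite !esize_pair.
have : @tsize (@encode labels _ B) <= esize l + 1.
  apply: leq_trans (esize_head _ _ _) _; rewrite leq_add//; exact: esize_filter.
by have := tsize_gt0 (encode s); unfold labels, vec in *; lia.
Qed.

Lemma feasible_assemble d : feasible (@assemble d).
Proof.
pose X := seq (arr d.+1); pose l' (l : X) := [seq entries a | a <- l].
have fid : feasible (fun l : X => l) by exact: feasible_id.
have fl' : feasible l'.
  eapply (@feasible_map _ _ _ _ _ _ (arr0 d.+1) [::] (fun _ a => entries a)) => //.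
  by eapply (feasible_app (feasible_entries d.+1)); feasible_proj.
have fsize : feasible (fun l : X => size l) by apply: (feasible_length (arr0 d.+1)).
have fm := feasible_grid_side d.+1 fsize.
have fK := feasible_comp feasible_paste_all (feasible_pair fl'
  (feasible_pair (feasible_origin_labels d.+1 fl') (feasible_passes d.+1 fm fsize))).
apply: (feasible_tabulate d.+1 _ fK); last exact: feasible_const.
apply: feasible_addn => //; apply: feasible_pred.
by apply: (feasible_length (arr0 d)); apply: feasible_head.
Qed.

End AssembleFeasible.

(** * Boxes, overlaps and reconstructible labelings *)

Section Cells.
Local Open Scope nat_scope.
Variables d n q : nat.
Implicit Types (s : config d n q) (v : Lambda d n) (p k : 'I_d -> nat).

Definition cell p k : {set Lambda d n} :=
  [set v : Lambda d n | [forall i, p i <= tnth v i < p i + k i]]%SET.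

Lemma cellP p k v : reflect (forall i, p i <= tnth v i < p i + k i) (v \in cell p k).
Proof. by rewrite inE; apply: forallP. Qed.

Definition fits p k := forall i, p i + k i <= n.

(** The translation that maps p to p' maps v to v'; stated with sums since the
    coordinates are natural numbers. *)
Definition translate p p' v v' := forall i, tnth v i + p' i = tnth v' i + p i.

Definition same s k p p' := forall v v', v \in cell p k -> translate p p' v v' -> s v = s v'.

Definition uniq_cell s k p := forall p', fits p' k -> same s k p p' -> p' =1 p.

Lemma Lambda_ex (x : 'I_d -> nat) : (forall i, x i < n) ->
  exists v : Lambda d n, forall i, tnth v i = x i :> nat.
Proof.
by move=> xn; exists [tuple Ordinal (xn i) | i < d] => i; rewrite tnth_mktuple.
Qed.

Lemma Lambda_eq v v' : (forall i, tnth v i = tnth v' i :> nat) -> v = v'.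
Proof. by move=> e; apply: eq_from_tnth => i; exact: val_inj (e i). Qed.

End Cells.

Section Boxes.
Local Open Scope nat_scope.
Variables d n q r : nat.
Implicit Types (s : config d n q) (c y : Lambda d n) (K : Lambda d n -> Prop).

Definition corner c : 'I_d -> nat := fun i => tnth c i.

Lemma boxesP c : reflect (forall i, tnth c i + r <= n) (c \in boxes d n r).
Proof. by rewrite inE; apply: forallP. Qed.

Lemma box_vertex_ex c v : c \in boxes d n r -> v \in cell n (corner c) (fun=> r) ->
  exists u : Lambda d r, box_vertex c u = v.
Proof.
move=> cB /cellP vc; have [|u uE] := @Lambda_ex d r (fun i => tnth v i - tnth c i).
  by move=> i; have := vc i; rewrite /corner/=; lia.
exists u; apply: Lambda_eq => i; rewrite tnth_box_vertex// uE subnKC//.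
by have /andP[] := vc i.
Qed.

(** The case in which the algorithm fills the box at c when K is known: all
    contents that occur in s and agree with s on the known part of that box are
    equal. *)
Definition determined s K c := forall y, y \in boxes d n r ->
  (forall u : Lambda d r, K (box_vertex c u) -> s (box_vertex y u) = s (box_vertex c u)) ->
  Defs.restrict r s y = Defs.restrict r s c.

Definition closed_under s K := forall c, c \in boxes d n r ->
  determined s K c -> forall u : Lambda d r, K (box_vertex c u).

Lemma determinedS s K K' c : (forall v, K v -> K' v) ->
  determined s K c -> determined s K' c.
Proof. by move=> KK' dc y yB h; apply: dc => // u /KK'; exact: h. Qed.

(** Side lengths of the overlap of two boxes that differ by a unit step in
    direction i. *)
Definition oside (i : 'I_d) : 'I_d -> nat := fun l => r - (l == i).

(** The first condition lets the box at the origin be recognized by its content.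
    The second one says that filling determined boxes, in any order, leads from
    that box to all vertices: the vertices reached form a closed set. *)
Definition reconstructible s :=
  (forall i, uniq_cell s (oside i) (fun=> 0)) /\
  (forall K, (forall v, v \in cell n (fun=> 0) (fun=> r) -> K v) ->
     closed_under s K -> forall v, K v).

End Boxes.

Section ArrayOfConfig.
Local Open Scope nat_scope.

Fixpoint arr_of (d n : nat) : (Lambda d n -> nat) -> arr d :=
  match d return (Lambda d n -> nat) -> arr d with
  | 0 => fun f => f [tuple]
  | d'.+1 => fun f =>
      [seq arr_of (fun w : Lambda d' n => f [tuple of x :: w]) | x <- enum 'I_n]
  end.

Definition arr_of_config d n q (s : config d n q) : arr d :=
  arr_of (fun v => s v : nat).

Lemma encode_arr_of d n (f : Lambda d n -> nat) :
  encode (arr_of f) = enc_array (fun v => enc_nat (f v)).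
Proof.
elim: d f => [|d IH] f //=.
rewrite /encode/= /seq_encoding -map_comp; congr enc_seq; apply: eq_map => x /=.
exact: IH.
Qed.

Lemma encode_arr_of_config d n q (s : config d n q) : encode (arr_of_config s) = enc_config s.
Proof. exact: encode_arr_of. Qed.

Lemma encode_arr_of_list d n q (l : seq (config d n q)) :
  encode [seq arr_of_config s | s <- l] = enc_list l.
Proof.
rewrite /encode /seq_encoding -map_comp /enc_list; congr enc_seq.
by apply: eq_map => s; exact: encode_arr_of_config.
Qed.

Definition coords d n (v : Lambda d n) : vec := [seq val i | i <- v].

Lemma size_coords d n (v : Lambda d n) : size (coords v) = d.
Proof. by rewrite size_map size_tuple. Qed.

Lemma nth_coords d n (v : Lambda d n) (i : 'I_d) : nth 0 (coords v) i = tnth v i.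
Proof.
rewrite (nth_map (tnth v i)) ?size_tuple//; congr val; exact: esym (tnth_nth _ _ _).
Qed.

Lemma coords_inj d n : injective (@coords d n).
Proof. by move=> v v' /(inj_map val_inj) /val_inj. Qed.

Lemma coordsP d n (u : vec) : size u = d -> all (fun x => x < n) u ->
  exists v : Lambda d n, coords v = u.
Proof.
move=> su /allP un; have [|v vE] := @Lambda_ex d n (fun i => nth 0 u i).
  by move=> i; apply/un/mem_nth; rewrite su.
exists v; apply: (@eq_from_nth _ 0); rewrite size_coords// => i id.
by rewrite (nth_coords v (Ordinal id)) vE.
Qed.

Lemma mem_entries d n (f : Lambda d n -> nat) e :
  reflect (exists v, e = (coords v, f v)) (e \in entries (arr_of f)).
Proof.
apply: (iffP idP).
- elim: d f e => [|d IH] f e /=.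
    by rewrite inE => /eqP ->; exists [tuple].
  case/flatten_mapP => k; rewrite mem_iota size_map size_enum_ord => /andP[_ kn].
  rewrite (nth_map (Ordinal kn)) ?size_enum_ord// => /mapP[e' /IH[w ->] ->] /=.
  have -> : nth (Ordinal kn) (enum 'I_n) k = Ordinal kn.
    by apply: val_inj; rewrite /= nth_enum_ord.
  by exists [tuple of Ordinal kn :: w].
- move=> [v ->] {e}; elim: d f v => [|d IH] f v /=.
    by rewrite tuple0 inE.
  apply/flatten_mapP; exists (val (thead v)).
    by rewrite mem_iota size_map size_enum_ord /=.
  apply/mapP; exists (coords [tuple of behead v], f v) => /=.
    rewrite (nth_map (thead v)) ?size_enum_ord// nth_ord_enum.
    by have := IH (fun w => f [tuple of thead v :: w]) [tuple of behead v]; rewrite -tuple_eta.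
  by rewrite {1}(tuple_eta v).
Qed.

Lemma mem_grid d m u : (u \in grid d m) = (size u == d) && all (fun x => x < m) u.
Proof.
elim: d u => [|d IH] u /=; first by case: u.
apply/flatten_mapP/idP => [[k]|].
  rewrite mem_iota /= => km /mapP[u' + ->]; rewrite IH /= => /andP[/eqP -> ->].
  by rewrite eqxx km.
case: u => [//|k u] /= /andP[/eqP[su] /andP[km um]].
by exists k; [rewrite mem_iota|apply/mapP; exists u => //; rewrite IH su eqxx].
Qed.

Lemma size_grid d m : size (grid d m) = m ^ d.
Proof.
elim: d => //= d IH; rewrite size_flatten /shape -map_comp.
rewrite (eq_map (g := fun=> m ^ d)); last by move=> k /=; rewrite size_map IH.
by rewrite sumnE big_map big_const_seq count_predT size_iota iter_addn_0 expnSr.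
Qed.

Lemma grid_sideE d m : grid_side d.+1 (m ^ d.+1) = m.
Proof.
rewrite /grid_side; set s := [seq a <- _ | _].
have inj a : size (grid d.+1 a) == m ^ d.+1 -> a = m.
  by rewrite size_grid eqn_exp2r// => /eqP.
have : m \in s.
  rewrite mem_filter size_grid eqxx mem_iota add0n ltnS /=.
  by case: m {s inj} => // m; rewrite -{1}[m.+1]expn1 leq_pexp2l.
case E : s => [//|a t] _ /=; apply: inj.
have : a \in s by rewrite E mem_head.
by rewrite mem_filter => /andP[].
Qed.

Lemma lookupE (K : labels) (v : vec) x : (v, x) \in K ->
  (forall e, e \in K -> e.1 = v -> e.2 = x) -> lookup K v = x.
Proof.
move=> vK Kx; rewrite /lookup.
have : (v, x) \in [seq e <- K | e.1 == v] by rewrite mem_filter eqxx.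
case E : [seq e <- K | e.1 == v] => [//|e t] _ /=.
have : e \in [seq e <- K | e.1 == v] by rewrite E mem_head.
by rewrite mem_filter => /andP[/eqP + eK]; exact: Kx.
Qed.

Lemma tabulateE d d' n (K : labels) (w : Lambda d n) (f : Lambda d' n -> nat) :
  (forall v, lookup K (coords w ++ coords v) = f v) ->
  tabulate d' n K (coords w) = arr_of f.
Proof.
elim: d' d w f => [|d' IH] d w f Kf /=; first by rewrite -(Kf [tuple]) cats0.
rewrite -val_enum_ord -map_comp; apply: eq_map => x /=.
have -> : rcons (coords w) x = coords [tuple of rcons w x] by rewrite /coords map_rcons.
by apply: IH => v; rewrite -Kf /coords /= map_rcons cat_rcons.
Qed.

End ArrayOfConfig.

(** * Correctness of the reconstruction *)

Section CellCard.
Local Open Scope nat_scope.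
Variables d n : nat.

Lemma card_interval a b : a + b <= n -> #|[pred x : 'I_n | a <= x < a + b]| = b.
Proof.
move=> abn; have lt (x : 'I_b) : a + x < n.
  by rewrite (leq_trans _ abn)// ltn_add2l.
pose f x := Ordinal (lt x).
have f_inj : injective f by move=> x y [/addnI xy]; exact: val_inj.
rewrite -[RHS]card_ord -(fintype.card_image f_inj).
apply: eq_card => x; rewrite inE; apply/idP/fintype.imageP => [/andP[ax xb]|[y _ ->]].
  have xab : x - a < b by rewrite ltn_subLR.
  by exists (Ordinal xab) => //; apply: val_inj; rewrite /= subnKC.
by rewrite /= leq_addr ltn_add2l ltn_ord.
Qed.

Lemma card_cell p k : fits n p k -> #|@cell d n p k| = \prod_i k i.
Proof.
move=> fit; pose g (v : Lambda d n) := [ffun i => tnth v i].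
have ginj : injective g.
  move=> v v' /ffunP e; apply: eq_from_tnth => i.
  by have := e i; rewrite !ffunE.
rewrite -(card_imset _ ginj).
pose F i := [pred x : 'I_n | p i <= x < p i + k i].
transitivity #|family F|.
  apply: eq_card => f; apply/imsetP/familyP => [[v /cellP vc ->] i|fF].
    by rewrite ffunE inE.
  exists [tuple f i | i < d]; last by apply/ffunP => i; rewrite ffunE tnth_mktuple.
  by apply/cellP => i; rewrite tnth_mktuple; have := fF i; rewrite inE.
rewrite card_family foldrE big_map big_enum /=.
by apply: eq_bigr => i _; exact: card_interval.
Qed.

Lemma card_Lambda : #|{: Lambda d n}| = n ^ d.
Proof. by rewrite card_tuple card_ord. Qed.

End CellCard.

Section AssembleCorrect.
Local Open Scope nat_scope.
Variables (d n q r : nat) (r0 : 0 < r) (rn : r <= n).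
Local Notation D := d.+1.
Implicit Types (s : config D n q) (l : seq (config D r q)) (c y v p : Lambda D n).

Let m := n - r + 1.

Lemma mem_boxes_lt c i : c \in boxes D n r -> tnth c i < m.
Proof. by move/boxesP/(_ i); rewrite /m; lia. Qed.

Lemma card_boxes : #|boxes D n r| = m ^ D.
Proof.
have -> : #|boxes D n r| = #|cell n (fun _ : 'I_D => 0) (fun=> m)|.
  apply: eq_card => c; apply/boxesP/cellP => cm i; have := cm i; rewrite /m; lia.
by rewrite card_cell ?prod_nat_const ?card_ord// => i; rewrite /m; lia.
Qed.

Lemma grid_boxes u : reflect (exists2 c, c \in boxes D n r & coords c = u) (u \in grid D m).
Proof.
rewrite mem_grid; apply: (iffP andP) => [[/eqP su um]|[c cB <-]].
  have [|c cu] := @coordsP _ n u su.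
    by apply/allP => x /(allP um); rewrite /m; lia.
  exists c => //; apply/boxesP => i.
  have : nth 0 u i < m by apply: (allP um); rewrite mem_nth// su.
  by rewrite -cu nth_coords /m; lia.
split; first by rewrite size_coords.
apply/allP => x /(nthP 0)[i]; rewrite size_coords => iD <-.
by rewrite (nth_coords c (Ordinal iD)); exact: mem_boxes_lt.
Qed.

Lemma nth_addv (u w : vec) i : i < size u -> nth 0 (addv u w) i = nth 0 u i + nth 0 w i.
Proof. by move=> iu; rewrite (nth_map 0) ?size_iota// nth_iota. Qed.

Lemma size_addv (u w : vec) : size (addv u w) = size u.
Proof. by rewrite size_map size_iota. Qed.

Definition unitv i : vec := [seq nat_of_bool (i == j) | j <- iota 0 D].

Lemma size_unitv i : size (unitv i) = D.
Proof. by rewrite size_map size_iota. Qed.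

Lemma nth_unitv i j : j < D -> nth 0 (unitv i) j = (i == j).
Proof. by move=> jD; rewrite (nth_map 0) ?size_iota// nth_iota. Qed.

Lemma addv_coords c (u : Lambda D r) : c \in boxes D n r ->
  addv (coords c) (coords u) = coords (box_vertex c u).
Proof.
move=> cB; apply: (@eq_from_nth _ 0); rewrite size_addv !size_coords// => i iD.
rewrite nth_addv ?size_coords//.
have e k (w : Lambda D k) : nth 0 (coords w) i = tnth w (Ordinal iD).
  by rewrite -nth_coords.
by rewrite !e tnth_box_vertex.
Qed.

Definition labels_of (B : config D r q) : labels := entries (arr_of_config B).

Lemma mem_labels_of (B : config D r q) e :
  reflect (exists u : Lambda D r, e = (coords u, B u : nat)) (e \in labels_of B).
Proof. exact: mem_entries. Qed.

Definition sound s (K : labels) := forall e, e \in K -> exists v, e = (coords v, s v : nat).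

Definition known (K : labels) v := coords v \in [seq e.1 | e <- K].

Lemma sound_known s K v : sound s K -> known K v -> (coords v, s v : nat) \in K.
Proof.
move=> Ks /mapP[[u x] eK /= vu]; have [v' e'] := Ks _ eK.
by move: e' eK vu => [-> ->] eK /coords_inj ->.
Qed.

Lemma mem_place s c e : c \in boxes D n r ->
  reflect (exists u : Lambda D r, e = (coords (box_vertex c u), s (box_vertex c u) : nat))
    (e \in place (coords c) (labels_of (Defs.restrict r s c))).
Proof.
move=> cB; apply: (iffP mapP) => [[_ /mem_labels_of[u ->] ->] /=|[u ->]].
  by exists u; rewrite addv_coords// ffunE.
exists (coords u, s (box_vertex c u) : nat); last by rewrite /= addv_coords.
by apply/mem_labels_of; exists u; rewrite ffunE.
Qed.

Lemma compatible_own s K c : sound s K -> c \in boxes D n r ->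
  compatible K (coords c) (labels_of (Defs.restrict r s c)).
Proof.
move=> Ks cB; apply/allP => e /(mem_place s _ cB)[u ->] /=.
apply/allP => e' /Ks[v ->] /=; apply/implyP => /eqP /coords_inj ->.
by rewrite eqxx.
Qed.

Lemma compatible_agree s K c y : sound s K -> c \in boxes D n r -> y \in boxes D n r ->
  compatible K (coords c) (labels_of (Defs.restrict r s y)) ->
  forall u : Lambda D r, known K (box_vertex c u) -> s (box_vertex y u) = s (box_vertex c u).
Proof.
move=> Ks cB yB /allP comp u ku.
have /comp /allP/(_ _ (sound_known Ks ku)) :
    (coords (box_vertex c u), s (box_vertex y u) : nat) \in
    place (coords c) (labels_of (Defs.restrict r s y)).
  apply/mapP; exists (coords u, s (box_vertex y u) : nat); last by rewrite /= addv_coords.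
  by apply/mem_labels_of; exists u; rewrite ffunE.
by rewrite /= eqxx /= => /eqP e; apply: val_inj; rewrite /= e.
Qed.

Section Listing.
Variables (s : config D n q) (l : seq (config D r q)).
Hypothesis sl : lists_profile s l.

Lemma listing_perm : perm_eq l [seq Defs.restrict r s c | c in boxes D n r].
Proof. exact/eq_seq_msetP. Qed.

Lemma mem_listing B : reflect (exists2 c, c \in boxes D n r & B = Defs.restrict r s c) (B \in l).
Proof. by rewrite (perm_mem listing_perm); exact: fintype.imageP. Qed.

Lemma size_listing : size l = m ^ D.
Proof. by rewrite (perm_size listing_perm) size_image card_boxes. Qed.

Local Notation l' := [seq labels_of B | B <- l].

Lemma mem_matches K c B : sound s K -> c \in boxes D n r ->
  (B \in [seq B <- l' | compatible K (coords c) B]) ->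
  exists y, [/\ y \in boxes D n r, B = labels_of (Defs.restrict r s y) &
    compatible K (coords c) B].
Proof.
by move=> Ks cB; rewrite mem_filter => /andP[cp /mapP[_ /mem_listing[y yB ->] BE]]; exists y.
Qed.

Lemma own_match K c : sound s K -> c \in boxes D n r ->
  labels_of (Defs.restrict r s c) \in [seq B <- l' | compatible K (coords c) B].
Proof.
move=> Ks cB; rewrite mem_filter compatible_own//=; apply: map_f.
by apply/mem_listing; exists c.
Qed.

Lemma sound_place c : c \in boxes D n r ->
  sound s (place (coords c) (labels_of (Defs.restrict r s c))).
Proof. by move=> cB e /(mem_place s _ cB)[u ->]; eexists. Qed.

(** The true content is compatible with correct labels; if all compatible
    contents are equal, they equal the true one. *)
Lemma paste_sound K c : sound s K -> c \in boxes D n r -> sound s (paste l' K (coords c)).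
Proof.
move=> Ks cB; rewrite /paste; set ms := [seq _ <- _ | _].
case: ifP => // /allP ms1; have /ms1/eqP <- := own_match Ks cB.
by move=> e; rewrite mem_cat => /orP[|/Ks//]; exact: sound_place.
Qed.

Lemma paste_mono K (u : vec) v : known K v -> known (paste l' K u) v.
Proof.
by rewrite /paste; case: ifP => // _; rewrite /known map_cat mem_cat => ->; rewrite orbT.
Qed.

Lemma paste_determined K c : sound s K -> c \in boxes D n r -> determined r s (known K) c ->
  forall u : Lambda D r, known (paste l' K (coords c)) (box_vertex c u).
Proof.
move=> Ks cB cdet u; rewrite /paste; set ms := [seq _ <- _ | _].
have all1 B : B \in ms -> B = labels_of (Defs.restrict r s c).
  move=> /(mem_matches Ks cB)[y [yB -> cp]]; congr labels_of; apply: cdet => //.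
  exact: compatible_agree cp.
have own := own_match Ks cB.
have hd : head [::] ms = labels_of (Defs.restrict r s c).
  apply: all1; case E : ms own => [|B t] own; first by rewrite -/ms E in own.
  by rewrite mem_head.
have -> : all (fun B => B == head [::] ms) ms.
  by apply/allP => B /all1 ->; rewrite hd.
rewrite hd /known map_cat mem_cat; apply/orP; left; apply/mapP.
exists (coords (box_vertex c u), s (box_vertex c u) : nat) => //.
by apply/mem_place => //; exists u.
Qed.

Definition pass K := foldl (paste l') K (grid D m).

Lemma foldl_paste_sound K (cs : seq vec) : {subset cs <= grid D m} ->
  sound s K -> sound s (foldl (paste l') K cs).
Proof.
elim: cs K => //= u cs IH K sub Ks; apply: IH.
  by move=> x xs; apply: sub; rewrite inE xs orbT.
have /grid_boxes[c cB <-] : u \in grid D m by apply: sub; rewrite mem_head.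
exact: paste_sound.
Qed.

Lemma foldl_paste_mono K (cs : seq vec) v : known K v -> known (foldl (paste l') K cs) v.
Proof. by elim: cs K => //= u cs IH K Kv; apply: IH; exact: paste_mono. Qed.

Lemma pass_determined K c : sound s K -> c \in boxes D n r -> determined r s (known K) c ->
  forall u : Lambda D r, known (pass K) (box_vertex c u).
Proof.
move=> Ks cB cdet u; rewrite /pass.
have cg : coords c \in grid D m by apply/grid_boxes; exists c.
have : {subset grid D m <= grid D m} by [].
move: cg; move: {1 2 4}(grid D m) => cs cg sub.
elim: cs K Ks cdet cg sub => //= w cs IH K Ks cdet cg sub.
have sub' : {subset cs <= grid D m} by move=> x xs; apply: sub; rewrite inE xs orbT.
move: cg; rewrite inE => /predU1P[<-|ccs].
  by apply: foldl_paste_mono; exact: paste_determined.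
have /grid_boxes[c' c'B wc] : w \in grid D m by apply: sub; rewrite mem_head.
apply: IH => //; first by rewrite -wc; exact: paste_sound.
by apply: determinedS cdet => v; exact: paste_mono.
Qed.

Lemma foldl_passes K N : foldl (paste l') K (passes D m N) = iter N pass K.
Proof.
rewrite /passes; have -> : iter N pass K = iter (size (iota 0 N)) pass K by rewrite size_iota.
elim: (iota 0 N) K => //= _ t IH K; rewrite foldl_cat -/(pass K) IH -iterSr.
by [].
Qed.

Lemma iter_pass_sound K N : sound s K -> sound s (iter N pass K).
Proof. by move=> Ks; elim: N => //= N IH; exact: foldl_paste_sound. Qed.

(** While a vertex is unknown, the known set is not closed, hence some box that
    is determined but incomplete gets completed by the next sweep. After i sweeps
    more than i boxes are complete, which is impossible when i is the number of
    boxes. *)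
Lemma iter_pass_all K c0 : sound s K -> c0 \in boxes D n r ->
  (forall u : Lambda D r, known K (box_vertex c0 u)) ->
  (forall K' : Lambda D n -> Prop, (forall v, v \in cell n (corner c0) (fun=> r) -> K' v) ->
     closed_under r s K' -> forall v, K' v) ->
  forall v, known (iter (size l) pass K) v.
Proof.
move=> Ks c0B K0 compl; apply: contrapT => nall.
have mono i v : known (iter i pass K) v -> known (iter i.+1 pass K) v.
  by move=> kv; rewrite iterS; exact: foldl_paste_mono.
have monole i j v : i <= j -> known (iter i pass K) v -> known (iter j pass K) v.
  by move=> /subnK <-; elim: (j - i) => // k IH kv; rewrite addSn; apply/mono/IH.
pose done i := [set c in boxes D n r | [forall u : Lambda D r,
  known (iter i pass K) (box_vertex c u)]]%SET.
have grow i : i <= size l -> i < #|done i|.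
  elim: i => [|i IH] il.
    apply/card_gt0P; exists c0; rewrite inE c0B; exact/forallP.
  apply: leq_ltn_trans (IH (ltnW il)) _; apply: proper_card; apply/properP; split.
    apply/fintype.subsetP => c; rewrite !inE => /andP[-> /forallP ku]; apply/forallP => u.
    exact: mono.
  have /existsNP[c /not_implyP[cB /not_implyP[cdet ncu]]] :
      ~ closed_under r s (known (iter i pass K)).
    move=> cl; apply: nall => v; apply: (monole i); first exact: ltnW.
    apply: compl cl v => v vc; have [u <-] := box_vertex_ex c0B vc.
    exact: (monole 0).
  exists c; rewrite inE cB/=.
    by apply/forallP => u; apply: pass_determined => //; exact: iter_pass_sound.
  by apply/negP => /forallP.
have /subset_leq_card : done (size l) \subset boxes D n r.
  by apply/fintype.subsetP => c; rewrite inE => /andP[].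
by rewrite leqNgt card_boxes -size_listing grow.
Qed.

Lemma at_origin_sound p : p \in boxes D n r ->
  at_origin D l' (labels_of (Defs.restrict r s p)) -> forall i, tnth p i = 0 :> nat.
Proof.
move=> pB /allP ori i; apply/eqP; rewrite -leqn0 leqNgt; apply/negP => pi0.
have [|y yE] := @Lambda_ex D n (fun j => tnth p j - (j == i)).
  by move=> j; rewrite (leq_ltn_trans (leq_subr _ _)).
have yB : y \in boxes D n r.
  by apply/boxesP => j; rewrite yE; have /boxesP/(_ j) := pB; lia.
have eu : unitv i \in units D.
  by apply/mapP; exists (val i) => //; rewrite mem_iota/=.
have /allP/(_ (labels_of (Defs.restrict r s y))) := ori _ eu.
case/(_ _)/negP; first by apply/map_f/mem_listing; exists y.
apply/allP => _ /mem_labels_of[u ->]; apply/allP => _ /mem_labels_of[w ->] /=.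
apply/implyP => /eqP wE; apply/eqP; rewrite !ffunE; congr (val (s _)).
apply: Lambda_eq => j; rewrite !tnth_box_vertex// yE.
have : nth 0 (coords w) j = (j == i) + tnth u j.
  by rewrite wE nth_addv ?size_unitv// nth_unitv// nth_coords eq_sym.
rewrite nth_coords => ->; have [->|_] := eqVneq j i; lia.
Qed.

(** A listed content that precedes the content of the origin box in direction i
    would be a second occurrence of the overlap located at the origin. *)
Lemma at_origin_complete p : p \in boxes D n r -> (forall i, tnth p i = 0 :> nat) ->
  (forall i, uniq_cell s (oside r i) (fun=> 0)) ->
  at_origin D l' (labels_of (Defs.restrict r s p)).
Proof.
move=> pB p0 un; apply/allP => _ /mapP[i0 + ->]; rewrite mem_iota => /= i0D.
set i := Ordinal i0D; apply/allP => _ /mapP[_ /mem_listing[y yB ->] ->].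
apply/negP => /allP fol; pose p' j := corner y j + (j == i).
have : p' =1 fun=> 0.
  apply: (un i) => [j|v v' /cellP vc vv'].
    by have /boxesP/(_ j) := yB; rewrite /p' /oside /corner; case: eqVneq; lia.
  have [|u uE] := @Lambda_ex D r (fun j => tnth v j).
    by move=> j; have := vc j; rewrite /oside; lia.
  have [|w wE] := @Lambda_ex D r (fun j => tnth v j + (j == i)).
    move=> j; have := vc j; rewrite /oside; case: eqVneq; lia.
  have vE : box_vertex p u = v.
    by apply: Lambda_eq => j; rewrite tnth_box_vertex// p0 uE.
  have v'E : box_vertex y w = v'.
    by apply: Lambda_eq => j; rewrite tnth_box_vertex// wE; have := vv' j; rewrite /p' /corner; lia.
  have /fol /allP : (coords u, s v : nat) \in labels_of (Defs.restrict r s p).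
    by apply/mem_labels_of; exists u; rewrite ffunE vE.
  have mw : (coords w, s v' : nat) \in labels_of (Defs.restrict r s y).
    by apply/mem_labels_of; exists w; rewrite ffunE v'E.
  move=> /(_ _ mw) /= /implyP h; apply: val_inj; apply/esym/eqP/h/eqP.
  apply: (@eq_from_nth _ 0); rewrite size_coords ?size_addv ?size_unitv// => j jD.
  rewrite -/(unitv i0) nth_addv ?size_unitv// nth_unitv//.
  by rewrite (nth_coords w (Ordinal jD)) (nth_coords u (Ordinal jD)) wE uE addnC [i0 == j]eq_sym.
by move=> /(_ i); rewrite /p' eqxx addn1.
Qed.

End Listing.

Lemma origin_ex : exists2 p : Lambda D n, p \in boxes D n r & forall i, tnth p i = 0 :> nat.
Proof.
have [|p pE] := @Lambda_ex D n (fun=> 0); first by move=> _; exact: leq_trans r0 rn.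
by exists p => //; apply/boxesP => i; rewrite pE.
Qed.

Lemma corner_origin p : (forall i, tnth p i = 0 :> nat) -> corner p = (fun=> 0).
Proof. by move=> p0; apply/funext. Qed.

(** The computed labels are correct for every labeling s' that has the given
    profile, reconstructible or not. This is what turns the correctness of the
    algorithm into uniqueness of the labeling. *)
Lemma final_labels s l : lists_profile s l -> reconstructible r s ->
  let l' := [seq labels_of B | B <- l] in
  let K := foldl (paste l') (origin_labels D l') (passes D m (size l)) in
  (forall v, known K v) /\ (forall s', lists_profile s' l -> sound s' K).
Proof.
move=> sl [un compl] l' K; have [p pB p0] := origin_ex.
have mem_or s' B : lists_profile s' l -> B \in [seq B <- l' | at_origin D l' B] ->
    exists p', [/\ p' \in boxes D n r, B = labels_of (Defs.restrict r s' p') &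
      forall i, tnth p' i = 0 :> nat].
  move=> s'l; rewrite mem_filter => /andP[ori /mapP[_ /(mem_listing s'l)[p' p'B ->] BE]].
  by exists p'; split=> //; apply: (at_origin_sound s'l p'B); rewrite -BE.
have own : labels_of (Defs.restrict r s p) \in [seq B <- l' | at_origin D l' B].
  rewrite mem_filter (at_origin_complete sl)//=.
  by apply/map_f/(mem_listing sl); exists p.
have oin : origin_labels D l' \in [seq B <- l' | at_origin D l' B].
  by rewrite /origin_labels; case: [seq B <- l' | _] own => // B t _; rewrite mem_head.
have addv0 (c : Lambda D n) (u : Lambda D r) : (forall i, tnth c i = 0 :> nat) ->
    c \in boxes D n r -> coords (box_vertex c u) = coords u.
  move=> c0 cB; rewrite -addv_coords//; apply: (@eq_from_nth _ 0).
    by rewrite size_addv !size_coords.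
  move=> i; rewrite size_addv size_coords => iD; rewrite nth_addv ?size_coords//.
  by rewrite (nth_coords c (Ordinal iD)) c0.
have sound0 s' : lists_profile s' l -> sound s' (origin_labels D l').
  move=> s'l; have [p' [p'B -> p'0]] := mem_or _ _ s'l oin.
  move=> _ /mem_labels_of[u ->]; exists (box_vertex p' u).
  by rewrite ffunE addv0.
split; last first.
  move=> s' s'l; rewrite /K foldl_passes//; apply: iter_pass_sound => //; exact: sound0.
rewrite /K foldl_passes//; apply: (iter_pass_all sl (sound0 _ sl) pB); last first.
  by rewrite corner_origin.
move=> u; have [p' [p'B -> p'0]] := mem_or _ _ sl oin.
rewrite /known addv0//; apply/mapP; exists (coords u, Defs.restrict r s p' u : nat) => //.
by apply/mem_labels_of; exists u.
Qed.

Theorem assembleE s l : lists_profile s l -> reconstructible r s ->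
  assemble [seq arr_of_config B | B <- l] = arr_of_config s.
Proof.
move=> sl rec; have [kn so] := final_labels sl rec.
rewrite /assemble size_map -map_comp.
have -> : grid_side D (size l) = m by rewrite (size_listing sl) grid_sideE.
have l0 : 0 < size l by rewrite (size_listing sl) expn_gt0 /m addn1.
have -> : m + (size (head [::] [seq arr_of_config B | B <- l])).-1 = n.
  case: l l0 {sl kn so} => //= B t _; rewrite size_map size_enum_ord /m; lia.
rewrite -[[::]]/(coords ([tuple] : Lambda 0 n)); apply: tabulateE => v /=.
apply: lookupE; first exact: (sound_known (so _ sl) (kn v)).
by move=> e /(so _ sl)[v' ->] /= /coords_inj ->.
Qed.

Theorem reconstructible_identifiable s : reconstructible r s -> identifiable r s.
Proof.
move=> rec [s' [neq e]]; pose l := enum_mset (profile r s).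
have sl : lists_profile s l by rewrite /lists_profile /l seq_mset_id.
have s'l : lists_profile s' l by rewrite /lists_profile e.
have [kn so] := final_labels sl rec; apply: neq; apply/ffunP => v.
have := sound_known (so _ sl) (kn v).
move=> /(so _ s'l)[v' [/coords_inj <- e']]; exact: val_inj.
Qed.

End AssembleCorrect.

(** * Running time in terms of n *)

Section PolynomialTimeRecovery.
Local Open Scope nat_scope.

Lemma tsize_enc_nat k : tsize (enc_nat k) = k.*2.+1.
Proof. by elim: k => //= k ->; rewrite doubleS. Qed.

Lemma tsize_enc_seq (s : seq tree) M : (forall t, List.In t s -> tsize t <= M) ->
  tsize (enc_seq s) <= 1 + size s * M.+1.
Proof.
elim: s => //= t s IH tM; have := tM t (or_introl erefl).
by have := IH (fun t' t's => tM t' (or_intror t's)); rewrite mulSn; lia.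
Qed.

Lemma tsize_enc_array d n M (f : Lambda d n -> tree) :
  0 < M -> (forall v, tsize (f v) <= M) ->
  tsize (enc_array f) <= M * (2 * n.+1) ^ d.
Proof.
move=> M0; elim: d f => [|d IH] f fM /=; first by rewrite expn0 muln1.
apply: leq_trans (tsize_enc_seq _) _ => [t /List.in_map_iff[x [<- _]]|].
  exact: IH.
rewrite size_map size_enum_ord expnS; have : 0 < M * (2 * n.+1) ^ d.
  by rewrite muln_gt0 M0 expn_gt0.
by rewrite mulnCA; move: (M * _) => X; nia.
Qed.

(** There are at most n ^ d boxes with at most n ^ d labels below q each, so the
    size of the input is polynomial in n. *)
Lemma poly_time_feasible d q (r : nat -> nat) (f : seq (arr d.+1) -> arr d.+1) :
  (forall n, 1 <= n -> 1 <= r n <= n) -> feasible f ->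
  exists2 c, poly_time d.+1 q r c &
    forall n (l : seq (config d.+1 (r n) q)), exists t,
      runs c (enc_list l) t (encode (f [seq arr_of_config B | B <- l])).
Proof.
move=> hr [c [N [k [fc _]]]]; exists c; last first.
  move=> n l; have [] := fc (update (fun=> Leaf) 0 (enc_list l)) [seq arr_of_config B | B <- l].
    by rewrite encode_arr_of_list.
  by move=> t [m' [e m'0 _ _]]; exists t, m'.
have [k' k'P] : poly (fun n => (1 + n ^ d.+1 * ((2 * q).+1 * (2 * n.+1) ^ d.+1).+1 + 2) ^ k).
  have pS : poly S by apply: poly_le (poly_add poly_id (poly_const 1)) => n; rewrite addn1.
  have pX g e : poly g -> poly (fun n => g n ^ e).
    move=> [a ga]; apply: poly_le (poly_exp e (poly_base a)) => n.
    by case: e => // e; rewrite leq_exp2r// (leq_trans (ga n))// leq_addr.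
  apply: poly_exp; apply: poly_add (poly_const _) (poly_mul (pX _ _ poly_id) _).
  apply: (poly_le (g := fun n => (2 * q).+1 * (2 * n.+1) ^ d.+1 + 1)).
    by move=> n; rewrite addn1.
  apply: poly_add (poly_const _); apply: poly_mul (poly_const _) (pX _ _ _).
  exact: poly_mul (poly_const _) pS.
exists (2 ^ k'), k' => n s l sl.
have [] := fc (update (fun=> Leaf) 0 (enc_list l)) [seq arr_of_config B | B <- l].
  by rewrite encode_arr_of_list.
move=> t [m' [e m'0 _ tk]]; exists t, (m' 0); split; first by exists m'.
rewrite -expnMn; apply: (@leq_trans ((n + 2) ^ k')); last first.
  by case: k' {k'P} => // k'; rewrite leq_exp2r//; lia.
apply: leq_trans tk (leq_trans _ (k'P n)).
case: k {fc k'P} => // k; rewrite leq_exp2r// leq_add2r encode_arr_of_list.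
have sz : size l <= n ^ d.+1.
  rewrite (perm_size (listing_perm sl)) size_image -card_Lambda; exact: max_card.
have [n0|n0] := posnP n.
  have nd : n ^ d.+1 = 0 by rewrite n0 exp0n.
  by move: sz; rewrite nd leqn0 => /eqP/size0nil ->.
apply: leq_trans (@tsize_enc_seq _ ((2 * q).+1 * (2 * n.+1) ^ d.+1) _) _.
  move=> u /List.in_map_iff[B [<- _]].
  apply: (@leq_trans ((2 * q).+1 * (2 * (r n).+1) ^ d.+1)).
    apply: tsize_enc_array => // v; rewrite tsize_enc_nat -mul2n ltnS leq_mul2l/=.
    exact/ltnW/ltn_ord.
  by rewrite leq_mul2l/= leq_exp2r// leq_mul2l/= ltnS; have /andP[] := hr n n0.
by rewrite size_map leq_add2l leq_mul2r sz orbT.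
Qed.

End PolynomialTimeRecovery.

(** * Spreading through clean hyperplanes *)

Section Growth.
Local Open Scope nat_scope.
Variables d n q r : nat.
Hypothesis r0 : 0 < r.
Variable s : config d n q.
Implicit Types (c p z : 'I_d -> nat) (i j l : 'I_d).

Definition bump_at i c : 'I_d -> nat := fun l => c l + (l == i).
Definition set_at i a c : 'I_d -> nat := fun l => if l == i then a else c l.

Section Closed.
Variable K : Lambda d n -> Prop.
Hypothesis Kcl : closed_under r s K.

Definition known_cell k p := forall v, v \in cell n p k -> K v.

(** If a content agrees with that of the box at c on a known overlap, then its own
    position exhibits an occurrence of the overlap; uniqueness of the overlap
    makes this position equal to c. The bit b tells whether the overlap is the
    lower or the upper part of the box in direction i. *)
Lemma known_step (b : bool) i c p : (forall l, p l = c l + b * (l == i)) ->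
  fits n c (fun=> r) -> uniq_cell s (oside r i) p -> known_cell (oside r i) p ->
  known_cell (fun=> r) c.
Proof.
move=> pE fc un Kp; have [|c0 c0E] := @Lambda_ex d n c.
  by move=> l; have := fc l; lia.
have cc0 : corner c0 = c by apply/funext => l; rewrite /corner c0E.
have c0B : c0 \in boxes d n r by apply/boxesP => l; rewrite c0E; exact: fc.
move=> v; rewrite -cc0 => /(box_vertex_ex c0B)[u <-]; apply: Kcl => // y yB agree.
pose p' l := corner y l + b * (l == i).
have p'p : p' =1 p.
  apply: un => [l|v1 v2 /cellP v1p v12].
    have /boxesP/(_ l) := yB; rewrite /p' /corner /oside.
    by case: (l == i); case: b pE {p'} => ?; lia.
  have [|u1 u1E] := @box_vertex_ex d n r c0 v1 c0B.
    apply/cellP => l; rewrite cc0; have := v1p l; rewrite pE /oside.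
    by case: (l == i); case: b {p' pE v12} => /=; lia.
  have -> : v2 = box_vertex y u1.
    apply: Lambda_eq => l; rewrite tnth_box_vertex//.
    have := v12 l; rewrite -u1E tnth_box_vertex// c0E pE /p' /corner; lia.
  rewrite -u1E agree// u1E; apply: Kp; exact/cellP.
suff -> : y = c0 by [].
apply: Lambda_eq => l; have := p'p l; rewrite /p' pE c0E /corner; lia.
Qed.

Lemma known_sub k k' p p' : (forall l, p l <= p' l) -> (forall l, p' l + k' l <= p l + k l) ->
  known_cell k p -> known_cell k' p'.
Proof.
by move=> pp kk Kp v /cellP vp; apply/Kp/cellP => l; have := vp l; have := pp l; have := kk l; lia.
Qed.

Lemma known_bump i c : fits n (bump_at i c) (fun=> r) ->
  uniq_cell s (oside r i) (bump_at i c) ->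
  known_cell (fun=> r) c <-> known_cell (fun=> r) (bump_at i c).
Proof.
move=> fb un; split=> Kc.
  apply: (@known_step false i) un _ => //; first by move=> l; rewrite mul0n addn0.
  by apply: known_sub Kc => l; rewrite /bump_at /oside; case: (l == i); lia.
apply: (@known_step true i c _ _ _ un); first by move=> l; rewrite mul1n.
  by move=> l; have := fb l; rewrite /bump_at; lia.
by apply: known_sub Kc => l; rewrite /bump_at /oside; case: (l == i); lia.
Qed.

Lemma known_all_boxes : r <= n ->
  (forall c, fits n c (fun=> r) -> known_cell (fun=> r) c) -> forall v, K v.
Proof.
move=> rn kn v; apply: (kn (fun l => minn (tnth v l) (n - r))) => [l|]; first by lia.
by apply/cellP => l; have := ltn_ord (tnth v l); lia.
Qed.

End Closed.

(** Every box is reached from the origin by unit steps. *)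
Lemma reconstructible_all_uniq : r <= n ->
  (forall i p, fits n p (oside r i) -> uniq_cell s (oside r i) p) -> reconstructible r s.
Proof.
move=> rn un; split=> [i|K K0 Kcl].
  by apply: un => l; rewrite /oside; lia.
apply: known_all_boxes => // c; have [m] := ubnP (\sum_i c i).
elim: m c => // m IH c cm fc; have [c0|] := boolP [forall i, c i == 0].
  move=> v vc; apply: K0; apply/cellP => l; have /cellP/(_ l) := vc.
  by have /eqP-> := forallP c0 l.
case/forallPn => i ci; pose c' l := c l - (l == i).
have cE : c = bump_at i c'.
  by apply/funext => l; rewrite /bump_at /c'; case: eqVneq => [->|]; lia.
have fc' : fits n c' (fun=> r) by move=> l; have := fc l; rewrite /c'; lia.
have unc : uniq_cell s (oside r i) c.
  by apply: un => l; have := fc l; rewrite /oside; lia.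
have [||kc _] := @known_bump K Kcl i c'; rewrite -?cE//; rewrite -cE in kc.
apply: kc; apply: IH fc'; move: cm; rewrite ltnS; apply: leq_trans.
rewrite (bigD1 i)//= [X in _ < X](bigD1 i)//= -addSn leq_add//.
  by rewrite /c' eqxx; lia.
by apply: leq_sum => l _; rewrite /c'; lia.
Qed.

Section Windows.
Variable L : nat.
Let w := 3 * L.
Hypothesis d2 : 1 < d.
Hypothesis L0 : 0 < L.
Hypothesis nbig : r + w <= n.

(** Cubes of positions of boxes. *)
Definition window z (m : nat) c := forall l, z l <= c l <= z l + m.

(** All unit steps inside the hyperplane with j-th coordinate a cross unique
    overlaps, as long as they stay in the window. *)
Definition clean z m j a := forall c i, window z m c -> c j = a -> i != j ->
  fits n (bump_at i c) (fun=> r) -> uniq_cell s (oside r i) (bump_at i c).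

Hypothesis clean_ex : forall z j a0, exists2 a, a0 <= a < a0 + L & clean z w.+1 j a.

Hypothesis no_run : forall i j p, i != j ->
  (forall t, t < r -> fits n (fun l => p l + t * (l == j)) (oside r i)) ->
  exists2 t, t < r & uniq_cell s (oside r i) (fun l => p l + t * (l == j)).

Hypothesis corners : forall z i p, (forall l, z l = 0 \/ z l = n - r - w) ->
  window z w.+1 p -> fits n p (oside r i) -> uniq_cell s (oside r i) p.

Lemma other_direction j : exists i : 'I_d, i != j.
Proof.
have [/eqP j0|j0] := boolP (j == 0 :> nat).
  by exists (Ordinal d2); apply/eqP => /(congr1 val) /=; lia.
by exists (Ordinal (ltnW d2)); apply/eqP => /(congr1 val) /=; move/eqP: j0; lia.
Qed.

Lemma cleanS z z' m m' j a : (forall c, window z' m' c -> window z m c) ->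
  clean z m j a -> clean z' m' j a.
Proof. by move=> zz cl c i /zz; exact: cl. Qed.

Variable K : Lambda d n -> Prop.
Hypothesis K0 : forall v, v \in cell n (fun=> 0) (fun=> r) -> K v.
Hypothesis Kcl : closed_under r s K.
Local Notation known c := (known_cell K (fun=> r) c).

Definition valid z := forall l, z l + w + r <= n.

Lemma window_fits z c : valid z -> window z w c -> fits n c (fun=> r).
Proof. by move=> vz wc l; have := vz l; have := wc l; lia. Qed.

(** Walk from c to c' inside the hyperplane, one coordinate step at a time. *)
Lemma hyperplane_connected z j a c c' : valid z -> clean z w j a ->
  window z w c -> window z w c' -> c j = a -> c' j = a -> known c -> known c'.
Proof.
move=> vz cl + wc' + c'a.
have [m] := ubnP (\sum_i ((c i - c' i) + (c' i - c i))).
elim: m c => // m IH c cm wc ca kc.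
have [/forallP cc|/forallPn[i /eqP ci]] := boolP [forall i, c i == c' i].
  by have -> : c' = c by apply/funext => l; apply/esym/eqP.
have ij : i != j by apply: contra_notN ci => /eqP ->; rewrite ca.
have decr c1 : (forall l, l != i -> c1 l = c l) ->
    (c1 i - c' i) + (c' i - c1 i) < (c i - c' i) + (c' i - c i) ->
    \sum_i ((c1 i - c' i) + (c' i - c1 i)) < m.
  move=> c1l c1i; move: cm; rewrite ltnS; apply: leq_trans.
  rewrite (bigD1 i)//= [X in _ < X](bigD1 i)//= -addSn leq_add//.
  by apply: leq_sum => l /c1l ->.
have [ltc|gtc|//] := ltngtP (c i) (c' i).
  have wb : window z w (bump_at i c).
    move=> l; rewrite /bump_at; have := wc l; have := wc' l.
    by case: eqVneq => [->|_]; lia.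
  apply: (IH (bump_at i c)) => //.
  - apply: decr => [l /negbTE li|]; rewrite /bump_at ?li ?eqxx; lia.
  - by rewrite /bump_at eq_sym (negbTE ij) addn0.
  - have fb := window_fits vz wb.
    by have [||kb _] := @known_bump K Kcl i c; [|exact: cl|exact: kb].
pose c1 l := c l - (l == i).
have cE : c = bump_at i c1.
  by apply/funext => l; rewrite /bump_at /c1; case: eqVneq => [->|]; lia.
have wc1 : window z w c1.
  move=> l; rewrite /c1; have := wc l; have := wc' l.
  by case: eqVneq => [->|_]; lia.
have c1j : c1 j = a by rewrite /c1 eq_sym (negbTE ij) subn0.
apply: (IH c1) => //.
  by apply: decr => [l /negbTE li|]; rewrite /c1 ?li ?eqxx; lia.
have fc := window_fits vz wc.
have [||_ kc1] := @known_bump K Kcl i c1; rewrite -?cE//; last by apply: kc1; rewrite -cE.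
by rewrite cE; apply: cl => //; rewrite -cE.
Qed.

Definition hyperplanes_known z := forall j a c,
  clean z w j a -> window z w c -> c j = a -> known c.

Lemma clean_window z j a0 : exists2 a, a0 <= a < a0 + L & clean z w j a.
Proof.
have [a aa cl] := clean_ex z j a0; exists a => //; apply: cleanS cl => c wc l.
by have := wc l; lia.
Qed.

Lemma window_set z c j a : window z w c -> z j <= a <= z j + w -> window z w (set_at j a c).
Proof. by move=> wc ja l; rewrite /set_at; case: eqVneq => [->|_]. Qed.

Lemma set_at_id j a c : set_at j a c j = a.
Proof. by rewrite /set_at eqxx. Qed.

Lemma set_at_neq j a c l : l != j -> set_at j a c l = c l.
Proof. by rewrite /set_at => /negbTE ->. Qed.

(** Clean hyperplanes orthogonal to different directions meet in the window. From
    a given one, knowledge passes to those of all other directions, and through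
    one of these to the clean hyperplanes parallel to the first. *)
Lemma hyperplanes_known_from z j a c : valid z -> clean z w j a -> window z w c ->
  c j = a -> known c -> hyperplanes_known z.
Proof.
move=> vz cl wc ca kc j' a' c' cl' wc' ca'.
have cross k b e : k != j -> clean z w k b -> window z w e -> e k = b -> known e.
  move=> kj clk we eb.
  have waj : window z w (set_at j a e) by apply: window_set => //; rewrite -ca.
  apply: (hyperplane_connected vz clk waj we) => //; first by rewrite set_at_neq.
  by apply: (hyperplane_connected vz cl wc waj) => //; exact: set_at_id.
have [jj|jj] := eqVneq j' j; last exact: cross cl' wc' ca'.
have [k kj] := other_direction j; have [b bz clk] := clean_window z k (z k).
have wb : window z w (set_at k b c') by apply: window_set => //; rewrite /w; lia.
apply: (hyperplane_connected vz cl' wb wc') => //.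
  by rewrite set_at_neq// jj eq_sym.
by apply: (cross k b) => //; exact: set_at_id.
Qed.

(** Induction on the position of the window. In the window at the origin all
    overlaps are unique. A hyperplane that is clean in a window enlarged by one
    is clean in two adjacent windows, and carries the knowledge from the one to
    the other. *)
Lemma all_hyperplanes_known z : valid z -> hyperplanes_known z.
Proof.
have [m] := ubnP (\sum_i z i); elim: m z => // m IH z zm vz.
have [/forallP z0|/forallPn[i zi]] := boolP [forall i, z i == 0].
  have z00 l : z l = 0 by apply/eqP.
  apply: (@hyperplanes_known_from z (Ordinal d2) 0 (fun=> 0)) => //.
  - move=> c i wc _ _ fb; apply: (corners (z := z)) => [l|l|l]; first by left.
      by have := wc l; rewrite /bump_at; case: (l == i); lia.
    by have := fb l; rewrite /oside; lia.
  - by move=> l; rewrite z00.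
pose z' l := z l - (l == i).
have vz' : valid z' by move=> l; have := vz l; rewrite /z'; lia.
have [j ji] := other_direction i.
have [a az cl] := clean_ex z' j (z' j).
have zj : z' j = z j by rewrite /z' (negbTE ji) subn0.
have wz : window z w (set_at j a z).
  by move=> l; rewrite /set_at /w; case: eqVneq => [->|_]; lia.
have wz' : window z' w (set_at j a z).
  move=> l; rewrite /set_at /w /z'; case: (eqVneq l j) => [->|_].
    by rewrite (negbTE ji); lia.
  by case: (l == i); lia.
apply: (@hyperplanes_known_from z j a (set_at j a z)) => //.
- by apply: cleanS cl => c wc l; have := wc l; rewrite /z'; lia.
- exact: set_at_id.
- have IHz : hyperplanes_known z'.
    apply: IH vz'; move: zm; rewrite ltnS; apply: leq_trans.
    rewrite (bigD1 i)//= [X in _ < X](bigD1 i)//= -addSn leq_add//.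
      by rewrite /z' eqxx; lia.
    by apply: leq_sum => l _; rewrite /z'; lia.
  apply: (IHz j a) => //; last exact: set_at_id.
  by apply: cleanS cl => c wc l; have := wc l; lia.
Qed.

(** The slabs of width r at two clean hyperplanes orthogonal to j are known, and
    so is one slab orthogonal to i. The space between the first two is filled
    layer by layer in direction i, starting from the third: a new vertex lies in r
    boxes that differ by steps in direction j, each of which consists of a slice
    of the new layer and of known ones. The overlaps of these boxes with the known
    layers form a run, one member of which is unique. *)
Lemma fill_window z i j b b' : valid z -> i != j ->
  clean z w j b -> clean z w j b' -> z j <= b -> b <= b' -> b' <= z j + w ->
  forall v : Lambda d n, (forall l, l != j -> z l <= tnth v l < z l + w + r) ->
  b <= tnth v j < b' + r -> K v.
Proof.
move=> vz ij clb clb' zb bb' b'z.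
have hk := all_hyperplanes_known vz.
(* a box of the window around a given vertex, with prescribed i and j coordinates *)
pose around (v : Lambda d n) x y : 'I_d -> nat :=
  set_at i x (set_at j y (fun l => minn (tnth v l) (z l + w))).
have aroundW (v : Lambda d n) x y : (forall l, l != j -> z l <= tnth v l < z l + w + r) ->
    z i <= x <= z i + w -> z j <= y <= z j + w -> window z w (around v x y).
  move=> vW xz yz l; rewrite /around /set_at; case: eqVneq => [->//|_].
  by case: eqVneq => [->//|/vW]; lia.
have aroundC (v : Lambda d n) x y : (forall l, l != j -> z l <= tnth v l < z l + w + r) ->
    x <= tnth v i < x + r -> y <= tnth v j < y + r ->
    v \in cell n (around v x y) (fun=> r).
  move=> vW xv yv; apply/cellP => l; rewrite /around /set_at; case: eqVneq => [->//|_].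
  by case: eqVneq => [->//|/vW]; lia.
have slab (v : Lambda d n) (y : nat) : clean z w j y -> z j <= y <= z j + w ->
    (forall l, l != j -> z l <= tnth v l < z l + w + r) -> y <= tnth v j < y + r -> K v.
  move=> cly yz vW yv; pose x := minn (tnth v i) (z i + w).
  have vi := vW i ij; have xz : z i <= x <= z i + w by rewrite /x; lia.
  apply: (hk j y (around v x y) cly); first exact: aroundW.
    by rewrite /around set_at_neq 1?eq_sym// set_at_id.
  by apply: aroundC => //; rewrite /x; lia.
have [a az cla] := clean_window z i (z i).
have start (v : Lambda d n) : (forall l, l != j -> z l <= tnth v l < z l + w + r) ->
    b <= tnth v j < b' + r -> a <= tnth v i < a + r -> K v.
  move=> vW vj va; pose y := minn (tnth v j) (z j + w).
  apply: (hk i a (around v a y) cla); last by apply: aroundC => //; rewrite /y; lia.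
    by apply: aroundW => //; rewrite ?/y /w; lia.
  by rewrite /around set_at_id.
(* one more layer x in direction i, from the r - 1 layers next to it; [up]
   tells on which side of the known slab the new layer lies *)
have layer (up : bool) x (v : Lambda d n) :
    (forall l, l != j -> z l <= tnth v l < z l + w + r) ->
    b <= tnth v j < b' + r -> tnth v i = x :> nat ->
    (if up then z i + r <= x.+1 else x <= z i + w) ->
    (forall v' : Lambda d n, (forall l, l != j -> z l <= tnth v' l < z l + w + r) ->
      b <= tnth v' j < b' + r ->
      (if up then x < tnth v' i + r else x < tnth v' i) ->
      (if up then tnth v' i < x else tnth v' i < x + r) -> K v') -> K v.
  move=> vW vj vi xz IH.
  have [vb|vb] := ltnP (tnth v j) (b + r).
    by apply: (slab v b) => //; lia.
  have [vb'|vb'] := leqP b' (tnth v j).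
    by apply: (slab v b') => //; lia.
  pose x' := if up then x.+1 - r else x.
  pose p0 := around v x' (tnth v j - r.-1).
  pose p := if up then p0 else bump_at i p0.
  have viW := vW i ij.
  have x'z : z i <= x' <= z i + w by rewrite /x'; case: (up) xz => ?; lia.
  have ct t : t < r -> window z w (fun l => p0 l + t * (l == j)).
    move=> tr l; have /(_ l) : window z w (around v x' (tnth v j - r.-1 + t)).
      by apply: aroundW => //; lia.
    rewrite /p0 /around /set_at; case: (eqVneq l i) => [->|_].
      by rewrite (negbTE ij) muln0 addn0.
    by case: (l == j); rewrite ?muln1 ?muln0 ?addn0.
  have pE t l : p l + t * (l == j) = p0 l + t * (l == j) + ~~ up * (l == i).
    by rewrite /p; case: (up); rewrite /= ?mul0n ?addn0// /bump_at; lia.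
  have fct t : t < r -> fits n (fun l => p0 l + t * (l == j)) (fun=> r).
    by move=> tr; exact: window_fits (ct t tr).
  have [|t tr un] := no_run ij (p := p).
    move=> t tr l; rewrite pE; have := fct t tr l; rewrite /oside.
    by case: (l == i); case: (up) => /=; lia.
  have kc : known (fun l => p0 l + t * (l == j)).
    apply: (known_step Kcl (b := ~~ up) _ (fct t tr) un); first exact: pE.
    move=> v' /cellP v'p; have v'pi := v'p i; have v'pj := v'p j.
    move: v'pi v'pj; rewrite !pE /oside !eqxx (negbTE ij) eq_sym (negbTE ij).
    rewrite /p0 /around set_at_id set_at_neq 1?eq_sym// set_at_id.
    rewrite !muln1 !muln0 !addn0 => v'pi v'pj.
    apply: IH.
    - move=> l lj; have := v'p l; rewrite pE /oside (negbTE lj) muln0 addn0.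
      have := ct t tr l; rewrite (negbTE lj) muln0 addn0.
      move: (p0 l) (z l) (nat_of_ord (tnth v' l)) (vz l) => P Z V; clear.
      case: (l == i); case: up => /=; lia.
    - by lia.
    - by move: v'pi xz; rewrite /x'; case: (up) => /=; lia.
    - by move: v'pi xz; rewrite /x'; case: (up) => /=; lia.
  apply: kc; apply/cellP => l.
  have /cellP/(_ l) : v \in cell n (around v x' (tnth v j - r.-1 + t)) (fun=> r).
    apply: aroundC => //; last by lia.
    by rewrite vi /x'; case: (up) xz => ?; lia.
  rewrite /p0 /around /set_at; case: (eqVneq l i) => [->|_].
    by rewrite (negbTE ij) muln0 addn0.
  by case: (l == j); rewrite ?muln1 ?muln0 ?addn0.
have above m (v : Lambda d n) : tnth v i < a + r + m -> a <= tnth v i ->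
    (forall l, l != j -> z l <= tnth v l < z l + w + r) -> b <= tnth v j < b' + r -> K v.
  elim: m v => [|m IH] v vm va vW vj; first by apply: start => //; lia.
  have [vs|vs] := ltnP (tnth v i) (a + r); first by apply: start => //; lia.
  apply: (layer true (tnth v i)) => //=; first by lia.
  by move=> v' v'W v'j v'1 v'2; apply: IH => //; lia.
have below m (v : Lambda d n) : a <= tnth v i + m -> tnth v i < a + r ->
    (forall l, l != j -> z l <= tnth v l < z l + w + r) -> b <= tnth v j < b' + r -> K v.
  elim: m v => [|m IH] v vm va vW vj; first by apply: start => //; lia.
  have [vs|vs] := leqP a (tnth v i); first by apply: start => //; lia.
  apply: (layer false (tnth v i)) => //=; first by rewrite /w; lia.
  by move=> v' v'W v'j v'1 v'2; apply: IH => //; lia.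
move=> v vW vj; have [va|va] := leqP a (tnth v i).
  by apply: (above n) => //; have := ltn_ord (tnth v i); lia.
by apply: (below a) => //; lia.
Qed.

(** A vertex that is far from both faces in some direction j lies between two
    clean hyperplanes orthogonal to j. A vertex near a face in every direction
    lies in a window at a corner, where all overlaps are unique. *)
Lemma known_everywhere v : K v.
Proof.
have [/existsP[j /andP[vj vj']]|/existsPn nj] :=
  boolP [exists j, (L <= tnth v j) && (tnth v j + r + 2 * L <= n)].
  have [i ij] := other_direction j.
  pose z l := if l == j then tnth v j - L else minn (tnth v l) (n - r - w).
  have vz : valid z by move=> l; rewrite /z /w; case: (l == j); lia.
  have zj : z j = tnth v j - L by rewrite /z eqxx.
  have [b bz clb] := clean_window z j (z j).
  have [b' b'z clb'] := clean_window z j (tnth v j).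
  apply: (fill_window vz ij clb clb'); rewrite ?zj /w; try by lia.
  by move=> l lj; rewrite /z (negbTE lj); have := ltn_ord (tnth v l); lia.
pose z l := if tnth v l < L then 0 else n - r - w.
have vz : valid z by move=> l; rewrite /z; case: ifP; lia.
pose c l := minn (tnth v l) (z l + w).
have j := Ordinal d2.
have wc : window z w c.
  move=> l; rewrite /c /z; case: ifP => [|/negbT]; first by lia.
  by rewrite -leqNgt => lv; have := nj l; rewrite lv /= -ltnNge /w; lia.
apply: (all_hyperplanes_known vz (j := j) (a := c j) (c := c)) => //.
- move=> c1 i wc1 _ _ fb; apply: (corners (z := z)).
  + by move=> l; rewrite /z; case: ifP; [left|right].
  + by move=> l; have := wc1 l; rewrite /bump_at; case: (l == i); lia.
  + by move=> l; have := fb l; rewrite /oside; lia.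
- apply/cellP => l; have := ltn_ord (tnth v l); rewrite /c /z.
  by case: ifP => [|/negbT]; rewrite /w; lia.
Qed.

End Windows.

Lemma reconstructible_windows L : 1 < d -> 0 < L -> r + 3 * L <= n ->
  (forall z j a0, exists2 a, a0 <= a < a0 + L & clean z (3 * L).+1 j a) ->
  (forall i j p, i != j ->
    (forall t, t < r -> fits n (fun l => p l + t * (l == j)) (oside r i)) ->
    exists2 t, t < r & uniq_cell s (oside r i) (fun l => p l + t * (l == j))) ->
  (forall z i p, (forall l, z l = 0 \/ z l = n - r - 3 * L) ->
    window z (3 * L).+1 p -> fits n p (oside r i) -> uniq_cell s (oside r i) p) ->
  reconstructible r s.
Proof.
move=> d2 L0 nbig cl nr co; split=> [i|K K0 Kcl].
  apply: (co (fun=> 0)) => [l|l|l]; [by left|by []|].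
  by rewrite /oside; lia.
exact: (known_everywhere d2 L0 nbig cl nr co K0 Kcl).
Qed.

End Growth.

(** * Counting labelings with forced labels *)

Section ForcedLabels.
Local Open Scope nat_scope.

(** Since phi decreases the rank, the labels off X determine those on X by
    induction; the rank rules out circular constraints. *)
Lemma count_forced (V : finType) (q : nat) (X : {set V}) (phi : V -> V) (rank : V -> nat) :
  0 < q -> (forall x, x \in X -> rank (phi x) < rank x) ->
  #|[set s : {ffun V -> 'I_q} | [forall x in X, s x == s (phi x)]]%SET| * q ^ #|X| <= q ^ #|V|.
Proof.
move=> q0 dec; case: q q0 => // {}q _.
set F := [set s : {ffun V -> 'I_q.+1} | _]%SET.
pose f (s : {ffun V -> 'I_q.+1}) : {ffun V -> 'I_q.+1} := [ffun v => if v \in X then ord0 else s v].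
have f_inj : {in F &, injective f}.
  move=> s s'; rewrite !inE => /forall_inP sX /forall_inP s'X /ffunP ff; apply/ffunP => v.
  have [m] := ubnP (rank v); elim: m v => // m IH v vm.
  have := ff v; rewrite !ffunE; case: ifP => // vX _.
  rewrite (eqP (sX v vX)) (eqP (s'X v vX)); apply: IH.
  exact: leq_trans (dec v vX) _.
rewrite -(card_in_imset f_inj).
have sub : f @: F \subset pffun_on ord0 (mem (~: X)) predT.
  apply/fintype.subsetP => g /imsetP[s _ ->]; apply/pffun_onP; split=> // .
  apply/supportP => v; rewrite inE negbK ffunE => vX; by rewrite vX.
rewrite (leq_trans (leq_mul (subset_leq_card sub) (leqnn _)))// card_pffun_on.
by rewrite card_ord -expnD -[#|mem (~: X)|]/#|~: X|%SET addnC cardsC.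
Qed.

End ForcedLabels.

Section Counting.
Local Open Scope nat_scope.
Variables d n q : nat.
Local Notation total := (q ^ (n ^ d)).

Definition count (E : config d n q -> Prop) : nat :=
  #|[set s : config d n q | `[< E s >]]%SET|.

Lemma countS (E F : config d n q -> Prop) : (forall s, E s -> F s) -> count E <= count F.
Proof.
move=> EF; apply/subset_leq_card/fintype.subsetP => s.
by rewrite !inE; exact: EF.
Qed.

Lemma count_total E : count E <= total.
Proof.
by rewrite (leq_trans (max_card _))// card_ffun card_ord card_Lambda.
Qed.

Lemma countU E F : count (fun s => E s \/ F s) <= count E + count F.
Proof.
apply: leq_trans (leq_card_setU _ _); apply/subset_leq_card/fintype.subsetP => s.
by rewrite !inE => -[] h; apply/orP; [left|right]; apply/asboolP.
Qed.

Lemma countC E : count E + count (fun s => ~ E s) = total.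
Proof.
have -> : count (fun s => ~ E s) = #|~: [set s : config d n q | `[< E s >]]%SET|.
  by apply: eq_card => s; rewrite !inE asbool_neg.
by rewrite cardsC card_ffun card_ord card_Lambda.
Qed.

Lemma count_exists (I : finType) (F : I -> config d n q -> Prop) a :
  (forall i, count (F i) * a <= total) ->
  count (fun s => exists i, F i s) * a <= #|I| * total.
Proof.
move=> Fa; apply: (@leq_trans ((\sum_i count (F i)) * a)).
  rewrite leq_mul2r; apply/orP; right.
  have sub : [set s | `[< exists i, F i s >]]%SET \subset
      (\bigcup_(i : I) [set s | `[< F i s >]])%SET.
    apply/fintype.subsetP => s; rewrite !inE => -[i Fi].
    by apply/finset.bigcupP; exists i => //; rewrite !inE.
  apply: leq_trans (subset_leq_card sub) _.
  elim/big_ind2 : _ => // [|x A y B Ax By]; first by rewrite cards0.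
  by rewrite (leq_trans (leq_card_setU _ _))// leq_add.
by rewrite big_distrl/= -sum_nat_const leq_sum.
Qed.

Lemma count_forced_cells (E : config d n q -> Prop) (X : {set Lambda d n})
    (phi : Lambda d n -> Lambda d n) (rank : Lambda d n -> nat) e :
  (forall s, E s -> forall x, x \in X -> s x = s (phi x)) ->
  (forall x, x \in X -> rank (phi x) < rank x) -> e <= #|X| ->
  0 < q -> count E * q ^ e <= total.
Proof.
move=> EX dec eX q0; apply: leq_trans (_ : _ <= q ^ #|{: Lambda d n}|) _; last first.
  by rewrite card_Lambda.
apply: leq_trans (count_forced q0 dec); rewrite leq_mul//.
  apply/subset_leq_card/fintype.subsetP => s; rewrite !inE => Es; have h := EX s Es.
  by apply/forall_inP => x /h ->.
exact: leq_pexp2l.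
Qed.

End Counting.

(** * Repeated overlaps *)

Section Displacements.
Local Open Scope nat_scope.
Variables d n q : nat.
Implicit Types (v : Lambda d n) (p k D : 'I_d -> nat) (s : config d n q).

(** Displacements are shifted by n so as to be natural numbers: D moves the
    coordinate l by D l - n. The default value of insubd is not reached on cells
    that are movable by D. *)
Definition move D v : Lambda d n :=
  [tuple insubd (tnth v i) (tnth v i + D i - n) | i < d].

Definition moved D p : 'I_d -> nat := fun l => p l + D l - n.

Definition movable k D p := forall l, n <= p l + D l /\ p l + D l - n + k l <= n.

Definition backward D : 'I_d -> nat := fun l => 2 * n - D l.

Definition repeats k D p s := forall v, v \in cell n p k -> s v = s (move D v).

Lemma moveE D v l : n <= tnth v l + D l < n + n -> tnth (move D v) l = tnth v l + D l - n :> nat.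
Proof. by move=> vD; rewrite tnth_mktuple val_insubd ifT//; lia. Qed.

Lemma move_cell k D p v l : movable k D p -> v \in cell n p k ->
  tnth (move D v) l = tnth v l + D l - n :> nat.
Proof.
by move=> mv /cellP/(_ l) vl; have [h1 h2] := mv l; apply: moveE; lia.
Qed.

Lemma backwardP k D p v : fits n p k -> movable k D p -> v \in cell n (moved D p) k ->
  [/\ move (backward D) v \in cell n p k, move D (move (backward D) v) = v &
      forall l, tnth (move (backward D) v) l + D l = tnth v l + n].
Proof.
move=> fp mv vp.
have bE l : tnth (move (backward D) v) l + D l = tnth v l + n.
  have /cellP/(_ l) := vp; have [] := mv l; have := fp l; rewrite /moved => h1 h2 h3 h4.
  by rewrite moveE /backward; have := ltn_ord (tnth v l); lia.
have bp : move (backward D) v \in cell n p k.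
  apply/cellP => l; have /cellP/(_ l) := vp; have := bE l; have [] := mv l.
  by rewrite /moved; lia.
split=> //; apply: Lambda_eq => l; rewrite (move_cell l mv bp) bE; lia.
Qed.

Lemma Lambda_corner p : (forall l, p l < n) -> exists c : Lambda d n, corner c = p.
Proof.
by move=> pn; have [c cE] := Lambda_ex pn; exists c; apply/funext => l; rewrite /corner cE.
Qed.

Lemma not_uniq_cell s k p : (forall l, 0 < k l) -> fits n p k -> ~ uniq_cell s k p ->
  exists D, [/\ forall l, D l < 2 * n, movable k D p, repeats k D p s & exists l, D l <> n].
Proof.
move=> k0 fp /existsNP[p' /not_implyP[fp' /not_implyP[sp' np']]].
pose D l := p' l + n - p l.
have mv : movable k D p by move=> l; have := fp l; have := fp' l; rewrite /D; lia.
exists D; split=> //.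
- by move=> l; rewrite /D; have := fp' l; have := k0 l; lia.
- move=> v vp; apply: (sp' v _ vp) => l; rewrite (move_cell l mv vp) /D.
  by have := fp l; have /cellP/(_ l) := vp; lia.
- move/existsNP: np' => [l pl]; exists l; rewrite /D; have := fp l; lia.
Qed.

Lemma count_if (C : Prop) (E : config d n q -> Prop) a : (C -> count E * a <= q ^ (n ^ d)) ->
  count (fun s => C /\ E s) * a <= q ^ (n ^ d).
Proof.
move=> CE; have [c|nc] := pselect C.
  by apply: leq_trans (CE c); rewrite leq_mul2r countS ?orbT// => s [].
suff -> : count (fun s => C /\ E s) = 0 by rewrite mul0n.
by apply: eq_card0 => s; rewrite inE; apply/asboolP => -[].
Qed.

(** A cell may overlap its translate, but a nonzero displacement moves some
    coordinate always in the same sense, which gives a rank. *)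
Lemma count_repeats k D p : 0 < q -> fits n p k -> movable k D p -> (exists l, D l <> n) ->
  count (repeats k D p) * q ^ (\prod_l k l) <= q ^ (n ^ d).
Proof.
move=> q0 fp mv [l Dl].
pose rank v : nat := if D l < n then (tnth v l : nat) else n - tnth v l.
apply: (count_forced_cells (X := cell n p k) (phi := move D) (rank := rank)) => //.
- move=> v vp; rewrite /rank (move_cell l mv vp).
  have := ltn_ord (tnth v l); have /cellP/(_ l) := vp; have [] := mv l.
  by case: (ltnP (D l) n); lia.
- by rewrite card_cell.
Qed.

End Displacements.

Lemma card_disjoint_bigcup (I V : finType) (F : I -> {set V}) :
  (forall i j x, i != j -> x \in F i -> x \notin F j) ->
  #|(\bigcup_i F i)%SET| = (\sum_i #|F i|)%N.
Proof.
move=> dis; rewrite -sum1_card partition_disjoint_bigcup /=; last first.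
  move=> i j ij; rewrite disjoint_subset; apply/fintype.subsetP => x; exact: dis.
by apply: eq_bigr => i _; rewrite sum1_card.
Qed.

Section OverlapSides.
Local Open Scope nat_scope.
Variables d r : nat.
Implicit Types i l : 'I_d.

Lemma oside_gt0 i l : 1 < r -> 0 < oside r i l.
Proof. by rewrite /oside; case: (l == i); lia. Qed.

Lemma prod_oside i : \prod_l oside r i l = (r - 1) * r ^ d.-1.
Proof.
rewrite (bigD1 i)//= {1}/oside eqxx; congr (_ * _).
rewrite (eq_bigr (fun=> r)) => [|l /negbTE li]; last by rewrite /oside li subn0.
by rewrite prod_nat_const cardC1 card_ord.
Qed.

Lemma fits_lt n i p l : 1 < r -> fits n p (oside r i) -> p l < n.
Proof. by move=> r1 /(_ l); have := oside_gt0 i l r1; lia. Qed.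

End OverlapSides.

Section BadEvents.
Local Open Scope nat_scope.
Variables d n q r : nat.
Hypothesis q0 : 0 < q.
Hypothesis r1 : 1 < r.
Implicit Types (v : Lambda d n) (p k D : 'I_d -> nat) (s : config d n q).
Local Notation total := (q ^ (n ^ d)).
Local Notation Disp := {ffun 'I_d -> 'I_(2 * n)}.
Local Notation rho := ((r - 1) * r ^ d.-1).

Definition disp (m : nat) (D : {ffun 'I_d -> 'I_m}) : 'I_d -> nat := fun l => D l.

Lemma disp_ex m D : (forall l, D l < m) -> exists D' : {ffun 'I_d -> 'I_m}, disp D' = D.
Proof.
move=> Dm; exists [ffun l => Ordinal (Dm l)].
by apply/funext => l; rewrite /disp ffunE.
Qed.

Lemma card_disp m : #|{: {ffun 'I_d -> 'I_m}}| = m ^ d.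
Proof. by rewrite card_ffun !card_ord. Qed.

Definition some_repeat s := exists i p D, [/\ fits n p (oside r i),
  forall l, D l < 2 * n, movable n (oside r i) D p, exists l, D l <> n &
  repeats (oside r i) D p s].

Lemma count_some_repeat :
  count some_repeat * q ^ rho <= d * n ^ d * (2 * n) ^ d * total.
Proof.
pose I := ('I_d * Lambda d n * Disp)%type.
pose C (x : I) := [/\ fits n (corner x.1.2) (oside r x.1.1),
  movable n (oside r x.1.1) (disp x.2) (corner x.1.2) & exists l, disp x.2 l <> n].
pose F (x : I) s := C x /\ repeats (oside r x.1.1) (disp x.2) (corner x.1.2) s.
have := @count_exists d n q I F (q ^ rho) _.
rewrite !card_prod card_ord card_Lambda card_disp => cF.
apply: leq_trans (cF _) => [|x]; last first.
  apply: count_if => -[fp mv Dl]; rewrite -(prod_oside r x.1.1); exact: count_repeats.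
rewrite leq_mul2r; apply/orP; right; apply: countS => s [i [p [D [fp Dn mv Dl rep]]]].
have [c cE] := Lambda_corner (fun l => fits_lt l r1 fp).
have [D' D'E] := disp_ex Dn.
by exists (i, c, D'); rewrite /F /C /= cE D'E.
Qed.

Definition near_repeat t s := exists i p D, [/\ fits n p (oside r i),
  forall l, D l <= n + t /\ n <= D l + t, movable n (oside r i) D p, exists l, D l <> n &
  repeats (oside r i) D p s].

Lemma count_near_repeat t :
  count (near_repeat t) * q ^ rho <= d * n ^ d * (2 * t).+1 ^ d * total.
Proof.
pose I := ('I_d * Lambda d n * {ffun 'I_d -> 'I_(2 * t).+1})%type.
pose Dx (x : I) : 'I_d -> nat := fun l => n + disp x.2 l - t.
pose C (x : I) := [/\ fits n (corner x.1.2) (oside r x.1.1),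
  movable n (oside r x.1.1) (Dx x) (corner x.1.2) & exists l, Dx x l <> n].
pose F (x : I) s := C x /\ repeats (oside r x.1.1) (Dx x) (corner x.1.2) s.
have := @count_exists d n q I F (q ^ rho) _.
rewrite !card_prod card_ord card_Lambda card_disp => cF.
apply: leq_trans (cF _) => [|x]; last first.
  apply: count_if => -[fp mv Dl]; rewrite -(prod_oside r x.1.1); exact: count_repeats.
rewrite leq_mul2r; apply/orP; right; apply: countS => s [i [p [D [fp Dn mv Dl rep]]]].
have [c cE] := Lambda_corner (fun l => fits_lt l r1 fp).
have [|D' D'E] := @disp_ex (2 * t).+1 (fun l => D l + t - n).
  by move=> l; have := Dn l; lia.
exists (i, c, D'); have DE : Dx (i, c, D') = D.
  by apply/funext => l; rewrite /Dx /= D'E; have := Dn l; lia.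
by rewrite /F /C DE /= cE.
Qed.

Definition corner_repeat w s := exists (z : 'I_d -> nat) i p D,
  ((forall l, z l = 0 \/ z l = n - r - w) /\ window z w.+1 p) /\
  [/\ fits n p (oside r i), forall l, D l < 2 * n,
      movable n (oside r i) D p, exists l, D l <> n & repeats (oside r i) D p s].

Lemma count_corner_repeat w :
  count (corner_repeat w) * q ^ rho <= 2 ^ d * w.+2 ^ d * d * (2 * n) ^ d * total.
Proof.
pose I := ({ffun 'I_d -> 'I_2} * {ffun 'I_d -> 'I_w.+2} * 'I_d * Disp)%type.
pose px (x : I) : 'I_d -> nat := fun l =>
  (if disp x.1.1.1 l == 0 then 0 else n - r - w) + disp x.1.1.2 l.
pose C (x : I) := [/\ fits n (px x) (oside r x.1.2),
  movable n (oside r x.1.2) (disp x.2) (px x) & exists l, disp x.2 l <> n].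
pose F (x : I) s := C x /\ repeats (oside r x.1.2) (disp x.2) (px x) s.
have := @count_exists d n q I F (q ^ rho) _.
rewrite !card_prod !card_disp card_ord => cF.
apply: leq_trans (cF _) => [|x]; last first.
  apply: count_if => -[fp mv Dl]; rewrite -(prod_oside r x.1.2); exact: count_repeats.
rewrite leq_mul2r; apply/orP; right; apply: countS.
move=> s [z [i [p [D [[zE wp] [fp Dn mv Dl rep]]]]]].
have [D' D'E] := disp_ex Dn.
have [|o oE] := @disp_ex w.+2 (fun l => p l - z l); first by move=> l; have := wp l; lia.
have [|b bE] := @disp_ex 2 (fun l => z l != 0); first by move=> l; case: (z l != 0).
exists (b, o, i, D'); have pE : px (b, o, i, D') = p.
  apply/funext => l; rewrite /px /= bE oE; have := wp l.
  by case: (zE l) => ->; case: eqP; lia.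
by rewrite /F /C pE /= D'E.
Qed.

(** S disjoint overlaps in a common window that are all copied from outside their
    union: together they force S times as many labels as one overlap, while the
    choice of the window costs a power of n that does not depend on S. *)
Definition separated_repeats S m s := exists (z : 'I_d -> nat) (i : 'I_S -> 'I_d)
    (p D : 'I_S -> 'I_d -> nat),
  [/\ forall a, window z m (p a) /\ fits n (p a) (oside r (i a)),
      forall a, (forall l, D a l < 2 * n) /\ movable n (oside r (i a)) (D a) (p a),
      forall a b v, a != b -> v \in cell n (p a) (oside r (i a)) ->
        v \notin cell n (p b) (oside r (i b)),
      forall a b v, v \in cell n (p a) (oside r (i a)) ->
        move (D a) v \notin cell n (p b) (oside r (i b)) &
      forall a, repeats (oside r (i a)) (D a) (p a) s].

Lemma count_separated S m : 0 < S ->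
  count (separated_repeats S m) * q ^ (S * rho) <=
    n ^ d * (m.+1 ^ d * d * (2 * n) ^ d) ^ S * total.
Proof.
move=> S0.
pose J := ({ffun 'I_d -> 'I_m.+1} * 'I_d * Disp)%type.
pose I := (Lambda d n * {ffun 'I_S -> J})%type.
pose px (x : I) a : 'I_d -> nat := fun l => corner x.1 l + disp (x.2 a).1.1 l.
pose ix (x : I) a := (x.2 a).1.2.
pose Dx (x : I) a := disp (x.2 a).2.
pose X x a := cell n (px x a) (oside r (ix x a)).
pose C (x : I) := [/\ forall a, fits n (px x a) (oside r (ix x a)),
      forall a, movable n (oside r (ix x a)) (Dx x a) (px x a),
      forall a b v, a != b -> v \in X x a -> v \notin X x b &
      forall a b v, v \in X x a -> move (Dx x a) v \notin X x b].
pose F (x : I) s := C x /\ forall a, repeats (oside r (ix x a)) (Dx x a) (px x a) s.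
have := @count_exists d n q I F (q ^ (S * rho)) _.
rewrite card_prod card_Lambda card_ffun !card_prod !card_disp !card_ord => cF.
apply: leq_trans (cF _) => [|x]; last first.
  apply: count_if => -[fp mv dis far].
  pose phi v := if [pick a | v \in X x a] is Some a then move (Dx x a) v else v.
  have phiP v : v \in (\bigcup_a X x a)%SET -> exists2 a, v \in X x a & phi v = move (Dx x a) v.
    move=> /finset.bigcupP[a _ va]; rewrite /phi; case: pickP => [b vb|/(_ a)]; first by exists b.
    by rewrite va.
  apply: (count_forced_cells (X := (\bigcup_a X x a)%SET) (phi := phi)
    (rank := fun v => nat_of_bool (v \in (\bigcup_a X x a)%SET))) => //.
  - by move=> s sx v /phiP[a va ->]; exact: sx.
  - move=> v vX; rewrite vX; have [a va ->] := phiP v vX.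
    by case: finset.bigcupP => // -[b _]; rewrite (negbTE (far a b v va)).
  - rewrite card_disjoint_bigcup//.
    rewrite (eq_bigr (fun=> rho)) ?sum_nat_const ?card_ord// => a _.
    by rewrite card_cell// prod_oside.
rewrite leq_mul2r; apply/orP; right; apply: countS.
move=> s [z [i [p [D [wf mv dis far rep]]]]].
have [|c cE] := @Lambda_corner d n z.
  move=> l; have [wp fp] := wf (Ordinal S0).
  by have := fits_lt l r1 fp; have := wp l; lia.
have [|off offE] := @choice 'I_S {ffun 'I_d -> 'I_m.+1}
    (fun a o => disp o = (fun l => p a l - z l)).
  by move=> a; apply: disp_ex => l; have [wp _] := wf a; have := wp l; lia.
have [|D' D'E] := @choice 'I_S Disp (fun a o => disp o = D a).
  by move=> a; apply: disp_ex; have [] := mv a.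
exists (c, [ffun a => (off a, i a, D' a)]).
set x := (_, _).
have ixE a : ix x a = i a by rewrite /ix /x /= ffunE.
have DxE a : Dx x a = D a by rewrite /Dx /x /= ffunE D'E.
have pxE a : px x a = p a.
  apply/funext => l; rewrite /px /x /= ffunE cE offE subnKC//.
  by have [wp _] := wf a; have /andP[] := wp l.
have XE a : X x a = cell n (p a) (oside r (i a)) by rewrite /X ixE pxE.
split; [split|] => [a|a|a b v|a b v|a]; rewrite ?XE ?ixE ?DxE ?pxE //.
- by have [] := wf a.
- by have [] := mv a.
- exact: dis.
- exact: far.
Qed.

End BadEvents.

(** * Pairs and runs of repeated overlaps *)

Section PairEvent.
Local Open Scope nat_scope.
Variables d n q r : nat.
Hypothesis q0 : 0 < q.
Hypothesis r1 : 1 < r.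
Implicit Types (v : Lambda d n) (p k D : 'I_d -> nat) (s : config d n q).
Local Notation total := (q ^ (n ^ d)).
Local Notation Disp := {ffun 'I_d -> 'I_(2 * n)}.
Local Notation rho := ((r - 1) * r ^ d.-1).

(** Overlaps at p and p' with different displacements. Their translates may meet
    each other, and the first translate may meet the second overlap. *)
Definition pair_cond (i l0 : 'I_d) p p' D D' :=
  [/\ fits n p (oside r i) /\ fits n p' (oside r i),
      movable n (oside r i) D p /\ movable n (oside r i) D' p',
      D l0 < D' l0,
      forall v, v \in cell n p (oside r i) -> move D v \notin cell n p (oside r i) &
      forall v, v \in cell n p' (oside r i) ->
        move D' v \notin cell n p (oside r i) /\ move D' v \notin cell n p' (oside r i)].

Definition pair_repeat s := exists i l0 p p' D D', pair_cond i l0 p p' D D' /\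
  [/\ forall l, D l < 2 * n,
      forall l, D l < D' l + 2 * r /\ D' l < D l + 2 * r,
      forall l, p l < p' l + r /\ p' l < p l + r,
      repeats (oside r i) D p s & repeats (oside r i) D' p' s].

(** The labels of the cell A at p are read off its translate by D, and those of
    the translate B of the cell at p' are read off this cell. A step from A into B
    followed by the step back by D' lowers the coordinate l0, since D is smaller
    than D' there. So both cells are forced without a circle, even if they
    interfere. *)
Lemma count_pair_cond i l0 p p' D D' : pair_cond i l0 p p' D D' ->
  count (fun s => repeats (oside r i) D p s /\ repeats (oside r i) D' p' s) *
    q ^ (2 * rho) <= total.
Proof.
move=> [[fp fp'] [mv mv'] lt far far'].
set k := oside r i; pose A := cell n p k; pose B := cell n (moved n D' p') k.
have fB : fits n (moved n D' p') k by move=> l; have [] := mv' l; rewrite /moved.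
have back v : v \in B -> [/\ move (backward n D') v \in cell n p' k,
    move D' (move (backward n D') v) = v &
    forall l, tnth (move (backward n D') v) l + D' l = tnth v l + n].
  by move=> vB; apply: backwardP.
have AB v : v \in A -> v \notin B.
  move=> vA; apply/negP => vB; have [v'p v'E _] := back v vB.
  by have [] := far' _ v'p; rewrite v'E -/k -/A vA.
have p'B v : v \in cell n p' k -> v \notin B.
  move=> vp'; apply/negP => vB; have [v'p v'E _] := back v vB.
  by have [_] := far' _ v'p; rewrite v'E -/k vp'.
pose phi v := if v \in A then move D v else move (backward n D') v.
(* a vertex of B ranks just above the vertex of the cell at p' from which it is
   copied, in case this one lies in A *)
pose rank v := if v \in A then (2 * tnth v l0).+1 else
  if v \in B then 2 * (tnth v l0 + n - D' l0) + 2 else 0.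
apply: (count_forced_cells (X := (A :|: B)%SET) (phi := phi) (rank := rank)) => //.
- move=> s [rep rep'] v; rewrite inE /phi; case: ifP => [vA _|_ /= vB]; first exact: rep.
  by have [v'p v'E _] := back v vB; rewrite -{1}v'E (rep' _ v'p) v'E.
- move=> v; rewrite inE /phi; case: ifP => [vA _|vA /= vB].
    rewrite /rank vA (negbTE (far v vA)); case: ifP => // mB.
    have [_ _ /(_ l0)] := back _ mB; rewrite (move_cell l0 mv vA).
    by have := mv l0; have := mv' l0; have /cellP/(_ l0) := vA; lia.
  have [v'p v'E v'l] := back v vB; rewrite /rank vA vB (negbTE (p'B _ v'p)).
  have := v'l l0; case: ifP => _; lia.
- rewrite cardsU disjoint_setI0; last first.
    by rewrite disjoint_subset; apply/fintype.subsetP => v /AB.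
  by rewrite cards0 subn0 !card_cell// !prod_oside mul2n addnn.
Qed.

Lemma count_pair_repeat : count pair_repeat * q ^ (2 * rho) <=
  d * d * n ^ d * (2 * r) ^ d * (2 * n) ^ d * (4 * r) ^ d * total.
Proof.
pose I := ('I_d * 'I_d * Lambda d n * {ffun 'I_d -> 'I_(2 * r)} * Disp *
  {ffun 'I_d -> 'I_(4 * r)})%type.
pose ix (x : I) := x.1.1.1.1.1; pose lx (x : I) := x.1.1.1.1.2.
pose px (x : I) := corner x.1.1.1.2.
pose px' (x : I) : 'I_d -> nat := fun l => px x l + disp x.1.1.2 l - r.
pose Dx (x : I) := disp x.1.2.
pose Dx' (x : I) : 'I_d -> nat := fun l => Dx x l + disp x.2 l - 2 * r.
pose F (x : I) s := pair_cond (ix x) (lx x) (px x) (px' x) (Dx x) (Dx' x) /\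
  (repeats (oside r (ix x)) (Dx x) (px x) s /\ repeats (oside r (ix x)) (Dx' x) (px' x) s).
have := @count_exists d n q I F (q ^ (2 * rho)) _.
rewrite !card_prod !card_disp card_Lambda !card_ord => cF.
apply: leq_trans (cF _) => [|x]; last by apply: count_if => /count_pair_cond.
rewrite leq_mul2r; apply/orP; right; apply: countS.
move=> s [i [l0 [p [p' [D [D' [cond [Dn DD' pp' rep rep']]]]]]]].
have [[fp _] _ _ _ _] := cond.
have [c cE] := Lambda_corner (fun l => fits_lt l r1 fp).
have [E EE] := disp_ex Dn.
have [|e eE] := @disp_ex d (4 * r) (fun l => D' l + 2 * r - D l).
  by move=> l; have := DD' l; lia.
have [|g gE] := @disp_ex d (2 * r) (fun l => p' l + r - p l).
  by move=> l; have := pp' l; lia.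
exists (i, l0, c, g, E, e); set x := (i, l0, c, g, E, e).
have pE : px x = p by rewrite /px /x /= cE.
have DE : Dx x = D by rewrite /Dx /x /= EE.
have p'E : px' x = p'.
  by apply/funext => l; rewrite /px' pE /x /= gE; have := pp' l; lia.
have D'E : Dx' x = D'.
  by apply/funext => l; rewrite /Dx' DE /x /= eE; have := DD' l; lia.
by rewrite /F pE DE p'E D'E.
Qed.

End PairEvent.

Section RunEvent.
Local Open Scope nat_scope.
Variables d n q r : nat.
Hypothesis q0 : 0 < q.
Hypothesis r1 : 1 < r.
Implicit Types (v : Lambda d n) (p k D : 'I_d -> nat) (s : config d n q).
Local Notation total := (q ^ (n ^ d)).
Local Notation Disp := {ffun 'I_d -> 'I_(2 * n)}.

Definition run_at p (j : 'I_d) (t : nat) : 'I_d -> nat := fun l => p l + t * (l == j).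

(** The overlaps along a run in direction j, grouped by the map f into m classes
    with a common displacement each. The translates of different classes are
    disjoint, and none of them meets the run. *)
Definition run_cond m p (i j : 'I_d) (f : 'I_r -> 'I_m) (E : 'I_m -> 'I_d -> nat) :=
  [/\ i != j /\ forall t : 'I_r, fits n (run_at p j t) (oside r i),
      forall t : 'I_r, movable n (oside r i) (E (f t)) (run_at p j t),
      forall c, exists t, f t = c,
      forall (t t' : 'I_r) v, v \in cell n (run_at p j t) (oside r i) ->
        move (E (f t)) v \notin cell n (run_at p j t') (oside r i) &
      forall (t t' : 'I_r) v v', f t != f t' -> v \in cell n (run_at p j t) (oside r i) ->
        v' \in cell n (run_at p j t') (oside r i) -> move (E (f t)) v != move (E (f t')) v'].

Definition run_repeats m s := exists p i j (f : 'I_r -> 'I_m) (E : 'I_m -> 'I_d -> nat),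
  [/\ run_cond p i j f E, forall c l, E c l < 2 * n &
      forall t : 'I_r, repeats (oside r i) (E (f t)) (run_at p j t) s].

(** The number of vertices in r - 1 slices of an overlap that are orthogonal to
    the direction of a run. *)
Definition run_exponent := (r - 1) * ((r - 1) * r ^ d.-2).

(** The translates of the members of the run are read off the run. A class of k
    members covers at least k + r - 1 slices orthogonal to the run. Summed over
    the m classes this is at least r + m (r - 1) slices: one factor more than the
    number of displacements that have to be chosen. *)
Lemma count_run_cond m p i j (f : 'I_r -> 'I_m) (E : 'I_m -> 'I_d -> nat) :
  run_cond p i j f E ->
  count (fun s => forall t : 'I_r, repeats (oside r i) (E (f t)) (run_at p j t) s) *
    q ^ (run_exponent * m.+1) <= total.
Proof.
move=> [[ij fp] mv surj far dis].
(* of each class of translates, the last one contributes its whole cell and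
   the others a slice orthogonal to the run, so that the pieces are disjoint *)
pose mx (t : 'I_r) := [forall t' : 'I_r, (f t' == f t) ==> (t' <= t)].
pose piece (t : 'I_r) : 'I_d -> nat := fun l => if (l == j) && ~~ mx t then 1 else oside r i l.
pose Z (t : 'I_r) := cell n (moved n (E (f t)) (run_at p j t)) (piece t).
have ji : (j == i) = false by rewrite eq_sym (negbTE ij).
have pieceS t l : piece t l <= oside r i l.
  by rewrite /piece; case: ifP => // /andP[/eqP -> _]; rewrite /oside ji; lia.
have ZS t v : v \in Z t -> v \in cell n (moved n (E (f t)) (run_at p j t)) (oside r i).
  by move=> /cellP vZ; apply/cellP => l; have := vZ l; have := pieceS t l; lia.
have back t v : v \in Z t -> [/\ move (backward n (E (f t))) v \in cell n (run_at p j t) (oside r i),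
    move (E (f t)) (move (backward n (E (f t))) v) = v &
    forall l, tnth (move (backward n (E (f t))) v) l + E (f t) l = tnth v l + n].
  by move=> /ZS vZ; apply: backwardP.
pose phi v := if [pick t | v \in Z t] is Some t then move (backward n (E (f t))) v else v.
have phiP v : v \in (\bigcup_t Z t)%SET ->
    exists2 t, v \in Z t & phi v = move (backward n (E (f t))) v.
  move=> /finset.bigcupP[t _ vt]; rewrite /phi; case: pickP => [t' vt'|/(_ t)]; first by exists t'.
  by rewrite vt.
apply: (count_forced_cells (X := (\bigcup_t Z t)%SET) (phi := phi)
  (rank := fun v => nat_of_bool (v \in (\bigcup_t Z t)%SET))) => //.
- move=> s rep v /phiP[t vt ->]; have [v'p v'E _] := back t v vt.
  by rewrite -{1}v'E -(rep t _ v'p).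
- move=> v vX; rewrite vX; have [t vt ->] := phiP v vX; have [v'p v'E _] := back t v vt.
  case: finset.bigcupP => // -[t' _ vt']; have [v''p v''E _] := back t' _ vt'.
  by have := far t' t _ v''p; rewrite v''E v'p.
have Zdis (t t' : 'I_r) v : f t = f t' -> t < t' -> v \in Z t -> v \notin Z t'.
  move=> ff tt' /cellP/(_ j) vt; apply/negP => /cellP/(_ j).
  have mxt : mx t = false.
    by apply/negbTE/forallPn; exists t'; rewrite ff eqxx /= -ltnNge.
  have [h1 h2] := mv t j; have [h3 h4] := mv t' j.
  move: vt h1 h2 h3 h4; rewrite /moved /piece eqxx mxt /= /run_at eqxx ff !muln1.
  by lia.
rewrite card_disjoint_bigcup; last first.
  move=> t t' v tt' vt; have [ff|ff] := eqVneq (f t) (f t'); last first.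
    apply/negP => vt'; have [v1 e1 _] := back t v vt; have [v2 e2 _] := back t' v vt'.
    by have /eqP := dis t t' _ _ ff v1 v2; rewrite e1 e2.
  have [lt|lt|/val_inj e] := ltngtP t t'; first exact: Zdis vt.
    by apply/negP => vt'; have := Zdis t' t v (esym ff) lt vt'; rewrite vt.
  by rewrite e eqxx in tt'.
pose kap := (r - 1) * r ^ d.-2.
have kapE : \prod_(l | l != j) oside r i l = kap.
  have dj : #|[pred l : 'I_d | (l != j) && (l != i)]| = d.-2.
    have -> : d.-2 = #|predC1 j|.-1 by rewrite cardC1 card_ord.
    rewrite (cardD1 i (predC1 j)) inE ij add1n /=.
    by apply: eq_card => l; rewrite !inE andbC.
  rewrite (bigD1 i)//= {1}/oside eqxx; congr (_ * _).
  rewrite (eq_bigr (fun=> r)) => [|l /andP[_ /negbTE li]]; last by rewrite /oside li subn0.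
  by rewrite prod_nat_const dj.
have cardZ t : #|Z t| = (if mx t then r else 1) * kap.
  rewrite card_cell => [|l]; last first.
    by have [] := mv t l; have := pieceS t l; rewrite /moved; lia.
  rewrite (bigD1 j)//= {1}/piece eqxx /= {1}/oside ji subn0 -kapE.
  congr (_ * _); first by case: (mx t).
  by apply: eq_bigr => l /negbTE lj; rewrite /piece lj.
rewrite (eq_bigr _ (fun t _ => cardZ t)) -big_distrl /=.
have msum : m <= #|[set t | mx t]%SET|.
  have im : (f @: [set t | mx t])%SET = [set: 'I_m]%SET.
    apply/setP => c; rewrite inE; apply/imsetP.
    have [t0 t0c] := surj c.
    have [t tc tmax] := @arg_maxnP _ t0 (fun t => f t == c) (fun t => t : nat) (introT eqP t0c).
    exists t; last by rewrite (eqP tc).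
    by rewrite inE; apply/forallP => t'; apply/implyP => /eqP e; apply: tmax; rewrite e.
  by rewrite -[X in X <= _]card_ord -cardsT -im leq_imset_card.
have -> : \sum_(t < r) (if mx t then r else 1) = r + (r - 1) * #|[set t | mx t]%SET|.
  rewrite (eq_bigr (fun t => 1 + (r - 1) * mx t)) => [|t _].
    rewrite big_split /= sum_nat_const card_ord muln1 -big_distrr /=; congr (_ + _ * _).
    by rewrite -sum1dep_card [RHS]big_mkcond /=; apply: eq_bigr => t _; case: (mx t).
  by case: (mx t) => /=; lia.
rewrite /run_exponent -/kap -mulnA [kap * _]mulnC mulnA leq_mul2r; apply/orP; right.
by move: msum; move: #|_| => M; nia.
Qed.

Lemma count_run_repeats m : count (run_repeats m) * q ^ (run_exponent * m.+1) <=
  n ^ d * d * d * m ^ r * ((2 * n) ^ d) ^ m * total.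
Proof.
pose I := (Lambda d n * 'I_d * 'I_d * {ffun 'I_r -> 'I_m} * {ffun 'I_m -> Disp})%type.
pose px (x : I) := corner x.1.1.1.1; pose ix (x : I) := x.1.1.1.2; pose jx (x : I) := x.1.1.2.
pose fx (x : I) : 'I_r -> 'I_m := fun t => x.1.2 t.
pose Ex (x : I) c := disp (x.2 c).
pose F (x : I) s := run_cond (px x) (ix x) (jx x) (fx x) (Ex x) /\
  forall t : 'I_r, repeats (oside r (ix x)) (Ex x (fx x t)) (run_at (px x) (jx x) t) s.
have := @count_exists d n q I F (q ^ (run_exponent * m.+1)) _.
rewrite !card_prod !card_ffun card_Lambda !card_ord => cF.
apply: leq_trans (cF _) => [|x]; last by apply: count_if => /count_run_cond.
rewrite leq_mul2r; apply/orP; right; apply: countS.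
move=> s [p [i [j [f [E [cond En rep]]]]]].
have [[_ fp] _ _ _ _] := cond.
have [|c cE] := @Lambda_corner d n p.
  move=> l; have t0 : 0 < r by lia.
  by have := fits_lt l r1 (fp (Ordinal t0)); rewrite /run_at /= mul0n addn0.
have [|D' D'E] := @choice 'I_m Disp (fun a o => disp o = E a).
  by move=> a; apply: disp_ex.
exists (c, i, j, [ffun t => f t], [ffun a => D' a]); set x := (c, i, j, _, _).
have fE : fx x = f by apply/funext => t; rewrite /fx /x /= ffunE.
have EE : Ex x = E by apply/funext => a; rewrite /Ex /x /= ffunE D'E.
by rewrite /F fE EE /px /ix /jx /x /= cE.
Qed.

End RunEvent.

(** * Labelings without rare events are reconstructible *)

Section BadCover.
Local Open Scope nat_scope.
Variables d n q r S : nat.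
Hypothesis r1 : 1 < r.
Hypothesis d2 : 1 < d.
Hypothesis S0 : 0 < S.
Let w := 3 * (S * r).
Let tau := w + 2 * r + 2.
Hypothesis nbig : r + w <= n.
Variable s : config d n q.

Lemma not_uniq_repeat (i : 'I_d) p : fits n p (oside r i) -> ~ uniq_cell s (oside r i) p ->
  exists D, [/\ forall l, D l < 2 * n, movable n (oside r i) D p,
    repeats (oside r i) D p s & exists l, D l <> n].
Proof. by move=> fp; apply: not_uniq_cell => // l; exact: oside_gt0. Qed.

(** If none of S r consecutive hyperplanes were clean, every r-th of them would
    contain a repeated overlap, and these S overlaps are disjoint. In a run of
    repeated overlaps, any two displacements are equal or far apart since close
    ones make a pair of repeats; so the run decomposes into classes. *)
Lemma reconstructible_avoid :
  ~ near_repeat r tau s -> ~ corner_repeat r w s -> ~ separated_repeats r S w.+2 s ->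
  ~ pair_repeat r s -> (forall m, m <= r -> ~ run_repeats r m.+1 s) ->
  reconstructible r s.
Proof.
move=> nnear ncorner nsep npair nrun.
have far i p D l0 m : fits n p (oside r i) -> movable n (oside r i) D p ->
    repeats (oside r i) D p s -> D l0 <> n -> m <= tau ->
    exists l, D l > n + m \/ n > D l + m.
  move=> fp mv rep Dl0 mt; apply: contrapT => nl; apply: nnear.
  exists i, p, D; split=> //; last by exists l0.
  by move=> l; have /not_orP[h1 h2] := (forallNP _).2 nl l; lia.
have r0 : 0 < r by lia.
apply: (reconstructible_windows r0 (L := S * r)) => //.
- by rewrite muln_gt0 S0.
- move=> z j a0; apply: contrapT => nex; apply: nsep.
  have bad (k : 'I_S) : exists x : ('I_d -> nat) * 'I_d * ('I_d -> nat),
      [/\ window z w.+1 x.1.1 /\ x.1.1 j = a0 + k * r, x.1.2 != j,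
        fits n (bump_at x.1.2 x.1.1) (oside r x.1.2) /\ forall l, x.2 l < 2 * n,
        movable n (oside r x.1.2) x.2 (bump_at x.1.2 x.1.1) /\
        repeats (oside r x.1.2) x.2 (bump_at x.1.2 x.1.1) s & exists l, x.2 l <> n].
    have : ~ clean r s z w.+1 j (a0 + k * r).
      move=> cl; apply: nex; exists (a0 + k * r) => //.
      by rewrite leq_addr ltn_add2l ltn_pmul2r// ltn_ord.
    move=> /existsNP[c] /existsNP[i] /not_implyP[wc] /not_implyP[cj] /not_implyP[ij].
    move=> /not_implyP[fb nu].
    have fo : fits n (bump_at i c) (oside r i) by move=> l; have := fb l; rewrite /oside; lia.
    have [D [Dn mv rep nz]] := not_uniq_repeat fo nu.
    by exists (c, i, D).
  have [x xP] := choice bad.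
  exists z, (fun k => (x k).1.2), (fun k => bump_at (x k).1.2 (x k).1.1), (fun k => (x k).2).
  have wx k : window z w.+2 (bump_at (x k).1.2 (x k).1.1).
    by have [[wc _] _ _ _ _] := xP k => l; have := wc l; rewrite /bump_at; lia.
  split.
  + by move=> k; split; [exact: wx|have [_ _ [] //] := xP k].
  + by move=> k; have [_ _ [_ Dn] [mv _] _] := xP k.
  + move=> k k' v kk' /cellP/(_ j) vk; apply/negP => /cellP/(_ j).
    have [[_ kj] ij _ _ _] := xP k; have [[_ k'j] i'j _ _ _] := xP k'.
    move: vk; rewrite /bump_at /oside ![j == _]eq_sym (negbTE ij) (negbTE i'j) kj k'j.
    rewrite !addn0 !subn0; have : (k : nat) != k' by [].
    by move: (k : nat) (k' : nat) => K K' /eqP; nia.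
  + move=> k k' v vk; have [_ _ [fp _] [mv rep] [l0 Dl0]] := xP k.
    have [|l Dl] := far _ _ _ _ (w.+2 + r) fp mv rep Dl0; first by rewrite /tau; lia.
    apply/negP => /cellP/(_ l); rewrite (move_cell l mv vk).
    have /cellP/(_ l) := vk; have := wx k l; have := wx k' l; have [] := mv l.
    by rewrite /oside; move: Dl; lia.
  + by move=> k; have [_ _ _ [_ rep] _] := xP k.
- move=> i j p ij fp; apply: contrapT => nex.
  have bad (t : 'I_r) : exists D : {ffun 'I_d -> 'I_(2 * n)},
      [/\ movable n (oside r i) (disp D) (run_at p j t),
        repeats (oside r i) (disp D) (run_at p j t) s & exists l, disp D l <> n].
    have nu : ~ uniq_cell s (oside r i) (run_at p j t).
      by move=> un; apply: nex; exists t.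
    have [D [Dn mv rep nz]] := not_uniq_repeat (fp t (ltn_ord t)) nu.
    by have [D' D'E] := disp_ex Dn; exists D'; rewrite D'E.
  have [D DP] := choice bad.
  have farD (t t' : 'I_r) v : v \in cell n (run_at p j t) (oside r i) ->
      move (disp (D t)) v \notin cell n (run_at p j t') (oside r i).
    move=> vt; have [mv rep [l0 Dl0]] := DP t.
    have [|l Dl] := far _ _ _ _ (2 * r) (fp t (ltn_ord t)) mv rep Dl0; first by rewrite /tau; lia.
    apply/negP => /cellP/(_ l); rewrite (move_cell l mv vt).
    have /cellP/(_ l) := vt; have [] := mv l; have := ltn_ord t; have := ltn_ord t'.
    by rewrite /run_at /oside; move: Dl; case: (l == j); lia.
  have sep (t t' : 'I_r) : D t != D t' ->
      exists l, disp (D t) l >= disp (D t') l + 2 * r \/ disp (D t') l >= disp (D t) l + 2 * r.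
    have wlog_pair (u u' : 'I_r) l0 : disp (D u) l0 < disp (D u') l0 ->
      (forall l, disp (D u) l < disp (D u') l + 2 * r /\ disp (D u') l < disp (D u) l + 2 * r) -> False.
      move=> lt0 nearuu; have [mv rep _] := DP u; have [mv' rep' _] := DP u'.
      apply: npair; exists i, l0, (run_at p j u), (run_at p j u'), (disp (D u)), (disp (D u')).
      split; first split=> //.
      + by split; apply: fp.
      + by move=> v; exact: farD.
      + by move=> v vu'; split; exact: farD.
      split=> //; first by move=> l; exact: ltn_ord.
      move=> l; rewrite /run_at; have := ltn_ord u; have := ltn_ord u'.
      by case: (l == j); lia.
    move=> DD; apply: contrapT => nl.
    have nearl l : disp (D t) l < disp (D t') l + 2 * r /\ disp (D t') l < disp (D t) l + 2 * r.
      by have /not_orP[h1 h2] := (forallNP _).2 nl l; lia.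
    have [l0 Dl0] : exists l0, disp (D t) l0 <> disp (D t') l0.
      apply: contrapT => /forallNP h; move/eqP: DD; apply; apply/ffunP => l.
      by apply: val_inj; have := h l; rewrite /disp notK.
    have [lt|gt|//] := ltngtP (disp (D t) l0) (disp (D t') l0).
      exact: wlog_pair lt nearl.
    by apply: wlog_pair gt _ => l; have [] := nearl l.
  pose m := #|codom D|.
  have Dim t : D t \in codom D by exact: codom_f.
  have t0 : 'I_r by exists 0.
  have m0 : 0 < m by apply/card_gt0P; exists (D t0).
  have mr : m <= r by rewrite /m (leq_trans (leq_image_card _ _))// card_ord.
  apply: (nrun m.-1); first by lia.
  rewrite prednK//.
  pose f t : 'I_m := enum_rank_in (Dim t0) (D t).
  pose E (c : 'I_m) := disp (enum_val c).
  have Ef t : E (f t) = disp (D t) by rewrite /E /f enum_rankK_in.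
  exists p, i, j, f, E; split; last by move=> t; rewrite Ef; have [] := DP t.
    split.
    + by split=> // t; exact: fp.
    + by move=> t; rewrite Ef; have [] := DP t.
    + move=> c; have /codomP[t tc] := enum_valP c; exists t.
      by rewrite /f -tc enum_valK_in.
    + by move=> t t' v vt; rewrite Ef; exact: farD.
    + move=> t t' v v' ff vt vt'; rewrite !Ef.
      have /sep[l Dl] : D t != D t' by apply: contra_neq ff => e; rewrite /f e.
      have [mv _ _] := DP t; have [mv' _ _] := DP t'.
      apply/eqP => /(congr1 (fun u : Lambda d n => tnth u l : nat)).
      rewrite (move_cell l mv vt) (move_cell l mv' vt').
      have /cellP/(_ l) := vt; have /cellP/(_ l) := vt'; have [] := mv l; have [] := mv' l.
      have := ltn_ord t; have := ltn_ord t'.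
      by rewrite /run_at /oside; move: Dl; case: (l == j); lia.
  by move=> c l; exact: ltn_ord.
- move=> z i p zE wp fp; apply: contrapT => nu; apply: ncorner.
  have [D [Dn mv rep nz]] := not_uniq_repeat fp nu.
  by exists z, i, p, D.
Qed.

End BadCover.

(** * From counting to probability *)

Section WhpCriterion.
Variables (R : realType) (d q : nat).
Hypothesis q2 : (2 <= q)%N.
Local Notation total n := (q ^ (n ^ d))%N.

Lemma total_gt0 n : 0 < (total n)%:R :> R.
Proof. by rewrite ltr0n expn_gt0 (ltn_trans _ q2). Qed.

Lemma prob_count n (E : set (config d n q)) :
  prob R E = (count (fun s => E s))%:R / (total n)%:R.
Proof.
rewrite /prob (eq_bigr (fun=> (total n)%:R^-1)) => [|s _].
  rewrite sumr_const -[LHS]mulr_natl; congr (_ * _); apply: (congr1 (fun k => k%:R)).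
  by apply: eq_card => s; rewrite !inE.
rewrite /config_pmf /label_pmf prodr_const -(card_Lambda d n) natrX exprVn.
by congr ((_ ^+ _)^-1); apply: eq_card.
Qed.

Lemma near_ln (A : R) : \forall n \near \oo, A <= ln (n%:R : R).
Proof.
exists (Num.truncn (expR A)).+1 => // n /= An.
have An' : expR A <= n%:R.
  by rewrite (le_trans (ltW (truncnS_gt _)))// ler_nat.
by rewrite -[leLHS]expRK ler_ln// ?posrE ?expR_gt0// (lt_le_trans (expR_gt0 A)).
Qed.

Lemma whp_count (E : forall n, set (config d n q)) (C c : R) : 0 < c ->
  (\forall n \near \oo, (count (fun s => ~ E n s))%:R <=
     C * expR (- (c * ln (n%:R : R))) * (total n)%:R) ->
  whp R E.
Proof.
move=> c0 H; apply/cvgrPdist_le => /= e e0.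
have C1 : 0 < `|C| + 1 by rewrite ltr_wpDl.
apply: filterS2 H (near_ln (- ln (e / (`|C| + 1)) / c)) => n H lnn.
have tot0 := total_gt0 n.
have eC : 0 < e / (`|C| + 1) by rewrite divr_gt0.
have small : C * expR (- (c * ln (n%:R : R))) <= e.
  apply: (@le_trans _ _ ((`|C| + 1) * expR (- (c * ln (n%:R : R))))).
    by rewrite ler_wpM2r ?expR_ge0// (le_trans (ler_norm _))// lerDl.
  rewrite mulrC -ler_pdivlMr// -[leRHS]lnK ?posrE// ler_expR.
  by move: lnn; rewrite ler_pdivrMr// => lnn; rewrite lerNl [leRHS]mulrC.
have -> : 1 - prob R (E n) = (count (fun s => ~ E n s))%:R / (total n)%:R.
  rewrite prob_count; apply/eqP; rewrite subr_eq -mulrDl -natrD addnC countC.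
  by rewrite divff// gt_eqF.
rewrite ger0_norm ?divr_ge0// ler_pdivrMr// (le_trans H)// ler_wpM2r//.
Qed.

Lemma whp_sub (E F : forall n, set (config d n q)) :
  (\forall n \near \oo, E n `<=` F n) -> whp R E -> whp R F.
Proof.
move=> EF /cvgrPdist_le WE; apply/cvgrPdist_le => /= e e0.
apply: filterS2 EF (WE e e0) => n EF.
have tot0 := total_gt0 n.
have P1 (G : set (config d n q)) : prob R G <= 1.
  by rewrite prob_count ler_pdivrMr// mul1r ler_nat count_total.
rewrite !ger0_norm ?subr_ge0//; apply: le_trans; rewrite lerB// !prob_count.
by rewrite ler_wpM2r ?ler_nat ?countS// invr_ge0 ltW.
Qed.

End WhpCriterion.

(** * Bounds for the rare events *)

Section NonReconstructibleCount.
Local Open Scope nat_scope.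
Variables d n q r : nat.
Hypotheses (q0 : 0 < q) (r1 : 1 < r).
Local Notation total := (q ^ (n ^ d)).
Local Notation bad := (count (fun s : config d n q => ~ reconstructible r s)).

Lemma count_nonreconstructible_dense : r <= n ->
  bad * q ^ ((r - 1) * r ^ d.-1) <= d * n ^ d * (2 * n) ^ d * total.
Proof.
move=> rn; apply: leq_trans (count_some_repeat d n q0 r1).
rewrite leq_mul2r; apply/orP; right; apply: countS => s nrec.
apply: contrapT => nrep; apply: nrec; apply: reconstructible_all_uniq => //; first by lia.
move=> i p fp; apply: contrapT => nu; apply: nrep.
have [|D [Dn mv rep nz]] := not_uniq_cell _ fp nu; first by move=> l; exact: oside_gt0.
by exists i, p, D.
Qed.

(** The choices that do not depend on n are powers of multiples of r with a
    bounded exponent; for large r all of them are bounded by the same power. *)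
Lemma leq_power_base a e : a <= r -> 2 * e <= r -> (a * r) ^ e <= r.+1 ^ r.+1.
Proof.
move=> ar er; apply: (@leq_trans ((r * r) ^ e)).
  by case: e er => // e _; rewrite leq_exp2r// leq_mul2r ar orbT.
rewrite expnMn -expnD addnn -mul2n (@leq_trans (r.+1 ^ (2 * e)))//.
  by case: e er => // e _; rewrite leq_exp2r// muln_gt0.
by rewrite leq_pexp2l// (leq_trans er).
Qed.

(** H bounds the choices that do not depend on n, T the choices of one
    displacement, and M is the number of ways to label a piece forced by it. In
    the asymptotic regime T / M is a negative power of n, while H is a power of n
    with a small exponent. *)
Local Notation H := (r.+1 ^ r.+1).
Local Notation M := (q ^ run_exponent d r).
Local Notation T := ((2 * n) ^ d).

(** When T is at most M, factors T / M may be dropped: a run with many classes is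
    no likelier than one with few. *)
Lemma leq_cancel_power c a m k : T <= M -> c * M ^ (m + k) <= a * T ^ (m + k) * total ->
  c * M ^ k <= a * T ^ k * total.
Proof.
move=> TM; rewrite !expnD => h.
have Mm : 0 < M ^ m by rewrite !expn_gt0 q0.
rewrite -(leq_pmul2l Mm); apply: (@leq_trans (c * (M ^ m * M ^ k))).
  by rewrite mulnCA.
apply: leq_trans h _.
have : T ^ m <= M ^ m by case: m {Mm} => // m; rewrite leq_exp2r.
move: (T ^ m) (M ^ m) (T ^ k) => x y z xy.
rewrite [a * _]mulnCA -!mulnA leq_mul2r xy orbT //.
Qed.

Variable S : nat.
Hypotheses (d2 : 1 < d) (S0 : 0 < S) (nbig : r + 3 * (S * r) <= n).
Hypothesis rbig : 100 * d * S * 2 ^ d <= r.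

Let tau := 3 * (S * r) + 2 * r + 2.
Let w := 3 * (S * r).

Lemma run_exponent_le : run_exponent d r <= (r - 1) * r ^ d.-1.
Proof.
rewrite /run_exponent leq_mul2l; apply/orP; right.
by case: d d2 => [//|[//|d']] _; rewrite /= expnS leq_mul2r leq_subr orbT.
Qed.

Lemma count_weaken (E : config d n q -> Prop) k a : count E * q ^ (k * ((r - 1) * r ^ d.-1)) <= a * total ->
  count E * M ^ k <= a * total.
Proof.
apply: leq_trans; rewrite leq_mul2l -expnM; apply/orP; right.
by rewrite leq_pexp2l// mulnC leq_mul2l run_exponent_le orbT.
Qed.

Lemma r_dominates : 2 ^ d * (100 * d * S) <= r /\ 100 * d <= r /\ 100 * S <= r /\ 100 * d * S <= r.
Proof.
have p2 : 0 < 2 ^ d by rewrite expn_gt0.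
have h : 100 * d * S <= r by apply: leq_trans rbig; rewrite leq_pmulr.
split; first by rewrite mulnC.
split; first by apply: leq_trans h; rewrite leq_pmulr.
by split=> //; apply: leq_trans h; rewrite mulnAC leq_pmulr// ltnW.
Qed.

Lemma leq_nd_T : n ^ d <= T.
Proof. by rewrite expnMn leq_pmull// expn_gt0. Qed.

Lemma count_near_small :
  count (fun s : config d n q => near_repeat r tau s) * M ^ 1 <= H * T ^ 1 * total.
Proof.
apply: count_weaken; rewrite mul1n expn1.
apply: leq_trans (count_near_repeat d n q0 r1 tau) _; rewrite leq_mul2r; apply/orP; right.
rewrite mulnAC leq_mul ?leq_nd_T//.
have [_ [dr [Sr dS]]] := r_dominates.
apply: (@leq_trans ((d * (6 * S + 9) * r) ^ d)); last by apply: leq_power_base; nia.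
apply: (@leq_trans (d ^ d * (2 * tau).+1 ^ d)).
  by rewrite leq_mul2r; apply/orP; right; rewrite -{1}[d]expn1 leq_pexp2l; lia.
by rewrite -expnMn leq_exp2r ?(ltnW d2)// -mulnA leq_mul2l /tau; nia.
Qed.

Lemma count_corner_small :
  count (fun s : config d n q => corner_repeat r w s) * M ^ 1 <= H * T ^ 1 * total.
Proof.
apply: count_weaken; rewrite mul1n expn1.
apply: leq_trans (count_corner_repeat d n q0 r1 w) _; rewrite leq_mul2r; apply/orP; right.
rewrite leq_mul2r; apply/orP; right.
have [_ [dr [Sr dS]]] := r_dominates.
apply: (@leq_trans ((2 * (3 * S + 2) * d * r) ^ d)); last by apply: leq_power_base; nia.
apply: (@leq_trans (2 ^ d * w.+2 ^ d * d ^ d)).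
  by rewrite leq_mul2l; apply/orP; right; rewrite -{1}[d]expn1 leq_pexp2l; lia.
by rewrite -!expnMn leq_exp2r ?(ltnW d2)// /w; nia.
Qed.

Lemma count_separated_small :
  count (fun s : config d n q => separated_repeats r S w.+2 s) * M ^ S <=
    T * (H * T) ^ S * total.
Proof.
apply: count_weaken.
apply: leq_trans (count_separated d n q0 r1 w.+2 S0) _; rewrite leq_mul2r; apply/orP; right.
rewrite leq_mul ?leq_nd_T// leq_exp2r// leq_mul2r; apply/orP; right.
have [_ [dr [Sr dS]]] := r_dominates.
apply: (@leq_trans (((3 * S + 3) * d * r) ^ d)); last by apply: leq_power_base; nia.
apply: (@leq_trans (w.+3 ^ d * d ^ d)).
  by rewrite leq_mul2l; apply/orP; right; rewrite -{1}[d]expn1 leq_pexp2l; lia.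
by rewrite -!expnMn leq_exp2r ?(ltnW d2)// /w; nia.
Qed.

Lemma count_pair_small :
  count (fun s : config d n q => pair_repeat r s) * M ^ 2 <= H * T ^ 2 * total.
Proof.
apply: count_weaken.
apply: leq_trans (count_pair_repeat d n q0 r1) _; rewrite leq_mul2r; apply/orP; right.
apply: (@leq_trans ((d * d * (2 * r) ^ d * (4 * r) ^ d) * (n ^ d * T))).
  by move: (n ^ d) ((2 * r) ^ d) ((4 * r) ^ d) T => x y z t; nia.
rewrite [T ^ 2]expnS expn1 leq_mul// ?leq_mul ?leq_nd_T//.
have [_ [dr [Sr dS]]] := r_dominates.
apply: (@leq_trans ((4 * d * r) ^ (2 * d))); last by apply: leq_power_base; nia.
rewrite [2 * d]mul2n -addnn expnD; apply: (@leq_trans ((d * (2 * r)) ^ d * (d * (4 * r)) ^ d)).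
  have dd : d <= d ^ d by rewrite -{1}[d]expn1 leq_pexp2l; lia.
  have dx x : d * x ^ d <= (d * x) ^ d by rewrite expnMn leq_mul2r dd orbT.
  by rewrite -mulnA mulnACA leq_mul ?dx.
by rewrite leq_mul// leq_exp2r ?(ltnW d2)//; nia.
Qed.

Lemma count_run_small : T <= M ->
  count (fun s : config d n q => exists m : 'I_r.+1, run_repeats r m.+1 s) * M ^ 2 <=
    d * d * H * T ^ 2 * total.
Proof.
move=> TM.
have run1 (m : 'I_r.+1) : count (fun s : config d n q => run_repeats r m.+1 s) * M ^ 2 <=
    d * d * r.+1 ^ r * T ^ 2 * total.
  apply: (@leq_cancel_power _ _ m) => //; rewrite addn2 -expnM.
  apply: leq_trans (count_run_repeats d n q0 r1 m.+1) _; rewrite leq_mul2r; apply/orP; right.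
  rewrite [T ^ m.+2]expnS mulnA leq_mul2r; apply/orP; right.
  have := leq_nd_T; have : m.+1 ^ r <= r.+1 ^ r by rewrite leq_exp2r ?ltn_ord//; lia.
  move: (n ^ d) T (m.+1 ^ r) (r.+1 ^ r) => x t y z yz xt.
  by rewrite -!mulnA mulnC -!mulnA !leq_mul.
have tot0 : 0 < total by rewrite expn_gt0 q0.
have U : count (fun s : config d n q => exists m : 'I_r.+1, run_repeats r m.+1 s) <=
    \sum_(m < r.+1) count (fun s : config d n q => run_repeats r m.+1 s).
  rewrite /count; set A := fun m : 'I_r.+1 => [set s : config d n q | `[< run_repeats r m.+1 s >]]%SET.
  have sub : [set s : config d n q | `[< exists m : 'I_r.+1, run_repeats r m.+1 s >]]%SET \subset
      (\bigcup_(m : 'I_r.+1) A m)%SET.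
    apply/fintype.subsetP => s; rewrite !inE => -[i Fi].
    by apply/finset.bigcupP; exists i => //; rewrite !inE.
  apply: leq_trans (subset_leq_card sub) _.
  elim/big_ind2 : _ => // [|x B y C Bx Cy]; first by rewrite cards0.
  by rewrite (leq_trans (leq_card_setU _ _))// leq_add.
apply: leq_trans (leq_mul U (leqnn _)) _; rewrite big_distrl /=.
apply: (@leq_trans (\sum_(m < r.+1) (d * d * r.+1 ^ r * T ^ 2 * total))).
  by apply: leq_sum => m _; exact: run1.
rewrite sum_nat_const card_ord [r.+1 ^ r.+1]expnS.
by apply: eq_leq; move: (r.+1 ^ r) (T ^ 2) total => x y z; ring.
Qed.

Lemma nonreconstructible_cover : bad <=
  count (fun s : config d n q => near_repeat r tau s) +
  (count (fun s : config d n q => corner_repeat r w s) +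
  (count (fun s : config d n q => separated_repeats r S w.+2 s) +
  (count (fun s : config d n q => pair_repeat r s) +
   count (fun s : config d n q => exists m : 'I_r.+1, run_repeats r m.+1 s)))).
Proof.
have cover (s : config d n q) : ~ reconstructible r s -> near_repeat r tau s \/
    (corner_repeat r w s \/ (separated_repeats r S w.+2 s \/ (pair_repeat r s \/
      exists m : 'I_r.+1, run_repeats r m.+1 s))).
  move=> nrec; apply: contrapT => /not_orP[h1 /not_orP[h2 /not_orP[h3 /not_orP[h4 h5]]]].
  apply: nrec; apply: (reconstructible_avoid r1 d2 S0 nbig h1 h2 h3 h4) => m mr h.
  by apply: h5; exists (Ordinal (mr : m < r.+1)).
apply: leq_trans (countS cover) _.
do 3 (apply: leq_trans (countU _ _) _; rewrite leq_add2l).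
exact: countU.
Qed.

End NonReconstructibleCount.

(** * Asymptotics of the identifiable regime *)

Section IdentifiableRegime.
Variables (R : realType) (q : nat).
Hypothesis q2 : (2 <= q)%N.
Let lq : R := ln q%:R.
Implicit Types (n m : nat) (x y : R).

Let q0 : (0 < q)%N. Proof. exact: leq_trans q2. Qed.

Lemma lnq_gt0 : 0 < lq.
Proof. by apply: ln_gt0; rewrite ltr1n. Qed.

Lemma nat_expR n : (0 < n)%N -> n%:R = expR (ln n%:R) :> R.
Proof. by move=> n0; rewrite lnK// posrE ltr0n. Qed.

Lemma natX_expR n m : (0 < n)%N -> (n ^ m)%:R = expR (m%:R * ln n%:R) :> R.
Proof. by move=> n0; rewrite natrX {1}(nat_expR n0) expRM_natl. Qed.

Lemma ln_nat_ge0 n : 0 <= ln (n%:R : R).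
Proof.
case: n => [|n]; first by rewrite ln0.
by apply: ln_ge0; rewrite ler1n.
Qed.

Lemma count_real (c A N m : nat) : (c * q ^ m <= A * N)%N ->
  c%:R <= A%:R * expR (- (m%:R * lq)) * N%:R :> R.
Proof.
rewrite -(ler_nat R) !natrM natX_expR// => h.
rewrite mulrAC expRN ler_pdivlMr ?expR_gt0//.
Qed.

Lemma whp_reconstructible_line (eps : R) (r : nat -> nat) : 0 < eps ->
  (forall n, (1 <= n)%N -> (1 <= r n <= n)%N) ->
  (\forall n \near \oo, 2 * (1 + eps) * ln (n%:R : R) / ln (q%:R : R) <= (r n)%:R) ->
  whp R (fun n => [set s : config 1 n q | reconstructible (r n) s]).
Proof.
move=> eps0 hr H; apply: (@whp_count R 1 q q2 _ (2 * q%:R) (2 * eps)).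
  by rewrite mulr_gt0.
apply: filterS2 H (near_ln (Num.max 1 lq)) => n H.
rewrite ge_max => /andP[X1 Xq].
have n0 : (0 < n)%N.
  by case: n X1 {H Xq} => // ; rewrite ln0// => /le_lt_trans/(_ ltr01); rewrite ltxx.
have /andP[r1 rn] := hr n n0; have l0 := lnq_gt0.
move: H; rewrite -/lq ler_pdivrMr// => H; set X := ln n%:R in H X1 Xq *.
have r2 : (1 < r n)%N.
  rewrite -(ltr_nat R); rewrite -(ltr_pM2r l0) mul1r (lt_le_trans _ H)//.
  by nra.
have := count_nonreconstructible_dense 1 q0 r2 rn.
rewrite expn0 muln1 => /count_real/le_trans; apply.
rewrite ler_wpM2r// mul1n !expn1 !natrM (nat_expR n0) -/X (nat_expR q0) -/lq.
rewrite [expR X * _]mulrCA -!mulrA ler_wpM2l// -!expRD ler_expR natrB// mulrBl.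
by lra.
Qed.

(** It makes (r + 1) ^ (r + 1) a power of n with a small exponent when r ^ 2 is
    of the order of ln n. *)
Lemma subquadratic (e : R) : 0 < e -> exists r0, forall r, (r0 <= r)%N ->
  (r.+1)%:R * ln (r.+1)%:R <= e * r%:R ^+ 2.
Proof.
move=> e0; exists (Num.truncn (64 / e ^+ 2)).+1 => r r0r.
have re : 64 <= e ^+ 2 * r%:R.
  rewrite mulrC -ler_pdivrMr ?exprn_gt0// (le_trans (ltW (truncnS_gt _)))//.
  by rewrite ler_nat.
have r1 : (1 : R) <= r%:R by rewrite ler1n (leq_trans _ r0r).
set y : R := r%:R in re r1 *; have yE : (r.+1)%:R = y + 1 :> R by rewrite -natr1.
have s0 : 0 <= Num.sqrt (y + 1) by rewrite sqrtr_ge0.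
have s2 : Num.sqrt (y + 1) ^+ 2 = y + 1 by rewrite sqr_sqrtr//; lra.
have lnle : ln (y + 1) <= 2 * Num.sqrt (y + 1).
  have sp : 0 < Num.sqrt (y + 1) by rewrite sqrtr_gt0; lra.
  by rewrite -{1}s2 lnXn// mulr2n; have := ln_sublinear sp; lra.
rewrite yE; apply: (@le_trans _ _ ((y + 1) * (2 * Num.sqrt (y + 1)))).
  by rewrite ler_wpM2l//; lra.
have key : 4 * Num.sqrt (y + 1) <= e * y.
  have a0 : 0 <= 4 * Num.sqrt (y + 1) by rewrite mulr_ge0.
  have b0 : 0 <= e * y by apply: mulr_ge0; lra.
  by rewrite -(@ler_pXn2r _ 2%N) ?nnegrE// !exprMn s2; nra.
nra.
Qed.

(** If r ^ d exceeds 4 d log_q n, then all overlaps are unique with high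
    probability. Otherwise r is so small that H is a power of n with exponent at
    most c, where n ^ (- 2 c) bounds T / M up to a constant, and each rare event
    has probability of order at most n ^ (- c). The number S of separated repeats
    is chosen so that their joint gain outweighs the n ^ d choices of a window. *)
Lemma whp_reconstructible_space (d : nat) (eps : R) (r : nat -> nat) : (2 <= d)%N -> 0 < eps ->
  (forall n, (1 <= n)%N -> (1 <= r n <= n)%N) ->
  (\forall n \near \oo, d%:R * (1 + eps) * ln (n%:R : R) / ln (q%:R : R) <= (r n)%:R ^+ d) ->
  whp R (fun n => [set s : config d n q | reconstructible (r n) s]).
Proof.
move=> d2 eps0 hr Heps.
(* the hypothesis for e is weaker than the one for eps, and 1 - e / 4 is positive *)
pose e := Num.min eps 1.
have e0 : 0 < e by rewrite lt_min eps0 ltr01.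
have e1 : e <= 1 by rewrite ge_min lexx orbT.
have ee : e <= eps by rewrite ge_min lexx.
have l0 := lnq_gt0; have d2R : (2 : R) <= d%:R by rewrite (ler_nat R 2).
(* S c >= 2 d, so that S separated repeats outweigh the choice of a window *)
have [S [S0 Se]] : exists S, (0 < S)%N /\ 8 <= S%:R * e.
  exists (Num.truncn (8 / e)).+1; split=> //.
  by rewrite -ler_pdivrMr// (le_trans (ltW (truncnS_gt _))).
pose c := d%:R * e / 4.
have c0 : 0 < c by rewrite divr_gt0// mulr_gt0//; lra.
have [r0 r0P] := @subquadratic (Num.min c 1 * lq / (4 * d%:R))
  ltac:(by rewrite divr_gt0// ?mulr_gt0// ?lt_min ?c0//; lra).
have [r1 [r1a r1b r1c r1d]] : exists r1, [/\ (r0 <= r1)%N, (100 * d * S * 2 ^ d <= r1)%N,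
    (S <= r1)%N & (4 <= r1)%N].
  have le (a b t k : nat) : exists m, [/\ (a <= m)%N, (b <= m)%N, (t <= m)%N & (k <= m)%N].
    by exists (a + b + t + k)%N; split; lia.
  exact: le.
pose D : R := (2 ^ d)%:R.
have D0 : 1 <= D by rewrite /D ler1n expn_gt0.
have Dge0 : 0 <= D := le_trans ler01 D0.
have dD0 : 0 <= d%:R * D by rewrite mulr_ge0.
have d3D0 : 0 <= (3 + d%:R ^+ 2) * D by rewrite mulr_ge0// addr_ge0// exprn_ge0.
have DS0 : 0 <= D * D ^+ S by rewrite mulr_ge0// exprn_ge0.
pose C : R := d%:R * D + ((3 + d%:R ^+ 2) * D + D * D ^+ S).
apply: (@whp_count R d q q2 _ C c c0).
apply: filterS2 Heps (near_ln (Num.max 1 (Num.max (r1%:R ^+ d * lq) (ln D / (d%:R * e / 2))))).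
move=> n Heps; rewrite !ge_max => /and3P[X1 Xr XD].
have n0 : (0 < n)%N.
  by case: n X1 {Heps Xr XD} => // ; rewrite ln0// => /le_lt_trans/(_ ltr01); rewrite ltxx.
have /andP[rpos rn] := hr n n0.
move: Heps; rewrite -/lq ler_pdivrMr// => Heps.
set X := ln n%:R in Heps X1 Xr XD *.
set y : R := (r n)%:R in Heps.
have {}Heps : d%:R * (1 + e) * X <= y ^+ d * lq.
  apply: le_trans Heps; rewrite ler_wpM2r//; first by lra.
  by rewrite ler_wpM2l//; lra.
have r1r : (r1 <= r n)%N.
  have : (r1%:R : R) ^+ d <= y ^+ d.
    rewrite -(ler_pM2r l0); apply: le_trans Xr (le_trans _ Heps).
  have de0 : 0 <= d%:R * e by apply: mulr_ge0 => //; lra.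
  by rewrite -{1}[X]mul1r ler_wpM2r//; lra.
  by rewrite ler_pXn2r ?nnegrE// ?ler_nat// ltnW.
have rr1 : (1 < r n)%N by apply: leq_trans r1r; apply: leq_trans r1d.
have y4 : 4 <= y by rewrite (ler_nat R 4) (leq_trans r1d).
have y8 : 8 <= y * e.
  by apply: le_trans Se _; apply: ler_wpM2r; [exact: ltW|rewrite ler_nat (leq_trans r1c)].
have TE : ((2 * n) ^ d)%:R = D * expR (d%:R * X) :> R by rewrite expnMn natrM (natX_expR _ n0).
have bndc : expR (- (d%:R * X)) <= expR (- (c * X)).
  by rewrite ler_expR lerN2 ler_wpM2r//; [lra|rewrite /c; nra].
have expc0 := expR_ge0 (- (c * X)).
have dE : d = d.-1.+1 by rewrite prednK// ltnW.
have [dense|sparse] := leP (4 * d%:R * X) (y ^+ d * lq).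
  have := count_nonreconstructible_dense d q0 rr1 rn.
  move=> /count_real/le_trans; apply; rewrite ler_wpM2r//.
  rewrite !natrM TE (natX_expR _ n0) -/X.
  apply: (@le_trans _ _ (d%:R * D * expR (- (c * X)))); last first.
    by rewrite ler_wpM2r// /C lerDl addr_ge0.
  apply: le_trans (_ : _ <= d%:R * D * expR (- (d%:R * X))) _; last first.
    by rewrite ler_wpM2l.
  rewrite natrX natrB ?(ltnW rr1)//.
  rewrite -/y; have -> : d%:R * expR (d%:R * X) * (D * expR (d%:R * X)) *
      expR (- ((y - 1) * y ^+ d.-1 * lq)) =
      d%:R * D * expR (d%:R * X + d%:R * X - (y - 1) * y ^+ d.-1 * lq).
    by rewrite !expRD; ring.
  rewrite ler_wpM2l// ler_expR.
  have yd : y ^+ d = y * y ^+ d.-1 by rewrite {1}dE exprS.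
  have y30 : 0 <= y ^+ d.-1 by rewrite exprn_ge0//; lra.
  have : 3 * (d%:R * X) <= (y - 1) * y ^+ d.-1 * lq.
    have yy : 3 * (y * y ^+ d.-1) * lq <= 4 * ((y - 1) * y ^+ d.-1) * lq.
      apply: ler_wpM2r; first exact: ltW.
      by rewrite mulrA [leRHS]mulrA; apply: ler_wpM2r => //; lra.
    by move: dense; rewrite yd; lra.
  lra.
have sub := r0P (r n) (leq_trans r1a r1r).
set rn' := r n in r1r rr1 rn sub *.
have y1 : 1 <= y by lra.
have y2d : y ^+ 2 <= y ^+ d by rewrite ler_weXn2l.
have X0 : 0 <= X by lra.
have m0 : 0 < Num.min c 1 by rewrite lt_min c0 ltr01.
have hH : (rn'.+1)%:R * ln (rn'.+1)%:R <= Num.min c 1 * X.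
  apply: le_trans sub _; rewrite -!mulrA; apply: ler_wpM2l; first exact: ltW.
  rewrite mulrCA ler_pdivrMl; last by rewrite mulr_gt0//; lra.
  apply: le_trans (ltW sparse); rewrite mulrC; apply: ler_wpM2r => //; exact: ltW.
have HE : (rn'.+1 ^ rn'.+1)%:R <= expR (Num.min c 1 * X).
  by rewrite natX_expR// ler_expR.
have Hn : (rn'.+1 ^ rn'.+1 <= n)%N.
  rewrite -(ler_nat R) (le_trans HE)// (nat_expR n0) ler_expR -/X.
  by rewrite -{2}[X]mul1r ler_wpM2r// ge_min lexx orbT.
have rbig : (100 * d * S * 2 ^ d <= rn')%N := leq_trans r1b r1r.
have nbig : (rn' + 3 * (S * rn') <= n)%N.
  apply: leq_trans Hn.
  have Sr : (1 + 3 * S <= rn')%N.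
    have P1 : (0 < 2 ^ d)%N by rewrite expn_gt0.
    by have [_ [_ [Sr _]]] := r_dominates d2 S0 rbig; move: Sr S0; clear; lia.
  have -> : (rn' + 3 * (S * rn') = (1 + 3 * S) * rn')%N by rewrite mulnDl mul1n mulnA.
  apply: (@leq_trans (rn'.+1 ^ 2)); first by rewrite -mulnn leq_mul// ltnW.
  by rewrite leq_pexp2l// ltnS ltnW.
pose M : R := (q ^ run_exponent d rn')%:R; pose T : R := ((2 * n) ^ d)%:R.
have ME : M = expR ((run_exponent d rn')%:R * lq) by rewrite /M natX_expR.
have M0 : 0 < M by rewrite ME expR_gt0.
have eX : d%:R * (1 + e / 2) * X <= (run_exponent d rn')%:R * lq.
  rewrite /run_exponent !natrM natrX natrB ?(ltnW rr1)// -/y.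
  have dE2 : y ^+ d = y * (y * y ^+ d.-2) by rewrite -!exprS; congr (_ ^+ _); case: (d) d2 => [|[]].
  have p0 : 0 <= y ^+ d.-2 by rewrite exprn_ge0//; lra.
  have k1 : (1 - e / 4) * y ^+ d <= (y - 1) * ((y - 1) * y ^+ d.-2).
    rewrite dE2 !mulrA; apply: ler_wpM2r => //; nra.
  apply: (@le_trans _ _ ((1 - e / 4) * (y ^+ d * lq))); last first.
    by rewrite [leLHS]mulrA; apply: ler_wpM2r => //; exact: ltW.
  apply: (@le_trans _ _ ((1 - e / 4) * (d%:R * (1 + e) * X))); last first.
    by apply: ler_wpM2l => //; lra.
  have dX : 0 <= d%:R * X by exact: mulr_ge0.
  have -> : d%:R * (1 + e / 2) * X = (1 + e / 2) * (d%:R * X) by ring.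
  have -> : (1 - e / 4) * (d%:R * (1 + e) * X) = ((1 - e / 4) * (1 + e)) * (d%:R * X) by ring.
  apply: ler_wpM2r => //; nra.
have th : T / M <= D * expR (- (2 * c * X)).
  rewrite /T TE ME -mulrA -expRN -expRD; apply: ler_wpM2l => //.
  by rewrite ler_expR /c; lra.
have th0 : 0 <= T / M by rewrite divr_ge0// ltW.
have th1 : T / M <= 1.
  apply: le_trans th _; rewrite expRN ler_pdivrMr ?expR_gt0// mul1r.
  rewrite -[leLHS]lnK ?posrE; last by lra.
  rewrite ler_expR; move: XD; rewrite ler_pdivrMr; last first.
    by rewrite divr_gt0// mulr_gt0//; lra.
  by rewrite /c; lra.
have TM : ((2 * n) ^ d <= q ^ run_exponent d rn')%N.
  by rewrite -(ler_nat R) -/M -/T; move: th1; rewrite ler_pdivrMr// mul1r.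
pose H : R := (rn'.+1 ^ rn'.+1)%:R.
have H0 : 0 <= H by [].
have Hth : H * (T / M) <= D * expR (- (c * X)).
  apply: le_trans (ler_pM H0 th0 HE th) _; rewrite mulrCA -expRD.
  apply: ler_wpM2l => //; rewrite ler_expR.
  have : Num.min c 1 * X <= c * X by apply: ler_wpM2r => //; rewrite ge_min lexx.
  by lra.
have Hth0 : 0 <= H * (T / M) by rewrite mulr_ge0.
have Hth2 : H * (T / M) ^+ 2 <= H * (T / M).
  by rewrite expr2 mulrA ler_piMr.
have tr (a A N k : nat) : (a * (q ^ run_exponent d rn') ^ k <= A * ((2 * n) ^ d) ^ k * N)%N ->
    (a%:R : R) <= A%:R * (T / M) ^+ k * N%:R.
  rewrite -(ler_nat R) !natrM !(natrX _ _ k) -/M -/T => h.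
  by rewrite expr_div_n mulrA -[leRHS]mulrAC ler_pdivlMr ?exprn_gt0.
set N : nat := (q ^ (n ^ d))%N.
have b1 := tr _ _ _ _ (count_near_small q0 rr1 d2 S0 nbig rbig).
have b2 := tr _ _ _ _ (count_corner_small q0 rr1 d2 S0 nbig rbig).
have b3 : ((count (fun s : config d n q => separated_repeats rn' S (3 * (S * rn')).+2 s))%:R : R)
    <= T * (H * (T / M)) ^+ S * N%:R.
  rewrite exprMn mulrA; have -> : T * H ^+ S = ((2 * n) ^ d * (rn'.+1 ^ rn'.+1) ^ S)%:R.
    by rewrite natrM [in RHS](natrX _ _ S).
  apply: tr.
  have -> : ((2 * n) ^ d * (rn'.+1 ^ rn'.+1) ^ S * ((2 * n) ^ d) ^ S =
      (2 * n) ^ d * (rn'.+1 ^ rn'.+1 * (2 * n) ^ d) ^ S)%N by rewrite -mulnA -expnMn.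
  exact: (count_separated_small q0 rr1 d2 S0 nbig rbig).
have b4 := tr _ _ _ _ (count_pair_small q0 rr1 d2 S0 nbig rbig).
have b5 := tr _ _ _ _ (count_run_small q0 rr1 d2 S0 nbig rbig TM).
have := nonreconstructible_cover q rr1 d2 S0 nbig.
rewrite -(ler_nat R) !natrD => /le_trans; apply.
have N0 : 0 <= N%:R :> R by [].
move: b1 b2 b4 b5; rewrite !expr1 [(d * d * _)%:R]natrM -/H -/N => b1 b2 b4 b5.
have sepb : T * (H * (T / M)) ^+ S <= D * D ^+ S * expR (- (c * X)).
  apply: (@le_trans _ _ (T * (D * expR (- (c * X))) ^+ S)).
    by apply: ler_wpM2l => //; apply: lerXn2r; rewrite ?nnegrE// mulr_ge0.
  rewrite exprMn -expRM_natl /T TE mulrACA -expRD.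
  apply: ler_wpM2l => //; rewrite ler_expR.
  have : 2 * d%:R * X <= S%:R * (c * X).
    have -> : S%:R * (c * X) = (S%:R * e) / 8 * (2 * d%:R * X) by rewrite /c; field.
    by rewrite -[leLHS]mul1r; apply: ler_wpM2r; [rewrite !mulr_ge0|lra].
  have : c * X <= d%:R * X by apply: ler_wpM2r => //; rewrite /c; nra.
  by rewrite mulrN; lra.
set E := expR (- (c * X)) in Hth sepb *.
apply: (@le_trans _ _ (((3 + d%:R ^+ 2) * (H * (T / M)) + T * (H * (T / M)) ^+ S) * N%:R)).
  have {}b4 := le_trans b4 (ler_wpM2r N0 Hth2).
  have h5 : (d * d)%:R * H * (T / M) ^+ 2 <= d%:R ^+ 2 * (H * (T / M)).
    by rewrite natrM -expr2 -mulrA; apply: ler_wpM2l Hth2; exact: exprn_ge0.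
  have {}b5 := le_trans b5 (ler_wpM2r N0 h5).
  have -> : ((3 + d%:R ^+ 2) * (H * (T / M)) + T * (H * (T / M)) ^+ S) * N%:R =
      H * (T / M) * N%:R + (H * (T / M) * N%:R + (T * (H * (T / M)) ^+ S * N%:R +
      (H * (T / M) * N%:R + d%:R ^+ 2 * (H * (T / M)) * N%:R))) by ring.
  by do 4 (apply: lerD => //).
apply: ler_wpM2r => //; rewrite /C.
have -> : (d%:R * D + ((3 + d%:R ^+ 2) * D + D * D ^+ S)) * E =
  d%:R * D * E + ((3 + d%:R ^+ 2) * (D * E) + D * D ^+ S * E) by ring.
rewrite -[leLHS]add0r lerD//; first by rewrite mulr_ge0.
by rewrite lerD// ler_wpM2l// addr_ge0// exprn_ge0.
Qed.

End IdentifiableRegime.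

(** * Fewer profiles than labelings *)

Section ProfileCounting.
Local Open Scope nat_scope.

(** Identifiable labelings have different profiles, and a profile assigns to each
    of the q ^ (r ^ d) contents a multiplicity of at most n ^ d. *)
Lemma count_identifiable d n q r :
  count (fun s : config d n q => identifiable r s) <= (n ^ d).+1 ^ (q ^ (r ^ d)).
Proof.
pose f (s : config d n q) : {ffun config d r q -> 'I_(n ^ d).+1} :=
  [ffun B => inord (profile r s B)].
have f_inj : {in [set s : config d n q | `[< identifiable r s >]]%SET &, injective f}.
  move=> s s'; rewrite !inE => ids _ /ffunP ff; apply: contrapT => /nesym ne.
  apply: ids; exists s'; split=> //; apply/msetP => B.
  have lt (t : config d n q) : profile r t B < (n ^ d).+1.
    rewrite /profile mset_seqE ltnS (leq_trans (count_size _ _))// size_image.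
    by rewrite -card_Lambda; exact: max_card.
  have := congr1 val (ff B); rewrite !ffunE /= !inordK//.
rewrite /count -(card_in_imset f_inj) (leq_trans (max_card _))//.
by rewrite !card_ffun !card_ord card_Lambda.
Qed.

End ProfileCounting.

Section SpaceNonIdentifiable.
Variables (R : realType) (q : nat).
Hypothesis q2 : (2 <= q)%N.

(** By the bound on r, the exponent q ^ (r ^ d) is at most n ^ (d (1 - eps)),
    which makes the number of profiles negligible against q ^ (n ^ d). *)
Lemma whp_nonidentifiable_space (d : nat) (eps : R) (r : nat -> nat) :
  (1 <= d)%N -> 0 < eps -> (forall n, (1 <= n)%N -> (1 <= r n <= n)%N) ->
  (\forall n \near \oo, (r n)%:R ^+ d <= d%:R * (1 - eps) * ln (n%:R : R) / ln (q%:R : R)) ->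
  whp R (fun n => [set s : config d n q | nonidentifiable (r n) s]).
Proof.
move=> d1 eps0 hr H; have l0 := lnq_gt0 R q2.
have d1R : (1 : R) <= d%:R by rewrite ler1n.
apply: (@whp_count R d q q2 _ 1 1) => //.
pose a := ln q%:R * (d%:R * eps) ^+ 2.
have de0 : 0 < d%:R * eps by rewrite mulr_gt0//; lra.
have a0 : 0 < a by rewrite mulr_gt0// exprn_gt0.
apply: filterS2 H (near_ln (Num.max 1 (4 * (d%:R + 3) / a))) => n H.
rewrite ge_max => /andP[X1 Xa].
have n0 : (0 < n)%N.
  by case: n X1 {H Xa} => // ; rewrite ln0// => /le_lt_trans/(_ ltr01); rewrite ltxx.
have /andP[r1 rn] := hr n n0.
set X := ln n%:R in H X1 Xa *.
have {}H : (r n)%:R ^+ d * ln q%:R <= d%:R * (1 - eps) * X.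
  by rewrite -ler_pdivlMr.
have eps1 : 0 <= d%:R * (1 - eps) * X.
  by apply: le_trans H; rewrite mulr_ge0 ?exprn_ge0// ltW.
have q0 : (0 < q)%N by exact: leq_trans q2.
have -> : count (fun s : config d n q => ~ [set s | nonidentifiable (r n) s] s) =
  count (fun s : config d n q => identifiable (r n) s) by [].
apply: le_trans (_ : _ <= ((n ^ d).+1 ^ (q ^ (r n ^ d)))%:R) _.
  by rewrite ler_nat count_identifiable.
rewrite (natX_expR R _ (ltn0Sn _)) !mul1r [(q ^ (n ^ d))%:R](natX_expR R _ q0).
rewrite -expRD ler_expR.
rewrite [(n ^ d)%:R](natX_expR R _ n0) -/X.
have Q1 : (q ^ (r n ^ d))%:R <= expR (d%:R * (1 - eps) * X) :> R.
  by rewrite natX_expR// ler_expR natrX.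
have lnn : ln ((n ^ d).+1)%:R <= 1 + d%:R * X :> R.
  rewrite -[leRHS]expRK ler_ln ?posrE ?ltr0n ?expR_gt0//.
  rewrite expRD -natX_expR//.
  have e1 : 2 <= expR (1 : R) by have := expR_ge1Dx (1 : R); lra.
  have nd1 : (1 : R) <= (n ^ d)%:R by rewrite ler1n expn_gt0 n0.
  by rewrite -natr1; nra.
have lnn0 : 0 <= ln ((n ^ d).+1)%:R :> R by exact: ln_nat_ge0.
set P := expR (d%:R * (1 - eps) * X) in Q1.
have P1 : 1 <= P by rewrite -[leLHS]expR0 ler_expR.
have -> : expR (d%:R * X) = P * expR (d%:R * eps * X).
  by rewrite -expRD; congr expR; ring.
have sq (x : R) : 0 <= x -> x ^+ 2 / 4 <= expR x.
  move=> x0; have -> : expR x = expR (x / 2) ^+ 2.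
    by rewrite -expRM_natl; congr expR; field.
  have -> : x ^+ 2 / 4 = (x / 2) ^+ 2 by field.
  rewrite lerXn2r ?nnegrE ?expR_ge0//; first by rewrite divr_ge0.
  by have := expR_ge1Dx (x / 2); lra.
have u0 : 0 <= d%:R * eps * X by rewrite mulr_ge0 ?ltW//; lra.
have u := sq _ u0.
apply: (@le_trans _ _ (- X + P * (expR (d%:R * eps * X) * ln q%:R))); last by rewrite mulrA.
have low : (d%:R + 3) * X <= expR (d%:R * eps * X) * ln q%:R.
  apply: le_trans (ler_wpM2r (ltW l0) u).
  have -> : (d%:R * eps * X) ^+ 2 / 4 * ln q%:R = a / 4 * X * X by rewrite /a; field.
  apply: ler_wpM2r; first by lra.
  by move: Xa; rewrite ler_pdivrMr//; lra.
apply: le_trans (_ : _ <= P * (1 + d%:R * X)) _.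
  by apply: ler_pM => //; rewrite ler0n.
have X0 : 0 <= d%:R * X by rewrite mulr_ge0//; lra.
have := ler_wpM2l (le_trans ler01 P1) low.
have : X <= P * X by rewrite ler_peMl//; lra.
have : 1 * P <= X * P by apply: ler_wpM2r => //; lra.
lra.
Qed.

End SpaceNonIdentifiable.

(** * Words with the same windows *)

Section Windows.
Local Open Scope nat_scope.
Variables (T : eqType) (r : nat).
Hypothesis r0 : 0 < r.
Implicit Types s A B : seq T.

Definition windows s := [seq take r (drop k s) | k <- iota 0 ((size s).+1 - r)].

(** A window that starts in A sees at most r - 1 letters of B. *)
Lemma windows_cat A B : r.-1 <= size B ->
  windows (A ++ B) = windows (A ++ take r.-1 B) ++ windows B.
Proof.
move=> rB; rewrite /windows !size_cat size_takel//.
have -> : (size A + size B).+1 - r = ((size A + r.-1).+1 - r) + ((size B).+1 - r) by lia.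
rewrite iotaD map_cat add0n; congr (_ ++ _).
  apply/eq_in_map => k; rewrite mem_iota => /andP[_ kA].
  rewrite !drop_cat; case: ltnP => [ltk|]; last by lia.
  rewrite !take_cat size_drop; case: ltnP => // Ak; congr (_ ++ _).
  by rewrite take_takel//; lia.
have -> : (size A + r.-1).+1 - r = size A by lia.
rewrite -{1}[size A]addn0 iotaDl -map_comp; apply: eq_map => k /=.
by rewrite drop_cat ltnNge leq_addr /= addKn.
Qed.

(** The windows of each segment depend on the next segment only through its
    first r - 1 letters, and these are the same before and after the exchange. *)
Lemma windows_swap A1 A2 A3 A4 A5 : r.-1 <= size A2 -> r.-1 <= size A3 ->
  r.-1 <= size A4 -> r.-1 <= size A5 ->
  take r.-1 A2 = take r.-1 A4 -> take r.-1 A3 = take r.-1 A5 ->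
  perm_eq (windows (A1 ++ A2 ++ A3 ++ A4 ++ A5)) (windows (A1 ++ A4 ++ A3 ++ A2 ++ A5)).
Proof.
move=> s2 s3 s4 s5 e24 e35.
have expand B2 B3 B4 : r.-1 <= size B2 -> r.-1 <= size B3 -> r.-1 <= size B4 ->
    windows (A1 ++ B2 ++ B3 ++ B4 ++ A5) = windows (A1 ++ take r.-1 B2) ++
      windows (B2 ++ take r.-1 B3) ++ windows (B3 ++ take r.-1 B4) ++
      windows (B4 ++ take r.-1 A5) ++ windows A5.
  move=> b2 b3 b4; have szA B : r.-1 <= size B -> forall C, r.-1 <= size (B ++ C).
    by move=> rB C; rewrite size_cat (leq_trans rB)// leq_addr.
  rewrite (@windows_cat A1 (B2 ++ B3 ++ B4 ++ A5)) ?szA// takel_cat//; congr (_ ++ _).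
  rewrite (@windows_cat B2 (B3 ++ B4 ++ A5)) ?szA// takel_cat//; congr (_ ++ _).
  rewrite (@windows_cat B3 (B4 ++ A5)) ?szA// takel_cat//; congr (_ ++ _).
  exact: windows_cat.
rewrite !expand// e24 e35 perm_cat2l.
by apply/permP => p; rewrite !count_cat; lia.
Qed.

End Windows.

Section Words.
Local Open Scope nat_scope.
Variables n q : nat.
Implicit Types (s : config 1 n q).

Definition word s : seq 'I_q := [seq s [tuple x] | x <- enum 'I_n].

Lemma size_word s : size (word s) = n.
Proof. by rewrite size_map size_enum_ord. Qed.

Lemma tuple1E (v : Lambda 1 n) : v = [tuple tnth v ord0].
Proof. by apply: eq_from_tnth => i; rewrite !ord1. Qed.

Lemma nth_word x0 s (v : Lambda 1 n) : nth x0 (word s) (tnth v ord0) = s v.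
Proof.
rewrite (nth_map (tnth v ord0)) ?size_enum_ord ?ltn_ord// nth_ord_enum.
by rewrite -tuple1E.
Qed.

Lemma word_inj : injective word.
Proof.
move=> s s' e; apply/ffunP => v.
by have := congr1 (fun t => nth (s v) t (tnth v ord0)) e; rewrite !nth_word.
Qed.

Lemma word_ex (t : seq 'I_q) : 0 < n -> size t = n -> exists s, word s = t.
Proof.
move=> n0 tn; case: t tn => [|x0 t] tn; first by rewrite -tn in n0.
exists [ffun v : Lambda 1 n => nth x0 (x0 :: t) (tnth v ord0)].
apply: (@eq_from_nth _ x0) => [|i]; first by rewrite size_word.
rewrite size_word => iN; rewrite -[i]/(nat_of_ord (Ordinal iN)).
have := nth_word x0 [ffun v : Lambda 1 n => nth x0 (x0 :: t) (tnth v ord0)] [tuple Ordinal iN].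
by rewrite ffunE.
Qed.

End Words.

Section ProfileOfWord.
Local Open Scope nat_scope.
Variables n q r : nat.
Hypotheses (r0 : 0 < r) (rn : r <= n).

Lemma word_restrict (s : config 1 n q) (c : Lambda 1 n) : c \in boxes 1 n r ->
  word (Defs.restrict r s c) = take r (drop (tnth c ord0) (word s)).
Proof.
move=> cB; have cr := (boxesP _ _ cB) ord0.
have n0 : 0 < n by lia.
pose x0 := s [tuple Ordinal n0].
apply: (@eq_from_nth _ x0) => [|i].
  by rewrite size_word size_takel// size_drop size_word; lia.
rewrite size_word => ir; rewrite nth_take// nth_drop.
have := nth_word x0 (Defs.restrict r s c) [tuple Ordinal ir].
rewrite tnth0 /= => ->; rewrite ffunE -(nth_word x0) tnth_box_vertex//.
Qed.

Lemma perm_words (s : config 1 n q) :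
  perm_eq [seq word (Defs.restrict r s c) | c in boxes 1 n r] (windows r (word s)).
Proof.
rewrite /windows size_word.
have -> : [seq word (Defs.restrict r s c) | c in boxes 1 n r] =
    [seq take r (drop k (word s)) | k <- [seq corner c ord0 | c <- enum (boxes 1 n r)]].
  rewrite -map_comp; apply/eq_in_map => c; rewrite mem_enum => cB /=.
  exact: word_restrict.
apply: perm_map; apply: uniq_perm; last 1 first.
- move=> k; rewrite mem_iota /=; apply/mapP/idP => [[c]|kn].
    by rewrite mem_enum => /boxesP/(_ ord0) + ->; rewrite /corner; lia.
  have [|v vE] := @Lambda_ex 1 n (fun=> k); first by move=> _; lia.
  exists v; rewrite /corner ?vE// mem_enum; apply/boxesP => i; rewrite vE; lia.
- rewrite map_inj_uniq ?enum_uniq// => v v' e; apply: Lambda_eq => i.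
  by rewrite !ord1.
- exact: iota_uniq.
Qed.

Lemma profile_windows (s s' : config 1 n q) :
  perm_eq (windows r (word s)) (windows r (word s')) -> profile r s' = profile r s.
Proof.
move=> ww; apply/eq_seq_msetP; apply: (perm_map_inj (@word_inj r q)).
have e (t : config 1 n q) : [seq word B | B <- [seq Defs.restrict r t c | c in boxes 1 n r]] =
    [seq word (Defs.restrict r t c) | c in boxes 1 n r] by rewrite /image_mem -map_comp.
rewrite !e perm_sym (perm_trans (perm_words s))// (perm_trans ww)// perm_sym.
exact: perm_words.
Qed.

(** The blocks of length len at a and b coincide; stated with sums since the
    positions are natural numbers. *)
Definition agree (s : config 1 n q) len a b := forall v v' : Lambda 1 n,
  a <= tnth v ord0 < a + len -> tnth v' ord0 + a = tnth v ord0 + b -> s v = s v'.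

Lemma agree_take s len a b : a + len <= n -> b + len <= n -> agree s len a b ->
  take len (drop a (word s)) = take len (drop b (word s)).
Proof.
move=> an bn ab; case: (posnP len) => [->|len0]; first by rewrite !take0.
have n0 : 0 < n by lia.
pose x0 := s [tuple Ordinal n0].
apply: (@eq_from_nth _ x0) => [|i]; first by rewrite !size_takel ?size_drop ?size_word; lia.
rewrite size_takel ?size_drop ?size_word; last by lia.
move=> il; rewrite !nth_take// !nth_drop.
have [|v vE] := @Lambda_ex 1 n (fun=> a + i); first by move=> _; lia.
have [|v' v'E] := @Lambda_ex 1 n (fun=> b + i); first by move=> _; lia.
by rewrite -(vE ord0) -(v'E ord0) !nth_word; apply: ab; rewrite vE ?v'E; lia.
Qed.

Lemma take_agree s len a b : a + len <= n -> b + len <= n ->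
  take len (drop a (word s)) = take len (drop b (word s)) -> agree s len a b.
Proof.
move=> an bn e v v' va vv'; pose x0 := s v.
rewrite -(nth_word x0 s v) -(nth_word x0 s v').
have := congr1 (fun t => nth x0 t (tnth v ord0 - a)) e.
rewrite !nth_take; try by lia.
by rewrite !nth_drop subnKC; [move=> ->; congr (nth _ _ _)|]; lia.
Qed.

(** Exchanging the segments [a, b) and [a', b') keeps all windows. The result is
    a different word because the first g letters of the segments differ. *)
Lemma nonidentifiable_swap s g a b a' b' : r <= g ->
  a + g <= b -> b + g <= a' -> a' + g <= b' -> b' + g <= n ->
  agree s r a a' -> agree s r b b' -> ~ agree s g a a' -> nonidentifiable r s.
Proof.
move=> rg ab ba' a'b' b'n aa' bb' naa'; set t := word s.
have tn : size t = n by rewrite size_word.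
pose A1 := take a t; pose A2 := take (b - a) (drop a t).
pose A3 := take (a' - b) (drop b t); pose A4 := take (b' - a') (drop a' t).
pose A5 := drop b' t.
have sub x y : x <= y -> take (y - x) (drop x t) ++ drop y t = drop x t.
  by move=> xy; rewrite -[RHS](cat_take_drop (y - x)) drop_drop subnK.
have tE : t = A1 ++ A2 ++ A3 ++ A4 ++ A5.
  by rewrite /A5 /A4 sub ?/A3 ?sub ?/A2 ?sub ?cat_take_drop//; lia.
have sA2 : size A2 = b - a by rewrite size_takel// size_drop tn; lia.
have sA3 : size A3 = a' - b by rewrite size_takel// size_drop tn; lia.
have sA4 : size A4 = b' - a' by rewrite size_takel// size_drop tn; lia.
have sA5 : size A5 = n - b' by rewrite size_drop tn.
have e24 : take r A2 = take r A4.
  by rewrite !take_takel; [apply: agree_take => //| |]; lia.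
have e35 : take r A3 = take r A5.
  by rewrite take_takel; [apply: agree_take => //|]; lia.
have [||s' s't] := @word_ex n q (A1 ++ A4 ++ A3 ++ A2 ++ A5); first by lia.
  by rewrite -tn tE !size_cat; lia.
have pr (A : seq 'I_q) : take r.-1 A = take r.-1 (take r A) by rewrite take_takel// leq_pred.
exists s'; split.
  move=> ss'; apply: naa'; apply: take_agree; try by lia.
  have := s't; rewrite ss' -/t {1}tE => /eqP; rewrite eqseq_cat// eqxx /= => /eqP e.
  have := congr1 (take g) e; rewrite !takel_cat ?sA2 ?sA4; try by lia.
  by rewrite /A2 /A4 !take_takel//; lia.
have r1g : r.-1 <= g by lia.
apply: profile_windows; rewrite s't -/t tE; apply: windows_swap => //;
  [by rewrite sA2; lia|by rewrite sA3; lia|by rewrite sA4; lia|by rewrite sA5; lia|..].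
- by rewrite pr e24 -pr.
- by rewrite pr e35 -pr.
Qed.

End ProfileOfWord.

(** * Second moments and free labels *)

Section SecondMoment.
Local Open Scope ring_scope.

(** Chebyshev's inequality for the number Z of events that occur: as two of
    them are never positively correlated, Q Z has mean #|I| and its squared
    deviations from #|I| sum to at most Q #|I| #|T|. *)
Lemma second_moment (T I : finType) (E : I -> {set T}) (Q : nat) :
  (forall i, #|E i| * Q = #|T|)%N ->
  (forall i j, i != j -> #|E i :&: E j| * (Q * Q) <= #|T|)%N ->
  (#|[set s | [forall i, s \notin E i]]%SET| * #|I| <= Q * #|T|)%N.
Proof.
move=> E1 E2; set F := [set s | _]%SET.
case: (posnP #|I|) => [->|I0]; first by rewrite muln0.
have I0' : 0 < #|I|%:R :> rat by rewrite ltr0n.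
pose Z s : rat := \sum_i (s \in E i)%:R.
have card_sum (A : {set T}) : (#|A|)%:R = \sum_s (s \in A)%:R :> rat.
  by rewrite -sum1_card natr_sum big_mkcond/=; apply: eq_bigr => s _; case: (s \in A).
have Z1 : Q%:R * (\sum_s Z s) = #|I|%:R * #|T|%:R.
  rewrite exchange_big/= mulr_sumr (eq_bigr (fun=> #|T|%:R)) => [|i _].
    by rewrite sumr_const mulr_natl.
  by rewrite -card_sum mulrC -natrM E1.
have Z2 : Q%:R ^+ 2 * (\sum_s Z s ^+ 2) <=
    Q%:R * #|I|%:R * #|T|%:R + #|I|%:R ^+ 2 * #|T|%:R.
  have -> : \sum_s Z s ^+ 2 = \sum_i \sum_j (#|E i :&: E j|%:R : rat).
    rewrite (eq_bigr (fun s => \sum_i \sum_j (s \in E i :&: E j)%:R)) => [|s _].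
      by rewrite exchange_big; apply: eq_bigr => i _; rewrite exchange_big; apply: eq_bigr => j _.
    rewrite expr2 big_distrlr/=; apply: eq_bigr => i _; apply: eq_bigr => j _.
    by rewrite inE -natrM mulnb.
  have term i j : Q%:R ^+ 2 * #|E i :&: E j|%:R <=
      (if j == i then Q%:R * #|T|%:R else 0) + #|T|%:R :> rat.
    case: eqP => [->|/eqP ji].
      have e := E1 i; rewrite finset.setIid expr2 -mulrA -[Q%:R * #|E i|%:R]natrM mulnC e lerDl//.
    by rewrite add0r -natrX -natrM ler_nat mulnC -mulnn E2// eq_sym.
  rewrite mulr_sumr; apply: (@le_trans _ _ (\sum_(i : I) (Q%:R * #|T|%:R + #|I|%:R * #|T|%:R))).
    apply: ler_sum => i _; rewrite mulr_sumr (le_trans (ler_sum _ (fun j _ => term i j)))//.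
    by rewrite big_split/= -big_mkcond/= big_pred1_eq sumr_const -[#|T|%:R *+ _]mulr_natl.
  by rewrite sumr_const -[leLHS]mulr_natl le_eqVlt; apply/orP; left; apply/eqP; ring.
have low : #|F|%:R * #|I|%:R ^+ 2 <= \sum_s (Q%:R * Z s - #|I|%:R) ^+ 2.
  rewrite card_sum mulr_suml; apply: ler_sum => s _; rewrite inE.
  case: forallP => [nE|_]; last by rewrite mul0r sqr_ge0.
  have -> : Z s = 0 by rewrite /Z big1// => i _; rewrite (negbTE (nE i)).
  by rewrite mulr0 sub0r sqrrN mul1r.
have expand : \sum_s (Q%:R * Z s - #|I|%:R) ^+ 2 = Q%:R ^+ 2 * (\sum_s Z s ^+ 2)
    - #|I|%:R *+ 2 * (Q%:R * \sum_s Z s) + #|I|%:R ^+ 2 * #|T|%:R.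
  have -> : #|I|%:R ^+ 2 * #|T|%:R = \sum_(s : T) (#|I|%:R ^+ 2 : rat).
    by rewrite sumr_const mulr_natr.
  rewrite !mulr_sumr -sumrB -big_split/=; apply: eq_bigr => s _; ring.
move: low; rewrite expand Z1 => low.
have {}low : #|F|%:R * #|I|%:R ^+ 2 <= Q%:R * #|I|%:R * #|T|%:R :> rat.
  apply: le_trans low _; rewrite -lerBrDr -lerBrDr opprK.
  by apply: le_trans Z2 _; rewrite le_eqVlt; apply/orP; left; apply/eqP; ring.
rewrite -(ler_nat rat) !natrM -(ler_pM2r I0').
by apply: le_trans (le_trans low _); rewrite le_eqVlt; apply/orP; left; apply/eqP; ring.
Qed.

(** Any labeling can be corrected on X by copying along phi; it is recovered from
    the corrected labeling and its former labels on X. *)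
Lemma count_free (V : finType) (q : nat) (X : {set V}) (phi : V -> V) :
  (0 < q)%N -> (forall x, x \in X -> phi x \notin X) ->
  (q ^ #|V| <= #|[set s : {ffun V -> 'I_q} | [forall x in X, s x == s (phi x)]]%SET| * q ^ #|X|)%N.
Proof.
case: q => // q _ free; set F := [set s : {ffun V -> 'I_q.+1} | _]%SET.
pose f (s : {ffun V -> 'I_q.+1}) : {ffun V -> 'I_q.+1} * {ffun V -> 'I_q.+1} :=
  ([ffun v => if v \in X then s (phi v) else s v], [ffun v => if v \in X then s v else ord0]).
have f_inj : injective f.
  move=> s s' [/ffunP e1 /ffunP e2]; apply/ffunP => v.
  by have := e1 v; have := e2 v; rewrite !ffunE; case: ifP.
have : (#|f @: [set: {ffun V -> 'I_q.+1}]%SET| <=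
    #|[predX F & pffun_on (@ord0 q) (mem X) predT]|)%N.
  apply/subset_leq_card/fintype.subsetP => _ /imsetP[s _ ->]; rewrite !inE /=; apply/andP; split.
    apply/forall_inP => x xX; rewrite !ffunE xX ifN//; exact: free.
  apply/pffun_onP; split=> //; apply/supportP => v; rewrite ffunE => vX.
  by rewrite (negbTE vX).
by rewrite card_imset// cardsT card_ffun card_ord cardX card_pffun_on card_ord.
Qed.

End SecondMoment.

(** * Repeated blocks of a word *)

Section Agreement.
Local Open Scope nat_scope.
Variables n q : nat.
Hypothesis q0 : 0 < q.
Implicit Types (s : config 1 n q) (v : Lambda 1 n).
Local Notation total := (q ^ (n ^ 1)).

Definition block len a : {set Lambda 1 n} := cell n (fun=> a) (fun=> len).

Lemma blockP len a v : reflect (a <= tnth v ord0 < a + len) (v \in block len a).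
Proof.
apply: (iffP (cellP _ _ _)) => [/(_ ord0)//|h i].
by rewrite (ord1 i : i = ord0).
Qed.

Lemma card_block len a : a + len <= n -> #|block len a| = len.
Proof. by move=> an; rewrite card_cell ?big_ord1// => l; lia. Qed.

Definition jump a b : Lambda 1 n -> Lambda 1 n := move (fun=> n + b - a).

Lemma jumpE len a b v : a + len <= n -> b + len <= n -> v \in block len a ->
  tnth (jump a b v) ord0 = tnth v ord0 + b - a :> nat.
Proof.
by move=> an bn /blockP va; rewrite /jump moveE; have := ltn_ord (tnth v ord0); lia.
Qed.

Lemma mem_jump len a b v : a + len <= n -> b + len <= n -> v \in block len a ->
  jump a b v \in block len b.
Proof.
move=> an bn va; apply/blockP; rewrite (jumpE an bn va).
by move/blockP: va; lia.
Qed.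

Lemma agreeP s len a b : a + len <= n -> b + len <= n ->
  agree s len a b <-> forall v, v \in block len a -> s v = s (jump a b v).
Proof.
move=> an bn; split=> h.
  move=> v va; apply: h; first exact/blockP.
  by rewrite (jumpE an bn va); move/blockP: va; lia.
move=> v v' va vv'; have va' : v \in block len a by apply/blockP.
rewrite h//; congr (s _); apply: Lambda_eq => i; rewrite (ord1 i : i = ord0) (jumpE an bn va').
by lia.
Qed.

Lemma agree_sym s len a b : agree s len a b -> agree s len b a.
Proof. by move=> h v v' vb vv'; apply/esym/h; lia. Qed.

Definition apart len a b := a + len <= b \/ b + len <= a.

Lemma apart_notin len a b v : apart len a b -> v \in block len a -> v \notin block len b.
Proof. by move=> ab /blockP va; apply/blockP; case: ab; lia. Qed.

Lemma count_agree len a b : apart len a b -> a + len <= n -> b + len <= n ->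
  count (fun s => agree s len a b) * q ^ len = total.
Proof.
move=> ab an bn; have free v : v \in block len a -> jump a b v \notin block len a.
  move=> va; apply: (@apart_notin _ b); last exact: mem_jump va.
  by case: ab; [right|left].
apply/eqP; rewrite eqn_leq; apply/andP; split.
  apply: (count_forced_cells (X := block len a) (phi := jump a b)
    (rank := fun v => (v \in block len a) : nat)) => //.
  - by move=> s /(agreeP _ an bn).
  - by move=> v va; rewrite va (negbTE (free v va)).
  - by rewrite card_block.
have := count_free q0 free; rewrite card_block// card_Lambda => /leq_trans; apply.
rewrite leq_mul2r; apply/orP; right; apply/subset_leq_card/fintype.subsetP => s.
rewrite !inE => /forall_inP h; apply/(agreeP _ an bn) => v va.
exact/eqP/h.
Qed.

(** Two coincidences between blocks force two disjoint blocks when the blocks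
    forced are different and read off blocks outside them; so they are together
    no likelier than independent events. *)
Lemma count_agree2 len a1 b1 a2 b2 : apart len a1 a2 ->
  apart len a1 b1 -> apart len a1 b2 -> apart len a2 b1 -> apart len a2 b2 ->
  a1 + len <= n -> b1 + len <= n -> a2 + len <= n -> b2 + len <= n ->
  count (fun s => agree s len a1 b1 /\ agree s len a2 b2) * (q ^ len * q ^ len) <= total.
Proof.
move=> a12 a1b1 a1b2 a2b1 a2b2 a1n b1n a2n b2n.
have sym a b : apart len a b -> apart len b a by case; [right|left].
pose X := (block len a1 :|: block len a2)%SET.
pose phi v := if v \in block len a1 then jump a1 b1 v else jump a2 b2 v.
have free v : v \in X -> phi v \notin X.
  rewrite !finset.in_setU /phi; case: ifP => /= [va _|_ va].
    have vb := mem_jump a1n b1n va.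
    by rewrite negb_or !(apart_notin _ vb)//; apply: sym.
  have vb := mem_jump a2n b2n va.
  by rewrite negb_or !(apart_notin _ vb)//; apply: sym.
rewrite -expnD; apply: (count_forced_cells (X := X) (phi := phi)
  (rank := fun v => (v \in X) : nat)) => //.
- move=> s [/(agreeP _ a1n b1n) h1 /(agreeP _ a2n b2n) h2] v.
  by rewrite finset.in_setU /phi; case: ifP => [va _|_ /= va]; [exact: h1|exact: h2].
- by move=> v vX; rewrite vX (negbTE (free v vX)).
- rewrite cardsU !card_block// (_ : _ :&: _ = finset.set0)%SET ?cards0 ?subn0//.
  apply/setP => v; rewrite finset.in_setI finset.in_set0; apply/negbTE/negP => /andP[va].
  exact/negP/(apart_notin a12 va).
Qed.

Definition no_match r m a b s := forall k l : 'I_m, ~ agree s r (a + k * r) (b + l * r).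

(** Distinct pairs (k, l) and (k', l') differ in a component, and the blocks of
    that component can be taken as the forced ones. *)
Lemma count_no_match r m a b : a + m * r <= b -> b + m * r <= n ->
  count (no_match r m a b) * (m * m) <= q ^ r * total.
Proof.
move=> ab bn.
have kr (k : 'I_m) : k * r + r <= m * r by rewrite -mulSnr leq_mul2r ltn_ord orbT.
have kl (k l : 'I_m) : k != l -> k * r + r <= l * r \/ l * r + r <= k * r.
  by rewrite -!mulSnr !leq_mul2r neq_ltn => /orP[]->; rewrite orbT; [left|right].
pose E (i : 'I_m * 'I_m) : {set config 1 n q} :=
  [set s | `[< agree s r (a + i.1 * r) (b + i.2 * r) >]]%SET.
have tot : #|{: config 1 n q}| = total by rewrite card_ffun card_ord card_Lambda.
have -> : count (no_match r m a b) = #|[set s | [forall i, s \notin E i]]%SET|.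
  apply: eq_card => s; rewrite !inE; apply/asboolP/forallP => [h [k l]|h k l].
    by rewrite inE; apply/asboolPn/h.
  by have := h (k, l); rewrite inE => /asboolPn.
rewrite -tot; have := @second_moment _ _ E (q ^ r).
rewrite card_prod card_ord; apply.
- move=> [k l]; rewrite tot; apply: count_agree => /=; rewrite /apart; have := kr k; have := kr l; lia.
- move=> [k l] [k' l'] ne; rewrite tot.
  have k1 := kr k; have k2 := kr l; have k3 := kr k'; have k4 := kr l'.
  have [ll'|ll'] := eqVneq l l'.
    have kk' : k != k' by apply: contraNneq ne => ->; rewrite ll'.
    apply: leq_trans (@count_agree2 r (a + k * r) (b + l * r) (a + k' * r) (b + l' * r) _ _ _ _ _ _ _ _ _);
      rewrite /apart; try (have := kl _ _ kk'; lia).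
    rewrite leq_mul2r; apply/orP; right; apply/subset_leq_card/fintype.subsetP => s.
    by rewrite !inE => /andP[/asboolP h1 /asboolP h2].
  apply: leq_trans (@count_agree2 r (b + l * r) (a + k * r) (b + l' * r) (a + k' * r) _ _ _ _ _ _ _ _ _);
    rewrite /apart; try (have := kl _ _ ll'; lia).
  rewrite leq_mul2r; apply/orP; right; apply/subset_leq_card/fintype.subsetP => s.
  by rewrite !inE => /andP[/asboolP h1 /asboolP h2]; split; apply: agree_sym.
Qed.

Definition long_match g c s := exists i : 'I_g * 'I_g, agree s g i.1 (c + i.2).

Lemma count_long_match g c : 2 * g <= c -> c + 2 * g <= n ->
  count (long_match g c) * q ^ g <= g * g * total.
Proof.
move=> gc cn; have := @count_exists 1 n q ('I_g * 'I_g)%type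
  (fun i s => agree s g i.1 (c + i.2)) (q ^ g).
rewrite card_prod card_ord; apply => -[k l] /=.
by rewrite count_agree// /apart; have := ltn_ord k; have := ltn_ord l; lia.
Qed.

(** Blocks of length r are compared in four regions of length g, separated by
    gaps of length g. A coincidence between the first and the third region and
    one between the second and the fourth give an exchange, unless the first
    coincidence extends to length g. *)
Lemma count_identifiable_line g m r : 0 < r -> 0 < g -> m * r <= g -> r <= g -> 8 * g <= n ->
  count (fun s => ~ nonidentifiable r s) * (m * m) * q ^ g <=
  (2 * q ^ r * q ^ g + g * g * (m * m)) * total.
Proof.
move=> r0 g0 mrg rg gn.
have kr (k : 'I_m) : k * r + r <= m * r by rewrite -mulSnr leq_mul2r ltn_ord orbT.
have sub : count (fun s => ~ nonidentifiable r s) <= count (no_match r m 0 (4 * g)) +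
    count (no_match r m (2 * g) (6 * g)) + count (long_match g (4 * g)).
  apply: leq_trans (leq_trans (countU _ _) (leq_add (countU _ _) (leqnn _))).
  apply: countS => s; apply: contra_notP => /not_orP[/not_orP[n1 n2] n3].
  move/existsNP: n1 => [k /existsNP[l /contrapT h1]].
  move/existsNP: n2 => [k' /existsNP[l' /contrapT h2]].
  have := kr k; have := kr l; have := kr k'; have := kr l' => e1 e2 e3 e4.
  apply: (@nonidentifiable_swap n q r r0 _ s g _ _ _ _ _ _ _ _ _ h1 h2); try by lia.
  have kg : 0 + k * r < g by lia.
  have lg : l * r < g by lia.
  by move=> h; apply: n3; exists (Ordinal kg, Ordinal lg).
have c1 := @count_no_match r m 0 (4 * g); have c2 := @count_no_match r m (2 * g) (6 * g).
have c3 := @count_long_match g (4 * g).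
have {}c1 := c1 ltac:(lia) ltac:(lia).
have {}c2 := c2 ltac:(lia) ltac:(lia).
have {}c3 := c3 ltac:(lia) ltac:(lia).
rewrite -mulnA; apply: leq_trans (leq_mul sub (leqnn _)) _.
by move: c1 c2 c3; move: (count _) (count _) (count _) (q ^ g) (q ^ r) total => x1 x2 x3 A B N; nia.
Qed.

End Agreement.

(** * Asymptotics of the non-identifiable regime on the line *)

Section LineNonIdentifiable.
Variables (R : realType) (q : nat).
Hypothesis q2 : (2 <= q)%N.
Local Notation lq := (ln (q%:R : R)).

Lemma sqr_le_expR (x : R) : 0 <= x -> x ^+ 2 <= 4 * expR x.
Proof.
move=> x0; have -> : expR x = expR (x / 2) ^+ 2 by rewrite -expRM_natl; congr expR; field.
by have := expR_ge1Dx (x / 2); nra.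
Qed.

Lemma cube_le_expR (x : R) : 0 <= x -> x ^+ 3 <= 27 * expR x.
Proof.
move=> x0; have -> : expR x = expR (x / 3) ^+ 3 by rewrite -expRM_natl; congr expR; field.
have -> : x ^+ 3 = 27 * (x / 3) ^+ 3 by field.
rewrite ler_wpM2l// lerXn2r ?nnegrE ?expR_ge0 ?divr_ge0//.
by have := expR_ge1Dx (x / 3); lra.
Qed.

Lemma regions_and_blocks n r (g := (n %/ 8)%N) (m := (g %/ r)%N) :
  (0 < r)%N -> (16 * r + 16 <= n)%N ->
  [/\ [/\ 8 * g <= n, n <= 16 * g & r <= g], m * r <= g & n <= 16 * (m * r)]%N.
Proof.
move=> r0 n16; have [gn n8] : (8 * g <= n /\ n < 8 * g + 8)%N by rewrite /g; lia.
have rg : (r <= g)%N by lia.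
have gm : (g < m.+1 * r)%N by rewrite ltn_ceil.
have rm : (r <= m * r)%N by rewrite leq_pmull// divn_gt0.
rewrite mulSn in gm; split; [split|exact: leq_divM|]; move: gn n8 rg gm rm; clear; lia.
Qed.

(** With g of order n and m = g / r blocks in a region, the m ^ 2 pairs of blocks
    exceed q ^ r, which is at most n ^ (2 - 2 eps), by a positive power of n; long
    coincidences are exponentially rare. *)
Lemma whp_nonidentifiable_line (eps : R) (r : nat -> nat) : 0 < eps ->
  (forall n, (1 <= n)%N -> (1 <= r n <= n)%N) ->
  (\forall n \near \oo, (r n)%:R <= 2 * (1 - eps) * ln (n%:R : R) / ln (q%:R : R)) ->
  whp R (fun n => [set s : config 1 n q | nonidentifiable (r n) s]).
Proof.
move=> eps0 hr H; have l0 := lnq_gt0 R q2.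
pose C1 : R := 2 * (256 * (4 / lq ^+ 2)) * (4 / eps ^+ 2).
pose C2 : R := 27 * 16 / lq ^+ 3.
apply: (@whp_count R 1 q q2 _ (C1 + C2) eps) => //.
apply: filterS2 H (near_ln (Num.max 16 (4 * (16 + 32 / lq)))) => n H.
rewrite ge_max => /andP[X16 Xl].
have n0 : (0 < n)%N.
  by case: n X16 {H Xl} => // ; rewrite ln0// => h; exfalso; move: h; rewrite lern0.
have /andP[r0 rn] := hr n n0.
have nX : n%:R = expR (ln n%:R) :> R by exact: nat_expR.
set X := ln n%:R in H X16 Xl nX *.
have X0 : 0 <= X by lra.
have {}H : (r n)%:R * lq <= 2 * (1 - eps) * X by rewrite -ler_pdivlMr.
have r0R : 1 <= (r n)%:R :> R by rewrite ler1n.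
have eps1 : eps < 1.
  by rewrite ltNge; apply/negP => e1; have : 0 < (r n)%:R * lq; [nra|nra].
have q0 : (0 < q)%N by exact: leq_trans q2.
have rX : (r n)%:R * lq <= 2 * X by nra.
have rX' : (r n)%:R <= 2 / lq * X by rewrite mulrAC ler_pdivlMr.
have n16r : 16 * (r n)%:R + 16 <= n%:R :> R.
  rewrite nX; have := sqr_le_expR X0.
  have e32 : 32 / lq = 16 * (2 / lq) by field; rewrite gt_eqF.
  rewrite e32 in Xl; have : 0 <= X * (X - 4 * (16 + 16 * (2 / lq))) by rewrite mulr_ge0// subr_ge0.
  by lra.
have n16 : (16 * r n + 16 <= n)%N by rewrite -(ler_nat R) natrD natrM.
have := regions_and_blocks r0 n16; set g := (n %/ 8)%N; set m := (g %/ r n)%N.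
move=> [[gn g16 rg] mrg nmr]; have m0 : (0 < m)%N by rewrite divn_gt0.
have g0 : (0 < g)%N := leq_trans r0 rg.
have := count_identifiable_line q0 r0 g0 mrg rg gn.
set cnt := count _; rewrite -(ler_nat R) !natrM natrD !natrM => bad.
set N := (q ^ (n ^ 1))%:R in bad *.
set Q : R := (q ^ r n)%:R in bad; set G : R := (q ^ g)%:R in bad.
set M : R := m%:R in bad; set e := expR (- (eps * X)).
have N0 : 0 <= N by rewrite /N ler0n.
have M0 : 0 < M by rewrite /M ltr0n.
have GE : G = expR (g%:R * lq) by rewrite /G natX_expR.
have G0 : 0 < G by rewrite GE expR_gt0.
have nM : n%:R <= 16 * (M * (r n)%:R) :> R by rewrite -!natrM ler_nat.
have first_term : 2 * Q <= C1 * M ^+ 2 * e.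
  have QX : Q <= expR X ^+ 2 * e ^+ 2.
    rewrite /Q natX_expR// /e -!expRM_natl -expRD ler_expR.
    by apply: le_trans H _; rewrite le_eqVlt; apply/orP; left; apply/eqP; ring.
  have e1 : (eps * X) ^+ 2 * e <= 4.
    have := sqr_le_expR (mulr_ge0 (ltW eps0) X0).
    by rewrite -ler_pdivrMr ?expR_gt0// /e expRN.
  have e2 : X ^+ 2 * e <= 4 / eps ^+ 2.
    by rewrite ler_pdivlMr ?exprn_gt0//; move: e1; rewrite exprMn; lra.
  have sq : expR X ^+ 2 <= 256 * (4 / lq ^+ 2) * M ^+ 2 * X ^+ 2.
    have -> : 256 * (4 / lq ^+ 2) * M ^+ 2 * X ^+ 2 = (16 * (M * (2 / lq * X))) ^+ 2.
      by field; rewrite gt_eqF.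
    rewrite lerXn2r ?nnegrE ?expR_ge0 -?nX//.
      by rewrite !mulr_ge0// ?invr_ge0 ltW.
    by apply: le_trans nM _; rewrite ler_wpM2l// ler_wpM2l// ltW.
  have e0 : 0 <= e by rewrite expR_ge0.
  have K0 : 0 <= 256 * (4 / lq ^+ 2) * M ^+ 2.
    by rewrite !mulr_ge0// ?invr_ge0 ?exprn_ge0// ltW.
  have s1 := ler_wpM2r (exprn_ge0 2 e0) sq.
  have s2 := ler_wpM2l K0 (ler_wpM2r e0 e2).
  rewrite /C1; apply: (@le_trans _ _ (2 * (expR X ^+ 2 * e ^+ 2))); first by rewrite ler_wpM2l.
  by lra.
have second_term : g%:R * g%:R <= C2 * G * e.
  have s1 : (g%:R * lq) ^+ 3 <= 27 * G by rewrite GE cube_le_expR// mulr_ge0// ltW.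
  have s2 : g%:R ^+ 3 <= 27 / lq ^+ 3 * G.
    by rewrite mulrAC ler_pdivlMr ?exprn_gt0// -exprMn.
  have s3 : n%:R <= 16 * g%:R :> R by rewrite -natrM ler_nat.
  have s4 : g%:R * g%:R * expR X <= C2 * G.
    apply: (@le_trans _ _ (g%:R * g%:R * (16 * g%:R))).
      by rewrite -nX ler_wpM2l ?mulr_ge0.
    rewrite /C2; move: s2; lra.
  have e1 : expR (- X) <= e by rewrite ler_expR lerN2 ler_piMl// ltW.
  have -> : g%:R * g%:R = g%:R * g%:R * expR X * expR (- X) :> R.
    by rewrite -mulrA -expRD subrr expR0 mulr1.
  apply: le_trans (ler_wpM2r (expR_ge0 _) s4) _; rewrite ler_wpM2l//.
  by rewrite mulr_ge0 ?ltW// /C2 divr_gt0 ?exprn_gt0.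
have MG : 0 < M * M * G by rewrite !mulr_gt0.
rewrite -(ler_pM2r MG) mulrA; apply: le_trans bad _.
have -> : (C1 + C2) * e * N * (M * M * G) =
    (C1 * M ^+ 2 * e * G + C2 * G * e * (M * M)) * N by ring.
by rewrite ler_wpM2r// lerD// ler_wpM2r// ?mulr_ge0 ?ltW.
Qed.

End LineNonIdentifiable.

(** * Recovery and thresholds *)

Section Recovery.
Variables (R : realType) (d q : nat) (r : nat -> nat).
Hypothesis hr : forall n : nat, (1 <= n)%N -> (1 <= r n <= n)%N.

Lemma whp_identifiable : (2 <= q)%N ->
  whp R (fun n => [set s : config d.+1 n q | reconstructible (r n) s]) ->
  whp R (fun n => [set s : config d.+1 n q | identifiable (r n) s]).
Proof.
move=> q2; apply: whp_sub => //; exists 1%N => // n /= n1 s sr.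
by have /andP[r0 rn] := hr n1; exact: reconstructible_identifiable.
Qed.

Lemma recoverable_of_reconstructible : (2 <= q)%N ->
  whp R (fun n => [set s : config d.+1 n q | reconstructible (r n) s]) ->
  poly_time_recoverable R d.+1 q r.
Proof.
move=> q2 H; have [c pc cE] := @poly_time_feasible d q r _ hr (feasible_assemble d).
exists c; split=> //; apply: whp_sub H => //; exists 1%N => // n /= n1 s sr l ls.
have /andP[r0 rn] := hr n1; have [t ct] := cE n l; exists t.
by rewrite -encode_arr_of_config -(assembleE r0 rn ls sr).
Qed.

End Recovery.

Theorem theorem1p1 (R : realType) (d q : nat) (eps : R) (r : nat -> nat)
    (hd : (1 <= d)%N) (hq : (2 <= q)%N) (heps : 0 < eps)
    (hr : forall n : nat, (1 <= n)%N -> (1 <= r n <= n)%N) :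
  [/\ (* part 1 *)
      d = 1%N ->
        ((\forall n \near \oo,
            2 * (1 + eps) * ln (n%:R : R) / ln (q%:R : R) <= (r n)%:R) ->
          whp R (fun n => [set s : config d n q | identifiable (r n) s])) /\
        ((\forall n \near \oo,
            (r n)%:R <= 2 * (1 - eps) * ln (n%:R : R) / ln (q%:R : R)) ->
          whp R (fun n => [set s : config d n q | nonidentifiable (r n) s])),
      (* part 2 *)
      (2 <= d)%N ->
        ((\forall n \near \oo,
            d%:R * (1 + eps) * ln (n%:R : R) / ln (q%:R : R)
              <= (r n)%:R ^+ d) ->
          whp R (fun n => [set s : config d n q | identifiable (r n) s])) /\
        ((\forall n \near \oo,
            (r n)%:R ^+ d
              <= d%:R * (1 - eps) * ln (n%:R : R) / ln (q%:R : R)) ->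
          whp R (fun n => [set s : config d n q | nonidentifiable (r n) s]))
    & (* part 3 *)
      (d = 1%N /\
        (\forall n \near \oo,
            2 * (1 + eps) * ln (n%:R : R) / ln (q%:R : R) <= (r n)%:R)) \/
      ((2 <= d)%N /\
        (\forall n \near \oo,
            d%:R * (1 + eps) * ln (n%:R : R) / ln (q%:R : R)
              <= (r n)%:R ^+ d)) ->
        poly_time_recoverable R d q r].
Proof.
split.
- move=> d1; subst d; split=> H; last exact: whp_nonidentifiable_line heps hr H.
  by apply: whp_identifiable => //; exact: whp_reconstructible_line heps hr H.
- move=> d2; split=> H; last exact: whp_nonidentifiable_space heps hr H.
  case: d hd d2 H => // d _ d2 H.
  by apply: whp_identifiable => //; exact: whp_reconstructible_space d2 heps hr H.
- case=> [[d1 H]|[d2 H]].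
    subst d; apply: recoverable_of_reconstructible => //.
    exact: whp_reconstructible_line heps hr H.
  case: d hd d2 H => // d _ d2 H; apply: recoverable_of_reconstructible => //.
  exact: whp_reconstructible_space d2 heps hr H.
Qed.
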